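(* Let $n\geqslant 4$, let $\Gamma$ be an admissible graph with $n$ half-edges and let $\ell=(\ell_1,\dots,\ell_n)$ be an $n$-tuple of non-negative integers. Then the operators $H_{a,\ell}:\mathcal H_\ell\to\mathcal H_\ell$, where $a$ runs over the internal edges of $\Gamma$, mutually commute. The joint eigenvalues of these operators are the $(n-3)$-tuples $$\bigl(\varphi(a)(\varphi(a)+2)\bigr)_{a\in E_{\mathrm{int}}(\Gamma)}$$ where $\varphi$ runs over the admissible colorings of $\Gamma$ such that $\varphi(i)=\ell_i$ for every half-edge $i$. Each joint eigenvalue is simple. Furthermore, if $\Gamma$ is the graph associated to a parenthesising of $V_{\ell_1}\otimes\cdots\otimes V_{\ell_n}$, then the joint eigenspace associated to the coloring $\varphi$ is the line $D_\varphi$ of the decomposition of $\mathcal H_\ell$ induced by this parenthesising.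
   Context: $V_m$ is the irreducible representation of $SU(2)$ of dimension $m+1$, and $\mathcal H_\ell=(V_{\ell_1}\otimes\cdots\otimes V_{\ell_n})^{SU(2)}$ is the subspace of invariants for the diagonal action. The invariant scalar product on $\mathfrak{su}(2)$ is $\langle\xi,\eta\rangle=-\frac12\operatorname{tr}(\xi\eta)$. An admissible graph is a connected, acyclic, trivalent graph, in which edges with only one endpoint (half-edges) are permitted; the other edges have two endpoints and are called internal edges. The half-edges are numbered $1,\dots,n$. $E_{\mathrm{int}}(\Gamma)$ is the set of internal edges (it has $n-3$ elements). A coloring is an assignment of a non-negative integer to each edge. Three non-negative integers $p,q,m$ satisfy the Clebsch-Gordan condition if $p+q+m$ is even and $p\leqslant q+m$, $q\leqslant m+p$, $m\leqslant p+q$. A coloring is admissible if at each vertex the colors of the three incident edges satisfy the Clebsch-Gordan condition. For a finite-dimensional representation $\rho$ of $SU(2)$, the Casimir operator is $Q=-(\rho(\xi_1)^2+\rho(\xi_2)^2+\rho(\xi_3)^2)$ with $(\xi_i)$ an orthonormal basis of $\mathfrak{su}(2)$ (it acts by $m(m+2)$ on $V_m$). For $I\subset\{1,\dots,n\}$, $Q_{I,\ell}$ is the Casimir operator of the representation of $SU(2)$ on $V_{\ell_1}\otimes\cdots\otimes V_{\ell_n}$ in which $g$ acts diagonally on the factors with index in $I$ and trivially on the other factors; $Q_{I,\ell}$ preserves $\mathcal H_\ell$, and $Q_{I,\ell}$ and $Q_{I^c,\ell}$ have the same restriction to $\mathcal H_\ell$. For an internal edge $a$, choose a direction and let $I(a)$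 be the set of half-edges connected to the initial vertex of $a$ by a path not containing the terminal vertex of $a$. $H_{a,\ell}$ is the restriction of $Q_{I(a),\ell}$ to $\mathcal H_\ell$; it does not depend on the direction of $a$. A parenthesising of the product of $n$ factors determines a binary tree with $n$ leaves numbered by the factors, $n-2$ trivalent vertices and one bivalent vertex (the root). The associated admissible graph is obtained by removing the leaves (so that edges ending at leaves become half-edges) and the root, merging the two edges incident to the root into one edge. Decomposing successively the partial products in the order prescribed by the brackets, with $V_p\otimes V_q=\bigoplus V_m$ (sum over $m$ such that $(m,p,q)$ satisfies the Clebsch-Gordan condition), and finally taking the invariant part, one obtains a decomposition of $\mathcal H_\ell$ as a direct sum of lines $D_\varphi$, indexed by the admissible colorings $\varphi$ of the associated graph with $\varphi(i)=\ell_i$ for each half-edge $i$: $\varphi(a)$ is the index $m$ of the irreducible summand $V_m$ selected in the partial product corresponding to the edge $a$. *)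

(* Defs.v *)
From HB Require Import structures.
From mathcomp Require Import all_boot all_order all_algebra.
From mathcomp Require Import complex.
From mathcomp Require Import boolp classical_sets reals topology normedtype.
From mathcomp Require Import sequences derive.

Set Implicit Arguments.
Unset Strict Implicit.
Unset Printing Implicit Defensive.

Import Order.TTheory GRing.Theory Num.Theory.
Import numFieldNormedType.Exports.

Local Open Scope complex_scope.
Local Open Scope sesquilinear_scope.
Local Open Scope ring_scope.

(* The complex numbers are R[i] for
   R : realType, and C^T is modelled by {ffun T -> R[i]^o} for a finite type T,
   a vectType over R[i] whose standard basis is indexed by T. *)
Definition vec (R : realType) (T : finType) := {ffun T -> R[i]^o}.

(** * SU(2), su(2), and the differential of a representation *)

Definition SU2 (R : realType) (g : 'M[R[i]]_2) : bool :=
  (g \is unitarymx) && (\det g == 1).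

Definition su2 (R : realType) (x : 'M[R[i]]_2) : bool :=
  (x^t* == - x) && (\tr x == 0).

Definition su2_dot (R : realType) (x y : 'M[R[i]]_2) : R[i] :=
  - (2%:R^-1 * \tr (x *m y)).

(* su(2) has real dimension 3, so such a triple is an orthonormal basis. *)
Definition su2_orthonormal (R : realType) (xi : 'I_3 -> 'M[R[i]]_2) : Prop :=
  (forall i, su2 (xi i)) /\ (forall i j, su2_dot (xi i) (xi j) = (i == j)%:R).

(* Limits and derivatives of complex-valued functions of a natural / real
   variable are taken on real and imaginary parts. *)
Definition clim (R : realType) (u : nat -> R[i]) : R[i] :=
  (limn (fun k => complex.Re (u k)) : R) +i*
  (limn (fun k => complex.Im (u k)) : R).

Definition cderive0 (R : realType) (f : R -> R[i]) : R[i] :=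
  derive1 (fun t : R => complex.Re (f t)) 0 +i*
  derive1 (fun t : R => complex.Im (f t)) 0.

Definition expmx (R : realType) (A : 'M[R[i]]_2) : 'M[R[i]]_2 :=
  \matrix_(i, j) clim (fun N => (\sum_(k < N) (k`!%:R)^-1 *: A ^+ k) i j).

(* A representation of SU(2) on C^T; only the values on SU(2) matter. *)
Definition rep (R : realType) (T : finType) := 'M[R[i]]_2 -> 'End(vec R T).

(* rho(xi) = d/dt rho(exp(t xi)) at t = 0, for xi in su(2). *)
Definition drep (R : realType) (T : finType) (rho : rep R T)
    (x : 'M[R[i]]_2) : 'End(vec R T) :=
  linfun (fun v : vec R T => [ffun a : T =>
    cderive0 (fun t : R => rho (expmx (t%:C%C *: x)) v a)] : vec R T).

Definition casimir (R : realType) (T : finType) (xi : 'I_3 -> 'M[R[i]]_2)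
    (rho : rep R T) : 'End(vec R T) :=
  - \sum_(i < 3) (drep rho (xi i) \o drep rho (xi i))%VF.

(* The smallest subspace containing the set A. *)
Lemma vspan_exists (K : fieldType) (V : vectType K) (A : set V) :
  exists U : {vspace V}, (forall v, A v -> v \in U) /\
    (forall W : {vspace V}, (forall v, A v -> v \in W) -> (U <= W)%VS).
Proof.
pose P (d : nat) := `[< exists s : seq V, (forall v, v \in s -> A v) /\
  \dim <<s>> = d >].
have exP : exists d, P d.
  by exists (\dim <<[::] : seq V>>)%VS; apply/asboolP; exists [::].
have boundP d : P d -> (d <= \dim {:V})%N.
  by move=> /asboolP[s [_ <-]]; apply/dimvS/subvf.
case: (ex_maxnP exP boundP) => d /asboolP[s [sA sd]] dmax.
exists <<s>>%VS; split=> [v Av|W AW]; last by apply/span_subvP => v /sA /AW.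
have sub : (<<s>> <= <<v :: s>>)%VS by rewrite span_cons addvSr.
have : (\dim <<v :: s>> <= \dim <<s>>)%N.
  rewrite sd; apply: dmax; apply/asboolP; exists (v :: s); split=> // w.
  by rewrite inE => /predU1P[->//|/sA].
rewrite (geq_leqif (dimv_leqif_sup sub)) => svs.
by apply: (subvP svs); rewrite memv_span ?mem_head.
Qed.

Definition vspan (K : fieldType) (V : vectType K) (A : set V) : {vspace V} :=
  projT1 (cid (vspan_exists A)).

Definition invariants (R : realType) (T : finType) (rho : rep R T) :
    {vspace vec R T} :=
  vspan [set v | forall g, SU2 g -> rho g v = v].

Lemma invariantsP (R : realType) (T : finType) (rho : rep R T) (v : vec R T) :
  v \in invariants rho <-> (forall g, SU2 g -> rho g v = v).
Proof.
rewrite /invariants /vspan; case: cid => U /= [inU minU]; split=> [vU g gSU|].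
  have: (U <= lker (rho g - \1%VF))%VS.
    apply: minU => w wP.
    by rewrite memv_ker !lfun_simp wP // subrr.
  move=> /subvP/(_ v vU).
  by rewrite memv_ker !lfun_simp subr_eq0 => /eqP.
by move=> vP; apply: inU.
Qed.

(** * The irreducible representations V_m and tensor products *)

Definition kernel_op (R : realType) (T : finType) (K : T -> T -> R[i]) :
    'End(vec R T) :=
  linfun (fun v : vec R T =>
    [ffun a : T => \sum_(b : T) K a b * v b] : vec R T).

(* V_m is the space of homogeneous polynomials P(z, w) of degree m, where
   (g P)(z, w) = P((z, w) g).  In the basis z^k w^(m - k), k = 0, ..., m, the
   column k of the matrix of g lists the coefficients of
   (g_00 z + g_10 w)^k (g_01 z + g_11 w)^(m - k), here with z = 'X and w = 1. *)
Definition irrmx (R : realType) (m : nat) (g : 'M[R[i]]_2) (j k : 'I_m.+1) :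
    R[i] :=
  ((g ord0 ord0 *: 'X + (g ord_max ord0)%:P) ^+ k *
   (g ord0 ord_max *: 'X + (g ord_max ord_max)%:P) ^+ (m - k))`_j.

Definition irr (R : realType) (m : nat) : rep R 'I_m.+1 :=
  fun g => kernel_op (@irrmx R m g).

(* The tensor product of the V_(l i), i < n, is C^T with T the type of
   multi-indices f, f i <= l i. *)
Definition multi_index (n : nat) (l : 'I_n -> nat) : finType :=
  {dffun forall i : 'I_n, 'I_(l i).+1}.

Definition tensor_rep (R : realType) (n : nat) (l : 'I_n -> nat)
    (I : {set 'I_n}) : rep R (multi_index l) :=
  fun g => kernel_op (fun a b : multi_index l => \prod_(i < n)
    (if i \in I then irrmx g (a i) (b i) else (a i == b i)%:R)).

Definition Hinv (R : realType) (n : nat) (l : 'I_n -> nat) :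
    {vspace vec R (multi_index l)} :=
  invariants (@tensor_rep R n l [set: 'I_n]).

Definition Qop (R : realType) (xi : 'I_3 -> 'M[R[i]]_2) (n : nat)
    (l : 'I_n -> nat) (I : {set 'I_n}) : 'End(vec R (multi_index l)) :=
  casimir xi (@tensor_rep R n l I).

(* vsproj is a retraction of vsval; as Q_I preserves Hinv, this is the
   restriction of Q_I to Hinv. *)
Definition Qres (R : realType) (xi : 'I_3 -> 'M[R[i]]_2) (n : nat)
    (l : 'I_n -> nat) (I : {set 'I_n}) : 'End(subvs_of (@Hinv R n l)) :=
  linfun (fun v => vsproj (@Hinv R n l) (Qop xi l I (vsval v))).

(** * Graphs with half-edges *)

(* An internal edge a has the two endpoints ends a false and ends a true; this
   labelling is arbitrary. Loops and multiple edges are allowed here. *)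
Record graph (n : nat) := Graph {
  vert : finType;
  iedge : finType;
  ends : iedge -> bool -> vert;
  half : 'I_n -> vert }.

Definition edge (n : nat) (G : graph n) : Type := (iedge G + 'I_n)%type.

(* A dart is an internal edge with a direction: (a, s) goes from ends a s to
   ends a (~~ s). *)
Definition dart (n : nat) (G : graph n) : finType := (iedge G * bool)%type.

Definition dsrc (n : nat) (G : graph n) (d : dart G) : vert G := ends d.1 d.2.

Definition dtgt (n : nat) (G : graph n) (d : dart G) : vert G :=
  ends d.1 (~~ d.2).

(* A flag is an end of an edge: an internal edge has two, a half-edge one. *)
Definition flag (n : nat) (G : graph n) : finType := (dart G + 'I_n)%type.

Definition fvert (n : nat) (G : graph n) (f : flag G) : vert G :=
  match f with inl d => dsrc d | inr i => half G i end.

Definition fedge (n : nat) (G : graph n) (f : flag G) : edge G :=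
  match f with inl d => inl d.1 | inr i => inr i end.

Definition adj (n : nat) (G : graph n) : rel (vert G) :=
  fun u v => [exists d : dart G, (dsrc d == u) && (dtgt d == v)].

Definition trivalent (n : nat) (G : graph n) : Prop :=
  forall v : vert G, #|[set f : flag G | fvert f == v]| = 3.

Definition connected_graph (n : nat) (G : graph n) : Prop :=
  (exists v : vert G, True) /\ (forall u v : vert G, connect (@adj n G) u v).

(* There is no simple cycle: no closed walk, of positive length, with distinct
   vertices and distinct edges. *)
Definition acyclic_graph (n : nat) (G : graph n) : Prop :=
  forall c : seq (dart G), cycle (fun d e => dtgt d == dsrc e) c ->
    uniq [seq dsrc d | d <- c] -> uniq [seq d.1 | d <- c] -> c = [::].

Definition admissible_graph (n : nat) (G : graph n) : Prop :=
  [/\ connected_graph G, acyclic_graph G & trivalent G].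

Definition clebsch_gordan (p q m : nat) : bool :=
  [&& ~~ odd (p + q + m), (p <= q + m)%N, (q <= m + p)%N & (m <= p + q)%N].

Definition admissible_coloring (n : nat) (G : graph n)
    (phi : edge G -> nat) : Prop :=
  forall f1 f2 f3 : flag G, uniq [:: f1; f2; f3] ->
    fvert f1 = fvert f2 -> fvert f2 = fvert f3 ->
    clebsch_gordan (phi (fedge f1)) (phi (fedge f2)) (phi (fedge f3)).

(* I(a), for a directed internal edge. *)
Definition Iset (n : nat) (G : graph n) (d : dart G) : {set 'I_n} :=
  [set i | connect
     [rel u v | [&& adj u v, u != dtgt d & v != dtgt d]] (dsrc d) (half G i)].

Definition Hop (R : realType) (xi : 'I_3 -> 'M[R[i]]_2) (n : nat)
    (l : 'I_n -> nat) (G : graph n) (d : dart G) :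
    'End(subvs_of (@Hinv R n l)) :=
  Qres xi l (Iset d).

(* dir chooses a direction for each internal edge. *)
Definition joint_eigenspace (R : realType) (xi : 'I_3 -> 'M[R[i]]_2) (n : nat)
    (l : 'I_n -> nat) (G : graph n) (dir : iedge G -> bool)
    (mu : iedge G -> R[i]) : {vspace subvs_of (@Hinv R n l)} :=
  (\bigcap_(a : iedge G) passmx.leigenspace (Hop xi l (a, dir a)) (mu a))%VS.

Definition joint_eigenvalue (R : realType) (xi : 'I_3 -> 'M[R[i]]_2) (n : nat)
    (l : 'I_n -> nat) (G : graph n) (dir : iedge G -> bool)
    (mu : iedge G -> R[i]) : Prop :=
  joint_eigenspace xi l dir mu != 0%VS.

Definition color_eigenvalue (R : realType) (n : nat) (G : graph n)
    (phi : edge G -> nat) (a : iedge G) : R[i] :=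
  (phi (inl a) * (phi (inl a) + 2))%:R.

(** * Parenthesisings *)

Inductive btree (n : nat) : Type :=
  | Leaf of 'I_n
  | Node of btree n & btree n.

Fixpoint leaves (n : nat) (t : btree n) : seq 'I_n :=
  match t with Leaf i => [:: i] | Node x y => leaves x ++ leaves y end.

(* The factors occur exactly once each, from left to right. *)
Definition parenthesising (n : nat) (t : btree n) : Prop :=
  leaves t = enum 'I_n.

Definition is_node (n : nat) (t : btree n) : bool :=
  if t is Node _ _ then true else false.

Fixpoint subtree (n : nat) (s t : btree n) : Prop :=
  s = t \/ match t with
           | Leaf _ => False
           | Node x y => subtree s x \/ subtree s y
           end.

Definition child (n : nat) (s t : btree n) : Prop :=
  match t with Leaf _ => False | Node x y => s = x \/ s = y end.

(* In a parenthesising the leaves have distinct labels, so that distinct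
   vertices of the tree carry distinct subtrees: the vertices other than the
   root are identified with the proper subtrees, and so are the edges, through
   their lower ends. *)
Definition proper_subtree (n : nat) (s t : btree n) : Prop :=
  match t with Leaf _ => False | Node x y => subtree s x \/ subtree s y end.

Definition incident (n : nat) (G : graph n) (e : edge G) (v : vert G) : Prop :=
  match e with
  | inl a => exists s, ends a s = v
  | inr i => half G i = v
  end.

(* G is the graph associated with t: nv identifies the trivalent vertices of t
   with the vertices of G, and ne the edges of t with those of G, the two edges
   at the root being merged and the edge ending at the leaf i being the
   half-edge i. *)
Record associated (n : nat) (t : btree n) (G : graph n)
    (nv : btree n -> vert G) (ne : btree n -> edge G) : Prop := Associated {
  nv_inj : forall s s', proper_subtree s t -> is_node s ->
    proper_subtree s' t -> is_node s' -> nv s = nv s' -> s = s';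
  nv_surj : forall v, exists s, [/\ proper_subtree s t, is_node s & nv s = v];
  ne_eq : forall s s', proper_subtree s t -> proper_subtree s' t ->
    (ne s = ne s' <-> [\/ s = s', t = Node s s' | t = Node s' s]);
  ne_surj : forall e, exists s, proper_subtree s t /\ ne s = e;
  ne_leaf : forall i, proper_subtree (Leaf i) t -> ne (Leaf i) = inr i;
  ne_incident : forall s s', proper_subtree s t -> proper_subtree s' t ->
    is_node s' ->
    (incident (ne s) (nv s') <-> exists s'',
       [/\ proper_subtree s'' t, ne s'' = ne s & s'' = s' \/ child s'' s']) }.

(** * The decomposition of Hinv induced by a parenthesising *)

Definition tens_vec (R : realType) (S T : finType) (u : vec R S)
    (v : vec R T) : vec R (S * T)%type :=
  [ffun ab : S * T => u ab.1 * v ab.2].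

Definition tens_space (R : realType) (S T : finType) (U : {vspace vec R S})
    (W : {vspace vec R T}) : {vspace vec R (S * T)%type} :=
  vspan [set w | exists u v, [/\ u \in U, v \in W & w = tens_vec u v]].

(* The coefficients of an operator in the standard basis of C^T. *)
Definition coef_op (R : realType) (T : finType) (f : 'End(vec R T))
    (a b : T) : R[i] :=
  f [ffun c => (c == b)%:R] a.

Definition tens_rep (R : realType) (S T : finType) (rho : rep R S)
    (sigma : rep R T) : rep R (S * T)%type :=
  fun g => kernel_op (fun ab cd : S * T =>
    coef_op (rho g) ab.1 cd.1 * coef_op (sigma g) ab.2 cd.2).

(* The sum of the images of all intertwining maps from V_m into the subspace W.
   When W is isomorphic to the tensor product of V_p and V_q, which is
   multiplicity-free, it is the summand of W isomorphic to V_m. *)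
Definition isotypic (R : realType) (T : finType) (rho : rep R T) (m : nat)
    (W : {vspace vec R T}) : {vspace vec R T} :=
  vspan [set w | exists f : 'Hom(vec R 'I_m.+1, vec R T),
    [/\ forall g v, SU2 g -> f (irr m g v) = rho g (f v),
        (limg f <= W)%VS & w \in limg f]].

Fixpoint tree_index (n : nat) (l : 'I_n -> nat) (t : btree n) : finType :=
  match t with
  | Leaf i => 'I_(l i).+1
  | Node x y => (tree_index l x * tree_index l y)%type
  end.

(* The tensor product of the V_(l i) along the leaves of t, bracketed as t. *)
Fixpoint tree_rep (R : realType) (n : nat) (l : 'I_n -> nat) (t : btree n) :
    rep R (tree_index l t) :=
  match t return rep R (tree_index l t) with
  | Leaf i => @irr R (l i)
  | Node x y => tens_rep (tree_rep l x) (tree_rep l y)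
  end.

(* c s is the index of the irreducible summand selected in the partial product
   given by the subtree s; partial_space is that summand. *)
Fixpoint partial_space (R : realType) (n : nat) (l : 'I_n -> nat)
    (c : btree n -> nat) (t : btree n) : {vspace vec R (tree_index l t)} :=
  match t return {vspace vec R (tree_index l t)} with
  | Leaf i => fullv
  | Node x y => isotypic (tree_rep l (Node x y)) (c (Node x y))
      (tens_space (partial_space R l c x) (partial_space R l c y))
  end.

Fixpoint tree_of_multi (n : nat) (l : 'I_n -> nat) (f : multi_index l)
    (t : btree n) : tree_index l t :=
  match t return tree_index l t with
  | Leaf i => f i
  | Node x y => (tree_of_multi f x, tree_of_multi f y)
  end.

(* The associativity isomorphism from the bracketed tensor product. *)
Definition unbracket (R : realType) (n : nat) (l : 'I_n -> nat) (t : btree n) :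
    'Hom(vec R (tree_index l t), vec R (multi_index l)) :=
  linfun (fun v : vec R (tree_index l t) =>
    [ffun f : multi_index l => v (tree_of_multi f t)]
      : vec R (multi_index l)).

(* The line D_phi: at the root one takes the invariant part of the product of
   the two summands selected so far. *)
Definition Dline (R : realType) (n : nat) (l : 'I_n -> nat) (t : btree n)
    (c : btree n -> nat) : {vspace vec R (multi_index l)} :=
  match t with
  | Leaf i => 0%VS
  | Node x y => (unbracket R l (Node x y) @:
      (invariants (tree_rep l (Node x y)) :&:
       tens_space (partial_space R l c x) (partial_space R l c y)))%VS
  end.

(* Main.v *)
From HB Require Import structures.
Require Import Defs.
From mathcomp Require Import all_boot all_order all_algebra.
From mathcomp Require Import complex.
From mathcomp Require Import boolp classical_sets reals topology normedtype.
From mathcomp Require Import sequences derive realfun exp trigo.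
From mathcomp Require Import ring lra zify.

Set Implicit Arguments.
Unset Strict Implicit.
Unset Printing Implicit Defensive.

Import Order.TTheory GRing.Theory Num.Theory.
Import numFieldNormedType.Exports.

(** Everything happens at the level of Lie algebras. An element of SU(2) is
   exp (t x) = cos t + sin t x for some x in su(2) of norm one ([SU2_rotation]),
   so a linear map that commutes with the differentials of two representations
   intertwines them ([intertwine_lie_group]), and the differential of V_m is an
   explicit triple E, F, H of operators satisfying the relations of sl(2).
   Orthonormality turns the Casimir operator into H^2 + 2 E F + 2 F E
   ([cas_sl2]), which is m (m + 2) on V_m.

   The product of V_p and V_q contains, for each r <= min (p, q), an explicit
   lowest weight vector of weight - (p + q - 2 r), and this vector generates a
   copy of V_(p + q - 2 r). These copies belong to distinct eigenvalues of the
   Casimir operator and their dimensions add up to (p + 1) (q + 1), so they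
   decompose the product ([cg_full]). Iterating along a bracketing, the summand
   selected by a coloring c is a copy of V_(c t), the summands span, and on each
   of them the Casimir operator of the leaves of a subtree s is the scalar
   c s (c s + 2). The invariant vectors are those of color 0 at the root: hence
   the lines D_c span H_l ([Dline_span]), and on D_c the operators attached to
   the subtrees are scalars ([Dline_Qop]).

   The rest matches graphs with trees. In an acyclic graph an internal edge is a
   bridge; inserting a root in the middle of one of them turns the graph into a
   tree whose proper subtrees hang from the edges directed away from the root
   ([below], [rooted_at]). The leaves of the subtree hanging from an edge a are
   the half-edges on one side of a, and on invariant vectors it does not matter
   which side is used, because there the two partial actions are opposite
   ([Qop_compl]). All the H_a are thus diagonal along the lines D_c, so they
   commute. As m (m + 2) determines m, the eigenvalues determine c; so the joint
   eigenspaces are exactly the lines D_c ([joint_space_Dline]), and the colorings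
   c of the tree are the admissible colorings of the graph
   ([joint_eigenvalue_coloring]). When the graph is associated with another
   bracketing t, the proper subtrees of t also hang from edges of the graph
   ([associated_below]); the line attached to t is then contained in a joint
   eigenspace, and both have dimension one. *)

(** * Subtrees *)

Section SubTrees.
Variable n : nat.
Implicit Types s t x y : btree n.

Lemma subtree_refl t : subtree t t.
Proof. by case: t => [i|x y]; left. Qed.

Lemma subtree_leaves s t : subtree s t -> {subset leaves s <= leaves t}.
Proof.
elim: t => [i|x IHx y IHy] /=; first by case=> [-> //|[]].
case=> [-> //|[/IHx sx|/IHy sy]] i si; rewrite mem_cat ?(sx i) ?(sy i) ?orbT //.
Qed.

Lemma leaves_neq0 t : exists i, i \in leaves t.
Proof.
elim: t => [i|x [i ix] y _] /=; first by exists i; rewrite mem_head.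
by exists i; rewrite mem_cat ix.
Qed.

End SubTrees.

(** * Cutting an acyclic graph at an edge *)

Lemma connect_ind (T : finType) (e : rel T) (P : T -> Prop) u w :
  connect e u w -> P u -> (forall v v', e v v' -> P v -> P v') -> P w.
Proof.
case/connectP => p + ->; elim: p u => [|v p IH] u //= /andP[uv vp] Pu step.
exact: (IH v vp (step _ _ uv Pu) step).
Qed.

Section Graph.
Variables (n : nat) (G : graph n).
Implicit Types (d e k : dart G) (a : iedge G) (u v w : vert G) (f g : flag G).
Implicit Types (x y z s t : btree n).

Definition drev d : dart G := (d.1, ~~ d.2).

Lemma drevK d : drev (drev d) = d.
Proof. by case: d => a s; rewrite /drev /= negbK. Qed.

Lemma dsrc_drev d : dsrc (drev d) = dtgt d.
Proof. by []. Qed.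

Lemma dtgt_drev d : dtgt (drev d) = dsrc d.
Proof. by rewrite -[in RHS](drevK d). Qed.

Lemma same_edge d e : d.1 = e.1 -> d = e \/ d = drev e.
Proof.
case: d e => a s [b r] /= ->; rewrite /drev /=.
by case: s r => [] []; [left|right|right|left].
Qed.

Definition adj_off a : rel (vert G) := fun u v =>
  [exists d : dart G, [&& d.1 != a, dsrc d == u & dtgt d == v]].

Lemma adj_offP a u v :
  reflect (exists2 d, d.1 != a & dsrc d = u /\ dtgt d = v) (adj_off a u v).
Proof.
apply: (iffP existsP) => [[d /and3P[da /eqP du /eqP dv]]|[d da [du dv]]]; exists d => //.
by rewrite da du dv !eqxx.
Qed.

Lemma adj_off_sym a : symmetric (adj_off a).
Proof.
by move=> u v; apply/adj_offP/adj_offP => -[d da [du dv]]; exists (drev d); rewrite ?dtgt_drev.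
Qed.

Lemma connect_off_sym a : connect_sym (adj_off a).
Proof. exact/sym_connect_sym/adj_off_sym. Qed.

(** Acyclicity speaks of walks of darts. A simple path of vertices lifts to darts
   with distinct edges, since using an edge twice would visit a vertex twice. *)
Lemma simple_walk_darts a u p : path (adj_off a) u p -> uniq (u :: p) ->
  exists ds : seq (dart G),
  [/\ map (@dsrc n G) ds = belast u p, map (@dtgt n G) ds = p,
      all (fun d => d.1 != a) ds, uniq [seq d.1 | d <- ds] &
      forall d, dtgt d = u -> path (fun d e => dtgt d == dsrc e) d ds].
Proof.
elim: p u => [|v p IH] u /=; first by exists [::].
move=> /andP[/adj_offP[d da [du dv]] vp] /andP[uvp uniq_vp].
have [ds [dsS dsT dsa dsU dsP]] := IH v vp uniq_vp.
exists (d :: ds); rewrite /= dsS dsT du dv da dsa dsU; split=> //.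
  rewrite andbT; apply/mapP => -[e eds de]; move: uvp; rewrite inE negb_or => /andP[uv up].
  have [ed|ed] := same_edge (esym de).
    have : u \in belast v p by rewrite -dsS -du -ed map_f.
    by move=> /mem_belast; rewrite inE (negbTE uv) (negbTE up).
  have : u \in p by rewrite -dsT -du -dtgt_drev -ed map_f.
  by rewrite (negbTE up).
by move=> k ->; rewrite eqxx dsP.
Qed.

(** One of the two halves of the graph once the edge of d is cut. *)
Definition side d : {set vert G} := [set w | connect (adj_off d.1) (dsrc d) w].

Hypothesis acyclicG : acyclic_graph G.

(** Otherwise a path from the target of d back to its source, avoiding the edge of
   d, would close up with d into a cycle. *)
Lemma bridge d : ~~ connect (adj_off d.1) (dtgt d) (dsrc d).
Proof.
apply/negP => /connectP[p dp]; case/shortenP: dp => {}p dp up _ pE.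
have [ds [dsS dsT dsa dsU dsP]] := simple_walk_darts dp up.
suff : d :: ds = [::] by [].
apply: acyclicG => /=.
- rewrite rcons_path dsP //= -(last_map (@dtgt n G)) dsT -pE; exact: eqxx.
- by rewrite dsS pE -rcons_uniq -lastI.
by rewrite dsU andbT; apply/mapP => -[e /(allP dsa) + de]; rewrite -de eqxx.
Qed.

Lemma mem_side d : dsrc d \in side d.
Proof. by rewrite inE connect0. Qed.

Lemma dtgt_notin_side d : dtgt d \notin side d.
Proof. by rewrite inE connect_off_sym bridge. Qed.

Lemma no_loop d : dtgt d != dsrc d.
Proof. by apply: contra (bridge d) => /eqP ->; apply: connect0. Qed.

Lemma side_step d u v : adj_off d.1 u v -> u \in side d -> v \in side d.
Proof. by rewrite !inE => uv /connect_trans; apply; apply: connect1. Qed.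

Lemma side_disjoint d w : w \in side d -> w \notin side (drev d).
Proof.
rewrite inE => dw; apply/negP; rewrite inE dsrc_drev connect_off_sym => wd.
have := bridge d; rewrite connect_off_sym; apply/negP; rewrite negbK.
exact: connect_trans dw wd.
Qed.

Lemma adjP u v : reflect (exists2 d, dsrc d = u & dtgt d = v) (adj u v).
Proof.
apply: (iffP existsP) => [[d /andP[/eqP du /eqP dv]]|[d du dv]]; exists d => //.
by rewrite du dv !eqxx.
Qed.

(** A walk leaves a side through the cut edge only. *)
Lemma dart_step d k : dsrc k \in side d -> dtgt k \in side d \/ k = d.
Proof.
have [kd|kd] := eqVneq k.1 d.1; last first.
  by move=> ks; left; apply: side_step ks; apply/adj_offP; exists k.
have [->|->] := same_edge kd; first by right.
by move=> _; left; rewrite dtgt_drev mem_side.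
Qed.

(** The definition of Iset forbids the vertex dtgt d rather than the edge of d. This
   amounts to the same: the edge being a bridge, a walk from dsrc d that does
   not use it never meets dtgt d. *)
Lemma Iset_side d : Iset d = [set i | Defs.half G i \in side d].
Proof.
apply/setP => i; rewrite !inE; apply/idP/idP.
  apply: connect_sub => u v /and3P[/adjP[k <- <-] ku kv]; apply: connect1.
  apply/adj_offP; exists k => //; apply/eqP => kd.
  by have [kE|kE] := same_edge kd; move: ku kv; rewrite kE ?dsrc_drev eqxx.
move=> dw.
pose avoid : rel (vert G) := [rel u v | [&& adj u v, u != dtgt d & v != dtgt d]].
suff [] : Defs.half G i \in side d /\ connect avoid (dsrc d) (Defs.half G i) by [].
apply: (connect_ind (P := fun w => w \in side d /\ connect avoid (dsrc d) w) dw).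
  by rewrite mem_side connect0.
move=> u v uv [us du].
have vs := side_step uv us; split=> //; apply: connect_trans du (connect1 _) => /=.
have neq r : r \in side d -> r != dtgt d by apply: contraTneq => ->; apply: dtgt_notin_side.
rewrite /avoid /= !neq // !andbT; have /adj_offP[k _ [ku kv]] := uv.
by apply/adjP; exists k.
Qed.

Lemma mem_Iset d i : (i \in Iset d) = (Defs.half G i \in side d).
Proof. by rewrite Iset_side inE. Qed.

Hypothesis connectedG : connected_graph G.

Lemma side_cover d w : (w \in side d) || (w \in side (drev d)).
Proof.
have [_ /(_ (dsrc d) w) dw] := connectedG.
apply: (connect_ind (P := fun w => (w \in side d) || (w \in side (drev d))) dw).
  by rewrite mem_side.
move=> u v /adjP[k <- <-].
move=> /orP[] ks.
  by have [->//|->] := dart_step ks; rewrite -dsrc_drev mem_side orbT.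
have [->|->] := dart_step ks; first by rewrite orbT.
by rewrite dtgt_drev mem_side.
Qed.

Lemma side_compl d : side (drev d) = ~: side d.
Proof.
apply/setP => w; rewrite finset.in_setC; have := side_cover d w.
have [wd _|wd /= -> //] := boolP (w \in side d).
by apply/negbTE/side_disjoint.
Qed.

Lemma Iset_compl d : Iset (drev d) = ~: Iset d.
Proof. by apply/setP => i; rewrite finset.in_setC 2!mem_Iset side_compl finset.in_setC. Qed.

(** * Flags at a vertex *)

(** The flag g is the one through which the vertex is entered; f1 and f2 lead to
   its two children. *)
Definition star v g f1 f2 : Prop :=
  uniq [:: g; f1; f2] /\ forall f, (fvert f == v) = (f \in [:: g; f1; f2]).

Hypothesis trivalentG : trivalent G.

Lemma star_exists g : exists f1 f2, star (fvert g) g f1 f2.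
Proof.
pose A := [set f | fvert f == fvert g].
have cA : #|A| = 3 := trivalentG (fvert g).
have gA : g \in A by rewrite inE.
have /cards2P[f1 [f2 [f12 AE]]] : #|A :\ g| == 2 
  by move/eqP: cA; rewrite (cardsD1 g) gA add1n eqSS.
exists f1, f2.
have f1A : f1 \in A :\ g by rewrite AE set21.
have f2A : f2 \in A :\ g by rewrite AE set22.
move: f1A f2A; rewrite !finset.in_setD1 => /andP[f1g _] /andP[f2g _]; split.
  by rewrite /= !inE negb_or andbT f12 ![g == _]eq_sym f1g f2g.
move=> f; have : (f \in A :\ g) = (f \in [set f1; f2]) by rewrite AE.
rewrite finset.in_setD1 !inE; have [->|] := eqVneq f g; last by move=> _ /= ->.
by rewrite eqxx.
Qed.

Lemma star_three v g f1 f2 : uniq [:: g; f1; f2] ->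
  fvert g = v -> fvert f1 = v -> fvert f2 = v -> star v g f1 f2.
Proof.
move=> u3 gv f1v f2v; split=> // f.
have sub : [set h in [:: g; f1; f2]] \subset [set h | fvert h == v].
  by apply/fintype.subsetP => h; rewrite !inE => /or3P[] /eqP ->; rewrite ?gv ?f1v ?f2v.
have cv : #|[set h | fvert h == v]| = 3 := trivalentG v.
have := subset_leqif_cards sub; rewrite cv cardsE (card_uniqP u3) => -[_].
by rewrite eqxx => /esym/eqP/setP/(_ f); rewrite !inE => ->.
Qed.

(** What lies beyond f, seen from its vertex. *)
Definition branch f : {set vert G} := if f is inl d then side (drev d) else finset.set0.

Definition branch_halves f : {set 'I_n} :=
  match f with inl d => Iset (drev d) | inr i => [set i] end.

(** A walk in a branch at v stays away from v, hence from the edges at v. *)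
Lemma branch_off d e w : dsrc d = dsrc e -> w \in side (drev d) ->
  connect (adj_off e.1) (dtgt d) w.
Proof.
move=> de; rewrite inE dsrc_drev => dw.
suff [] : w \in side (drev d) /\ connect (adj_off e.1) (dtgt d) w by [].
apply: (connect_ind (P := fun w => w \in side (drev d) /\
    connect (adj_off e.1) (dtgt d) w) dw).
  by rewrite -dsrc_drev mem_side connect0.
move=> u v uv [us du].
have vs : v \in side (drev d) := side_step uv us.
have neq r : r \in side (drev d) -> r != dsrc e.
  by apply: contraTneq => ->; rewrite -de -dtgt_drev dtgt_notin_side.
split=> //; apply: connect_trans du (connect1 _); have /adj_offP[k _ [ku kv]] := uv.
apply/adj_offP; exists k => //; apply/eqP => ke.
have [kE|kE] := same_edge ke.
  by have := neq _ us; rewrite -ku kE eqxx.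
by have := neq _ vs; rewrite -kv kE dtgt_drev eqxx.
Qed.

Lemma star_edges e d : dsrc d = dsrc e -> d != e -> d.1 != e.1.
Proof.
move=> de ne; apply/eqP => /same_edge[dE|dE]; first by rewrite dE eqxx in ne.
by have := no_loop e; rewrite -de dE dsrc_drev eqxx.
Qed.

(** A walk on the side of e that leaves dsrc e enters one of the two branches, and
   can only leave that branch by coming back to dsrc e. *)
Lemma star_side e f1 f2 : star (dsrc e) (inl e) f1 f2 ->
  side e = dsrc e |: (branch f1 :|: branch f2).
Proof.
case=> u3 mem3; apply/setP => w; rewrite !inE; apply/idP/idP => [ew|].
  apply: (connect_ind (P := fun w => [|| w == dsrc e, w \in branch f1 | w \in branch f2]) ew).
    by rewrite eqxx.
  move=> u v /adj_offP[k ke [ku kv]].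
  have inbr (f : flag G) : fvert f = dsrc e -> u \in branch f -> (v == dsrc e) || (v \in branch f).
    case: f => [d|i] /=; last by rewrite inE.
    rewrite -ku -kv => dv /dart_step[->|->]; first by rewrite orbT.
    by rewrite dtgt_drev dv eqxx.
  have f1v : fvert f1 = dsrc e by apply/eqP; rewrite mem3 !inE eqxx orbT.
  have f2v : fvert f2 = dsrc e by apply/eqP; rewrite mem3 !inE eqxx !orbT.
  case/or3P => [/eqP ue|/(inbr f1 f1v)/orP[]->|/(inbr f2 f2v)/orP[]->]; rewrite ?orbT //.
  have : (inl k : flag G) \in [:: inl e; f1; f2] by rewrite -mem3 /= ku ue.
  have kb : v \in branch (inl k) by rewrite /= -kv -dsrc_drev mem_side.
  rewrite !inE => /or3P[/eqP[kE]|/eqP <-|/eqP <-]; rewrite ?kb ?orbT //.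
  by rewrite kE eqxx in ke.
have sub f : f \in [:: f1; f2] -> w \in branch f -> connect (adj_off e.1) (dsrc e) w.
  case: f => [d|i] fin /=; last by rewrite inE.
  have dv : dsrc d = dsrc e.
    by apply/eqP; rewrite -[dsrc d]/(fvert (inl d : flag G)) mem3 inE fin orbT.
  have de : d != e.
    by apply: contraTneq fin => ->; case/andP: u3.
  move=> /(branch_off dv); apply: connect_trans; apply: connect1; apply/adj_offP.
  by exists d => //; apply: star_edges.
case/or3P => [/eqP ->|wb|wb]; first exact: connect0.
  by apply: (sub f1) => //; rewrite !inE eqxx.
by apply: (sub f2) => //; rewrite !inE eqxx orbT.
Qed.

Lemma branch_center e f : fvert f = dsrc e -> dsrc e \notin branch f.
Proof.
case: f => [d|i] /=; last by rewrite inE.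
by move=> <-; rewrite -dtgt_drev dtgt_notin_side.
Qed.

(** From a common vertex of the two branches, one could walk around the edge of d,
   which is a bridge. *)
Lemma branch_disjoint d d' w : dsrc d = dsrc d' -> d != d' ->
  w \in branch (inl d) -> w \notin branch (inl d').
Proof.
move=> dd' ne wd; apply/negP => /(branch_off (esym dd')) wd'.
have /negP := bridge d; apply.
have step : adj_off d.1 (dtgt d') (dsrc d).
  by apply/adj_offP; exists (drev d'); rewrite ?dtgt_drev // (star_edges (esym dd')) // eq_sym.
have wd1 : connect (adj_off d.1) (dtgt d) w by move: wd; rewrite inE dsrc_drev.
apply: connect_trans wd1 _; rewrite connect_off_sym in wd'.
exact: connect_trans wd' (connect1 step).
Qed.

Lemma star_fvert v g f1 f2 f : star v g f1 f2 -> f \in [:: g; f1; f2] -> fvert f = v.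
Proof. by case=> _ mem3; rewrite -mem3 => /eqP. Qed.

Lemma star_halves e f1 f2 : star (dsrc e) (inl e) f1 f2 ->
  Iset e = branch_halves f1 :|: branch_halves f2.
Proof.
move=> st; have [u3 mem3] := st; apply/setP => i.
rewrite mem_Iset (star_side st) !in_setU1 !finset.in_setU.
have -> : (Defs.half G i == dsrc e) = (f1 == inr i) || (f2 == inr i).
  by rewrite -[Defs.half G i]/(fvert (inr i)) mem3 !inE /= ![inr i == _]eq_sym.
have br f : ((f == inr i) || (Defs.half G i \in branch f)) = (i \in branch_halves f).
  case: f => [d|j] /=; first by rewrite mem_Iset.
  by rewrite !inE orbF eq_sym; apply/eqP/eqP => [[]|->].
by rewrite -!br orbACA.
Qed.

Lemma star_halves_disjoint e f1 f2 i : star (dsrc e) (inl e) f1 f2 ->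
  i \in branch_halves f1 -> i \notin branch_halves f2.
Proof.
move=> st; have [u3 mem3] := st.
have f1v : fvert f1 = dsrc e by apply: (star_fvert st); rewrite !inE eqxx orbT.
have f2v : fvert f2 = dsrc e by apply: (star_fvert st); rewrite !inE eqxx !orbT.
have f12 : f1 != f2 by move: u3; rewrite /= !inE => /and3P[].
case: f1 f2 f12 f1v f2v {st u3 mem3} => [d1|i1] [d2|i2] f12 /= f1v f2v.
- rewrite !mem_Iset; apply: branch_disjoint; first by rewrite f1v.
  by apply: contraNneq f12 => ->.
- rewrite mem_Iset finset.in_set1 => id1; apply/eqP => ii2; move: id1.
  by rewrite ii2 f2v; apply/negP; exact: (@branch_center e (inl d1) f1v).
- rewrite mem_Iset finset.in_set1 => /eqP ->; rewrite f1v.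
  exact: (@branch_center e (inl d2) f2v).
- by rewrite !finset.in_set1 => /eqP ->; apply: contraNneq f12 => ->.
Qed.

(** * The subtree seen from a flag *)

(** The part of G beyond the flag f, read as a binary tree: at each vertex, the two
   flags other than the entering one lead to the two children, in either order. *)
Fixpoint below f x : Prop :=
  match x with
  | Leaf i => f = inr i
  | Node y z => exists d f1 f2,
      [/\ f = inl d, star (dtgt d) (inl (drev d)) f1 f2, below f1 y & below f2 z]
  end.

Lemma below_leaves f x : below f x -> leaves x =i branch_halves f /\ uniq (leaves x).
Proof.
elim: x f => [i|y IHy z IHz] f /=; first by move=> ->; split=> // j; rewrite !inE.
case=> d [f1 [f2 [-> st /IHy[yE uy] /IHz[zE uz]]]].
rewrite -dsrc_drev in st.
split=> [i|]; first by rewrite mem_cat yE zE /= (star_halves st) finset.in_setU.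
rewrite cat_uniq uy uz andbT; apply/hasPn => i; rewrite zE => iz.
by apply/negP; rewrite /= yE => /(star_halves_disjoint st); rewrite iz.
Qed.

(** By induction on the size of the side beyond f, which decreases at the children. *)
Lemma below_exists f : exists x, below f x.
Proof.
case: f => [d|i]; last by exists (Leaf i).
have [m] := ubnP #|side (drev d)|; elim: m d => // m IH d; rewrite ltnS => dm.
have [f1 [f2 st]] := star_exists (inl (drev d)).
have sE := star_side st.
have sub f : f \in [:: f1; f2] -> exists x, below f x.
  case: f => [k|i] fin; last by exists (Leaf i).
  have kv : fvert (inl k) = dsrc (drev d) by apply: (star_fvert st); rewrite inE fin orbT.
  apply: IH; apply: leq_trans dm; apply: proper_card; apply/properP; split.
    apply/fintype.subsetP => w wk; rewrite sE in_setU1 finset.in_setU.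
    move: fin; rewrite !inE => /orP[] /eqP <-; rewrite [branch _]/= wk ?orbT //.
  exists (dsrc (drev d)); first exact: mem_side.
  exact: branch_center kv.
have [y fy] := sub f1 (mem_head _ _).
have [z fz] : exists z, below f2 z by apply: sub; rewrite !inE eqxx orbT.
by exists (Node y z), d, f1, f2.
Qed.

(** The flags leading to the children meet at the vertex to which f points, and f
   enters that vertex through its remaining flag. *)
Lemma below_inj f f' x : below f x -> below f' x -> f = f'.
Proof.
elim: x f f' => [i|y IHy z IHz] f f' /=; first by move=> -> ->.
case=> d [f1 [f2 [-> st fy fz]]] [d' [f1' [f2' [-> st' fy' fz']]]].
rewrite -(IHy _ _ fy fy') -(IHz _ _ fz fz') in st'.
have f1v : fvert f1 = dtgt d by apply: (star_fvert st); rewrite !inE eqxx orbT.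
have f1v' : fvert f1 = dtgt d' by apply: (star_fvert st'); rewrite !inE eqxx orbT.
have : (inl (drev d') : flag G) \in [:: inl (drev d); f1; f2].
  by have [_ <-] := st; rewrite -f1v f1v' /= dsrc_drev eqxx.
have [/andP[+ _] _] := st'; rewrite !inE negb_or => /andP[/negbTE -> /negbTE ->].
rewrite !orbF => /eqP[d1 d2]; rewrite -(drevK d') -(drevK d).
by congr (inl (drev _)); rewrite /drev d1 d2.
Qed.

Lemma below_subtree f s x : below f x -> subtree s x -> exists f', below f' s.
Proof.
elim: x f => [i|y IHy z IHz] f /=; first by move=> fi [-> | []]; exists f.
move=> fx [sx|sx]; first by exists f; rewrite sx.
case: fx => d [f1 [f2 [_ _ fy fz]]].
by case: sx => [/(IHy _ fy)|/(IHz _ fz)].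
Qed.

Lemma below_node f y z : below f (Node y z) -> exists d, f = inl d.
Proof. by case=> d [f1 [f2 [-> _ _ _]]]; exists d. Qed.

Lemma below_vertex d x w : below (inl d) x -> w \in side (drev d) ->
  exists d' y z, [/\ subtree (Node y z) x, dtgt d' = w & below (inl d') (Node y z)].
Proof.
elim: x d => [i|y IHy z IHz] d; first by [].
case=> d' [f1 [f2 [[<-] st fy fz]]] => {d'}.
have dx : below (inl d) (Node y z) by exists d, f1, f2.
rewrite -dsrc_drev in st; rewrite (star_side st) in_setU1 finset.in_setU => /or3P[/eqP ->|wb|wb].
- by exists d, y, z; split=> //; left.
- case: f1 wb fy st {dx} => [k|i] /= wb fy st; last by rewrite inE in wb.
  have [d' [y' [z' [sub dw d'b]]]] := IHy k fy wb.
  by exists d', y', z'; split=> //; right; left.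
- case: f2 wb fz st {dx} => [k|i] /= wb fz st; last by rewrite inE in wb.
  have [d' [y' [z' [sub dw d'b]]]] := IHz k fz wb.
  by exists d', y', z'; split=> //; right; right.
Qed.

(** * Rooting the graph at an internal edge *)

(** The root sits in the middle of the edge of d. *)
Definition rooted_at d x y := below (inl d) x /\ below (inl (drev d)) y.

Lemma rooted_leaves d x y : rooted_at d x y ->
  perm_eq (leaves (Node x y)) (enum 'I_n).
Proof.
case=> /below_leaves[xE ux] /below_leaves[yE uy].
have yx i : (i \in leaves y) = ~~ (i \in leaves x).
  by rewrite xE yE /= drevK Iset_compl finset.in_setC negbK.
apply: uniq_perm; last by move=> i; rewrite mem_cat yx mem_enum orbN.
  by rewrite /= cat_uniq ux uy andbT; apply/hasPn => i iy; move: iy; rewrite yx.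
exact: enum_uniq.
Qed.

Lemma rooted_subtree d x y s : rooted_at d x y -> proper_subtree s (Node x y) ->
  exists f, below f s.
Proof. by case=> xb yb [/(below_subtree xb)|/(below_subtree yb)]. Qed.

Lemma rooted_vertex d x y w : rooted_at d x y ->
  exists d' y' z', [/\ proper_subtree (Node y' z') (Node x y), dtgt d' = w &
    below (inl d') (Node y' z')].
Proof.
case=> xb yb; have := side_cover d w => /orP[wd|wd].
  have wd' : w \in side (drev (drev d)) by rewrite drevK.
  have [d' [y' [z' [sub dw b]]]] := below_vertex yb wd'.
  by exists d', y', z'; split=> //; right.
have [d' [y' [z' [sub dw b]]]] := below_vertex xb wd.
by exists d', y', z'; split=> //; left.
Qed.

Lemma proper_subtree_child s y z t : proper_subtree (Node y z) t ->
  s = y \/ s = z -> proper_subtree s t.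
Proof.
have trans r : subtree (Node y z) r -> s = y \/ s = z -> subtree s r.
  elim: r => [i|x1 IH1 x2 IH2] /=; first by case.
  case=> [[<- <-] [->|->]|[h|h] syz]; right.
  - by left; apply: subtree_refl.
  - by right; apply: subtree_refl.
  - by left; apply: IH1.
  - by right; apply: IH2.
by case: t => [i|x1 x2] //= [h|h] syz; [left|right]; apply: trans.
Qed.

(** The flags from which subtrees hang point away from the root: f is one of them,
   or it is the other end of the edge of one of them. *)
Lemma rooted_flag d x y f : rooted_at d x y -> exists f' s,
  [/\ proper_subtree s (Node x y), below f' s & fedge f' = fedge f].
Proof.
move=> r; have [d' [y' [z' [sub dw b]]]] := rooted_vertex (fvert f) r.
have [e [f1 [f2 [[eE] st fy fz]]]] := b; rewrite -eE in st.
have : f \in [:: inl (drev d'); f1; f2] by have [_ <-] := st; rewrite dw eqxx.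
rewrite !inE => /or3P[] /eqP ->.
- by exists (inl d'), (Node y' z').
- by exists f1, y'; split=> //; apply: proper_subtree_child sub _; left.
- by exists f2, z'; split=> //; apply: proper_subtree_child sub _; right.
Qed.

End Graph.

Local Open Scope complex_scope.
Local Open Scope sesquilinear_scope.
Local Open Scope ring_scope.

(** * Derivatives of complex-valued functions *)

Section ComplexDerivative.
Variable R : realType.
Implicit Types (f g : R -> R[i]) (c d : R[i]).

(** Unlike the value of the total function cderive0, this relation also asserts that
   the derivative exists. *)
Definition has_cderive0 f d : Prop :=
  is_derive (0 : R) (1 : R) (fun t => complex.Re (f t)) (complex.Re d) /\
  is_derive (0 : R) (1 : R) (fun t => complex.Im (f t)) (complex.Im d).

Lemma ReD c d : complex.Re (c + d) = complex.Re c + complex.Re d.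
Proof. by case: c d => [? ?] [? ?]. Qed.

Lemma ImD c d : complex.Im (c + d) = complex.Im c + complex.Im d.
Proof. by case: c d => [? ?] [? ?]. Qed.

Lemma ReM c d : complex.Re (c * d) =
  complex.Re c * complex.Re d - complex.Im c * complex.Im d.
Proof. by case: c d => [? ?] [? ?]. Qed.

Lemma ImM c d : complex.Im (c * d) =
  complex.Re c * complex.Im d + complex.Im c * complex.Re d.
Proof. by case: c d => [? ?] [? ?]. Qed.

Lemma cderive0E f d : has_cderive0 f d -> cderive0 f = d.
Proof.
case=> fr fi; rewrite /cderive0 !derive1E.
by rewrite (@derive_val _ _ _ _ _ _ _ fr) (@derive_val _ _ _ _ _ _ _ fi); case: d {fr fi}.
Qed.

Lemma has_cderive0_ext f g d : f =1 g -> has_cderive0 f d -> has_cderive0 g d.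
Proof. by move=> /funext ->. Qed.

Lemma has_cderive0_cst c : has_cderive0 (fun=> c) 0.
Proof. by split; apply: is_derive_cst. Qed.

Lemma has_cderive0D f g c d : has_cderive0 f c -> has_cderive0 g d ->
  has_cderive0 (fun t => f t + g t) (c + d).
Proof.
move=> [fr fi] [gr gi]; split.
  rewrite ReD; under eq_fun do rewrite ReD.
  exact: is_deriveD.
rewrite ImD; under eq_fun do rewrite ImD.
exact: is_deriveD.
Qed.

Lemma has_cderive0M f g c d : has_cderive0 f c -> has_cderive0 g d ->
  has_cderive0 (fun t => f t * g t) (c * g 0 + f 0 * d).
Proof.
move=> [fr fi] [gr gi]; split.
  rewrite ReD !ReM; under eq_fun do rewrite ReM.
  apply: (@is_derive_eq _ _ _ _ _ _ _ _
    (is_deriveB (is_deriveM fr gr) (is_deriveM fi gi))).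
  by rewrite /GRing.scale /=; ring.
rewrite ImD !ImM; under eq_fun do rewrite ImM.
apply: (@is_derive_eq _ _ _ _ _ _ _ _
  (is_deriveD (is_deriveM fr gi) (is_deriveM fi gr))).
by rewrite /GRing.scale /=; ring.
Qed.

Lemma has_cderive0_Ml c f d : has_cderive0 f d ->
  has_cderive0 (fun t => c * f t) (c * d).
Proof.
move=> fd; have := has_cderive0M (has_cderive0_cst c) fd.
by rewrite mul0r add0r.
Qed.

Lemma has_cderive0_sum (I : Type) (r : seq I) (F : I -> R -> R[i])
    (d : I -> R[i]) :
  (forall i, has_cderive0 (F i) (d i)) ->
  has_cderive0 (fun t => \sum_(i <- r) F i t) (\sum_(i <- r) d i).
Proof.
move=> Fd; elim: r => [|i r IH].
  rewrite big_nil; apply: (has_cderive0_ext (f := fun=> 0)) => [t|].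
    by rewrite big_nil.
  exact: has_cderive0_cst.
rewrite big_cons; apply: (has_cderive0_ext
    (f := fun t => F i t + \sum_(j <- r) F j t)) => [t|].
  by rewrite big_cons.
exact: has_cderive0D.
Qed.

Lemma is_derive_shift (h : R -> R) (t d : R) :
  is_derive (0 : R) (1 : R) (fun s => h (s + t)) d -> is_derive t (1 : R) h d.
Proof.
have E : (fun s : R => s^-1 *: (((fun s => h (s + t)) \o shift 0) (s *: (1 : R)) -
     (fun s => h (s + t)) 0)) =
   (fun s : R => s^-1 *: ((h \o shift t) (s *: (1 : R)) - h t)).
  by apply/funext => s /=; rewrite !addr0 add0r.
case=> dr <-; split; first by rewrite /derivable -E.
by rewrite /derive -E.
Qed.

(** Derivatives are taken at the origin only: the derivative at t is that of the
   translated function. *)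
Lemma cderive0_eq0_cst f :
  (forall t, has_cderive0 (fun s => f (s + t)) 0) -> forall t, f t = f 0.
Proof.
move=> f'0 t; apply/eqP; rewrite eq_complex; apply/andP; split; apply/eqP.
  apply: (@is_derive_0_is_cst _ (fun s => complex.Re (f s))) => s.
  by apply: is_derive_shift; have [] := f'0 s.
apply: (@is_derive_0_is_cst _ (fun s => complex.Im (f s))) => s.
by apply: is_derive_shift; have [] := f'0 s.
Qed.

End ComplexDerivative.

(** * One-parameter subgroups of SU(2) *)

Section OneParameter.
Variable R : realType.
Implicit Types (x g : 'M[R[i]]_2) (t : R).

Definition su2_unit x : Prop := su2 x /\ su2_dot x x = 1.

(** The one-parameter subgroup exp (t x), see [expmxE]. *)
Definition rotation x t : 'M[R[i]]_2 :=
  (cos t)%:C%:M + (sin t)%:C *: x.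

Lemma mx2P (A B : 'M[R[i]]_2) : A ord0 ord0 = B ord0 ord0 ->
  A ord0 ord_max = B ord0 ord_max -> A ord_max ord0 = B ord_max ord0 ->
  A ord_max ord_max = B ord_max ord_max -> A = B.
Proof.
move=> e1 e2 e3 e4; apply/matrixP => i j.
have ordE (k : 'I_2) : k = ord0 \/ k = ord_max.
  by case: k => [[|[|k]] kP] //; [left|right]; apply/val_inj.
by case: (ordE i) => ->; case: (ordE j) => ->.
Qed.

Lemma sum2E (V : nmodType) (F : 'I_2 -> V) : \sum_i F i = F ord0 + F ord_max.
Proof. by rewrite big_ord_recl big_ord1; congr (_ + F _); apply: val_inj. Qed.

Lemma tr2E g : \tr g = g ord0 ord0 + g ord_max ord_max.
Proof. by rewrite /mxtrace sum2E. Qed.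

Lemma mul2E (g h : 'M[R[i]]_2) i j : (g *m h) i j =
  g i ord0 * h ord0 j + g i ord_max * h ord_max j.
Proof. by rewrite mxE sum2E. Qed.

Lemma det2E g : \det g =
  g ord0 ord0 * g ord_max ord_max - g ord0 ord_max * g ord_max ord0.
Proof.
rewrite (expand_det_row _ ord0) sum2E /cofactor !det_mx11 !mxE /=.
have -> : lift ord0 (0 : 'I_1) = ord_max :> 'I_2 by apply: val_inj.
have -> : lift ord_max (0 : 'I_1) = ord0 :> 'I_2 by apply: val_inj.
by rewrite /bump /= expr0 expr1; ring.
Qed.

Lemma su2_trace0 x : su2 x -> x ord_max ord_max = - x ord0 ord0.
Proof.
case/andP=> _ /eqP; rewrite tr2E => /eqP.
by rewrite addrC addr_eq0 => /eqP.
Qed.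

Lemma su2_unit_sqr x : su2_unit x -> x *m x = - 1%:M.
Proof.
case=> sx; have tx := su2_trace0 sx; rewrite /su2_dot tr2E !mul2E tx => h.
have {}h : x ord0 ord0 * x ord0 ord0 + x ord0 ord_max * x ord_max ord0 = -1.
  by rewrite -[LHS]opprK -h; field.
by apply: mx2P; rewrite !mul2E !mxE /= ?tx -?h; ring.
Qed.

Lemma su2_adj x : su2 x -> x^t* = - x.
Proof. by case/andP=> /eqP. Qed.

Lemma expr_su2_unit x k : su2_unit x ->
  x ^+ k = if odd k then ((-1) ^+ k./2) *: x else scalar_mx ((-1) ^+ k./2).
Proof.
move=> /su2_unit_sqr xx.
have [->|->] : k = k./2.*2 \/ k = k./2.*2.+1.
  by case: (boolP (odd k)) => ko; move: (odd_double_half k); rewrite ?ko ?(negbTE ko) => <-;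
     [right|left]; rewrite ?add1n ?add0n /= ?uphalf_double ?half_double.
  rewrite odd_double doubleK -muln2 mulnC exprM expr2 -[x * x]/(x *m x) xx.
  by rewrite -scaleN1r -[1%:M]/1 exprZn expr1n scalemx1.
rewrite /= odd_double uphalf_double exprSr -muln2 mulnC exprM expr2.
rewrite -[x * x]/(x *m x) xx.
by rewrite -scaleN1r -[1%:M]/1 exprZn expr1n -scalerAl mul1r.
Qed.

Lemma clim_linear (u v : nat -> R) (c d : R[i]) :
  cvgn u -> cvgn v ->
  clim (fun k => (u k)%:C * c + (v k)%:C * d) =
  (limn u)%:C * c + (limn v)%:C * d.
Proof.
move=> cu cv; rewrite /clim.
have P (a b : R) : limn (fun k => u k * a + v k * b) =
    limn u * a + limn v * b.
  by apply/cvg_lim => //; apply: cvgD; apply: cvgMl.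
under eq_fun do rewrite ReD !ReM /= !mul0r !subr0.
under [X in _ +i* limn X]eq_fun do rewrite ImD !ImM /= !mul0r !addr0.
rewrite !P; case: c d => [c1 c2] [d1 d2] /=; simpc.
by [].
Qed.

(** As x squares to -1, the exponential series splits into those of cosine and
   sine. *)
Lemma expmxE x t : su2_unit x -> expmx (t%:C *: x) = rotation x t.
Proof.
move=> xu; apply/matrixP => i j; rewrite !mxE.
pose u := series (cos_coeff t); pose v := series (sin_coeff t).
transitivity (clim (fun k => (u k)%:C * (i == j)%:R + (v k)%:C * x i j)).
  congr clim; apply/funext => N; rewrite summxE /u /v /series /=.
  rewrite !big_mkord !rmorph_sum !mulr_suml -big_split /=.
  apply: eq_bigr => k _; rewrite mxE exprZn mxE expr_su2_unit //.
  have -> : (if odd k then (-1) ^+ k./2 *: x else scalar_mx ((-1) ^+ k./2)) i j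
      = if odd k then (-1) ^+ k./2 * x i j else (-1) ^+ k./2 * (i == j)%:R.
    by case: (odd k); rewrite !mxE // mulr_natr.
  rewrite /cos_coeff /sin_coeff /= !rmorphM !rmorphXn !fmorphV !rmorph_nat /=.
  rewrite !rmorphN !rmorph1.
  case: (boolP (odd k)) => ko; rewrite !(mul0r, mul1r, add0r, addr0).
    have -> : (k.-1)./2 = k./2.
      by move: (nat_of_ord k) ko => m; lia.
    by ring.
  by ring.
rewrite clim_linear; last 2 first.
- exact: is_cvg_series_cos_coeff.
- exact: is_cvg_series_sin_coeff.
by rewrite cos.unlock sin.unlock mulr_natr.
Qed.

Lemma rotation0 x : rotation x 0 = 1%:M.
Proof. by rewrite /rotation cos0 sin0 scale0r addr0. Qed.

Lemma rotationD x s t : su2_unit x ->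
  rotation x (s + t) = rotation x s *m rotation x t.
Proof.
move=> xu; have xx := su2_unit_sqr xu; rewrite /rotation cosD sinD.
rewrite mulmxDl !mulmxDr !mul_scalar_mx !mul_mx_scalar -scalemxAl -scalemxAr xx.
have -> : (cos s * cos t - sin s * sin t)%:C =
    (cos s)%:C * (cos t)%:C - (sin s)%:C * (sin t)%:C.
  by rewrite rmorphB !rmorphM.
have -> : (sin s * cos t + cos s * sin t)%:C =
    (sin s)%:C * (cos t)%:C + (cos s)%:C * (sin t)%:C.
  by rewrite rmorphD !rmorphM.
move: (cos s)%:C (cos t)%:C (sin s)%:C (sin t)%:C => a b c d.
by apply/matrixP => i j; rewrite !mxE; case: (i == j) => /=; ring.
Qed.

Lemma rotation_SU2 x t : su2_unit x -> SU2 (rotation x t).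
Proof.
move=> xu; have xx := su2_unit_sqr xu; have [sx dx] := xu.
have tx := su2_trace0 sx; rewrite /SU2.
have -> : \det (rotation x t) = 1.
  rewrite det2E !mxE /= tx !mulr1n !mulr0n.
  have /matrixP/(_ ord0 ord0) := xx; rewrite mul2E !mxE /= mulr1n => h.
  transitivity ((cos t)%:C ^+ 2 - (sin t)%:C ^+ 2 *
    (x ord0 ord0 * x ord0 ord0 + x ord0 ord_max * x ord_max ord0)); first ring.
  by rewrite h mulrN1 opprK -!rmorphXn -rmorphD cos2Dsin2.
rewrite eqxx andbT.
have rot_adj : (rotation x t)^t* = rotation x (- t).
  apply/matrixP => i j; rewrite !mxE cosN sinN.
  have -> : x i j = - Num.conj (x j i).
    have /matrixP/(_ i j) := su2_adj sx; rewrite !mxE => ->.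
    by rewrite opprK.
  rewrite !rmorphD !rmorphM !rmorphN /= rmorphMn /=.
  rewrite (conj_Creal (x := (cos t)%:C)) ?complex_real //.
  rewrite (conj_Creal (x := (sin t)%:C)) ?complex_real //.
  by rewrite mulrNN [i == j]eq_sym.
by apply/unitarymxP; rewrite rot_adj -rotationD // subrr rotation0.
Qed.

End OneParameter.

Section Surjectivity.
Variable R : realType.
Implicit Types (x g : 'M[R[i]]_2) (t : R).

Lemma conj_complex (a b : R) : Num.conj (a +i* b) = a -i* b.
Proof. by []. Qed.

Lemma SU2_entries g : SU2 g -> g ord_max ord_max = Num.conj (g ord0 ord0) /\
  g ord_max ord0 = - Num.conj (g ord0 ord_max).
Proof.
case/andP=> /unitarymxP gu /eqP dg.
(* A is the adjugate of g, which is its inverse as g has determinant 1. *)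
pose A : 'M[R[i]]_2 := \matrix_(i, j)
  if i == j then g (rev_ord i) (rev_ord j) else - g i j.
have r0 : rev_ord (ord0 : 'I_2) = ord_max by apply: val_inj.
have r1 : rev_ord (ord_max : 'I_2) = ord0 by apply: val_inj.
have Ag : A *m g = 1%:M.
  move: dg; rewrite det2E => dg.
  by apply: mx2P; rewrite mul2E !mxE /= ?r0 ?r1 -?dg; ring.
have gA : g^t* = A by rewrite -[LHS]mul1mx -Ag -mulmxA gu mulmx1.
have e i j : Num.conj (g j i) = A i j by rewrite -gA !mxE.
by rewrite !e !mxE /= r0 opprK.
Qed.

(** Surjectivity of the exponential map. The entries of g are a, b, - b^*, a^* with
   |a|^2 + |b|^2 = 1; the angle is given by cos t = Re a, and x is the traceless
   part of g divided by sin t. *)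
Lemma SU2_rotation g : SU2 g -> exists x t, su2_unit x /\ g = rotation x t.
Proof.
move=> gS; have [gd gc] := SU2_entries gS.
have /andP[_ /eqP] := gS; rewrite det2E gd gc.
move ga : (g ord0 ord0) gd => a; move gb : (g ord0 ord_max) gc => b.
case: a b ga gb => [a1 a2] [b1 b2] ga gb; rewrite !conj_complex => gc gd.
simpc => /eqP; rewrite eq_complex /= => /andP[/eqP norm1 _].
have {}norm1 : a1 ^+ 2 + (a2 ^+ 2 + b1 ^+ 2 + b2 ^+ 2) = 1.
  by rewrite -norm1; ring.
have s2 : 1 - a1 ^+ 2 = a2 ^+ 2 + b1 ^+ 2 + b2 ^+ 2 by rewrite -norm1; ring.
have s2_ge0 : 0 <= 1 - a1 ^+ 2 by rewrite s2 !addr_ge0 ?sqr_ge0.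
have a1P : -1 <= a1 <= 1 by apply/andP; split; nra.
pose s := Num.sqrt (1 - a1 ^+ 2).
have cs : cos (acos a1) = a1 by apply: acosK.
have ss : sin (acos a1) = s by apply: sin_acos.
have sqs : s ^+ 2 = a2 ^+ 2 + b1 ^+ 2 + b2 ^+ 2 by rewrite sqr_sqrtr.
pose mk (c d e : R) : 'M[R[i]]_2 := \matrix_(i, j)
  if i == j then (if i == ord0 then 0 +i* c else 0 -i* c)
  else (if i == ord0 then d +i* e else - d +i* e).
have mk_unit c d e : c ^+ 2 + d ^+ 2 + e ^+ 2 = 1 -> su2_unit (mk c d e).
  move=> n1; split.
    rewrite /su2 tr2E !mxE /=; apply/andP; split; last first.
      by rewrite eq_complex /=; apply/andP; split; apply/eqP; ring.
    by apply/eqP/mx2P; rewrite !mxE /= conj_complex; apply/eqP;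
      rewrite eq_complex /=; apply/andP; split; apply/eqP; ring.
  rewrite /su2_dot tr2E !mul2E !mxE /=.
  set X := (X in 2%:R^-1 * X); have -> : X = - (1 + 1).
    by rewrite /X; apply/eqP; rewrite eq_complex /= -n1; apply/andP; split;
      apply/eqP; ring.
  by rewrite mulrN opprK mulVf // pnatr_eq0.
(* If s = sin t is 0 then g is 1 or -1, and any x does. *)
have [s0|s0] := eqVneq s 0.
  have /eqP := sqs; rewrite s0 expr0n /= eq_sym !paddr_eq0 ?addr_ge0 ?sqr_ge0 //.
  rewrite !sqrf_eq0 => /andP[/andP[/eqP a20 /eqP b10] /eqP b20].
  exists (mk 1 0 0), (acos a1); split.
    by apply: mk_unit; ring.
  by apply: mx2P; rewrite !mxE /= cs ss s0 ?ga ?gb ?gc ?gd ?a20 ?b10 ?b20;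
    apply/eqP; rewrite eq_complex /=; apply/andP; split; apply/eqP; ring.
exists (mk (a2 / s) (b1 / s) (b2 / s)), (acos a1); split.
  by apply: mk_unit; rewrite !exprMn -!mulrDl -sqs -exprMn divff ?expr1n.
by apply: mx2P; rewrite !mxE /= cs ss ?ga ?gb ?gc ?gd; 
   apply/eqP; rewrite eq_complex /=; apply/andP; split; apply/eqP; field.
Qed.

End Surjectivity.

(** * Linear maps between coordinate spaces *)

Section VecBasics.
Variable R : realType.
Implicit Types S T : finType.

Definition dvec T (b : T) : vec R T := [ffun c => (c == b)%:R].

Lemma dvecE T (b a : T) : dvec b a = (a == b)%:R.
Proof. by rewrite ffunE. Qed.

Lemma vecZ T c (v : vec R T) a : (c *: v) a = c * v a.
Proof. by rewrite ffunE. Qed.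

Lemma vecD T (u v : vec R T) a : (u + v) a = u a + v a.
Proof. by rewrite ffunE. Qed.

Lemma vecN T (v : vec R T) a : (- v) a = - v a.
Proof. by rewrite ffunE. Qed.

Lemma vec0 T a : (0 : vec R T) a = 0.
Proof. by rewrite ffunE. Qed.

Lemma vec_sumE T I (r : seq I) (P : pred I) (F : I -> vec R T) a :
  (\sum_(i <- r | P i) F i) a = \sum_(i <- r | P i) F i a.
Proof. by rewrite sum_ffunE. Qed.

Lemma sum_delta T (F : T -> R[i]) a : \sum_b F b * (a == b)%:R = F a.
Proof.
rewrite (bigD1 a) //=.
rewrite eqxx mulr1.
rewrite big1 ?addr0 // => b ba.
by rewrite eq_sym (negbTE ba) mulr0.
Qed.

Lemma vec_sum T (v : vec R T) : v = \sum_b v b *: dvec b.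
Proof.
apply/ffunP => a.
rewrite vec_sumE.
rewrite -[LHS](sum_delta v).
apply: eq_bigr => b _.
by rewrite vecZ dvecE.
Qed.

Lemma lfun_vecE S T (f : 'Hom(vec R S, vec R T)) (v : vec R S) a :
  f v a = \sum_b f (dvec b) a * v b.
Proof.
rewrite [in LHS](vec_sum v).
rewrite linear_sum.
rewrite vec_sumE.
apply: eq_bigr => b _.
rewrite linearZ.
by rewrite vecZ mulrC.
Qed.

Lemma lfun_vecP S T (f g : 'Hom(vec R S, vec R T)) :
  (forall b, f (dvec b) = g (dvec b)) -> f = g.
Proof.
move=> fg; apply/lfunP => v; apply/ffunP => a; rewrite !lfun_vecE.
by apply: eq_bigr => b _; rewrite fg.
Qed.

Definition mx_hom S T (K : T -> S -> R[i]) : 'Hom(vec R S, vec R T) :=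
  linfun (fun v : vec R S => [ffun a => \sum_b K a b * v b] : vec R T).

Lemma mx_homE S T (K : T -> S -> R[i]) v a :
  mx_hom K v a = \sum_b K a b * v b.
Proof.
have lin : linear (fun v : vec R S => [ffun a => \sum_b K a b * v b] : vec R T).
  move=> c u w; apply/ffunP => b; rewrite !ffunE /GRing.scale /= mulr_sumr.
  rewrite -big_split /=; apply: eq_bigr => d _.
  by rewrite !ffunE /GRing.scale /=; ring.
pose L := GRing.isLinear.Build _ _ _ _ _ lin.
pose F : {linear vec R S -> vec R T} := HB.pack (fun v : vec R S =>
  [ffun a => \sum_b K a b * v b] : vec R T) L.
by rewrite /mx_hom (lfunE F) /= ffunE.
Qed.

Lemma mx_hom_dvec S T (K : T -> S -> R[i]) a b : mx_hom K (dvec b) a = K a b.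
Proof.
rewrite mx_homE (bigD1 b) //= ffunE eqxx mulr1 big1 ?addr0 // => c cb.
by rewrite ffunE (negbTE cb) mulr0.
Qed.

Lemma kernel_op_mx T (K : T -> T -> R[i]) : kernel_op K = mx_hom K.
Proof. by []. Qed.

Lemma kernel_opE T (K : T -> T -> R[i]) v a :
  kernel_op K v a = \sum_b K a b * v b.
Proof. exact: mx_homE. Qed.

Lemma linfun_id (V W : vectType R[i]) (f : 'Hom(V, W)) : linfun f = f.
Proof. exact: fun_of_lfunK. Qed.

End VecBasics.

(** * Differentials and intertwining maps *)

Section Differential.
Variable R : realType.
Implicit Types S T : finType.

(** For x of norm one the curve exp (t x) is explicit, and the elements of an
   orthonormal basis have norm one. *)
Definition has_differential T (rho : rep R T) (D : 'M[R[i]]_2 -> 'End(vec R T)) :=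
  forall x, su2_unit x -> forall v a,
    has_cderive0 (fun t => rho (rotation x t) v a) (D x v a).

Definition multiplicative_rep T (rho : rep R T) :=
  rho 1%:M = \1%VF /\ forall g h, rho (g *m h) = (rho g \o rho h)%VF.

Lemma drepE T (rho : rep R T) D x : has_differential rho D -> su2_unit x ->
  drep rho x = D x.
Proof.
move=> rhoD xu; rewrite -[RHS]linfun_id /drep; congr linfun; apply/funext => v.
apply/ffunP => a; rewrite ffunE; apply: cderive0E.
by under eq_fun do rewrite expmxE //; exact: rhoD.
Qed.

Definition cas T (xi : 'I_3 -> 'M[R[i]]_2) (D : 'M[R[i]]_2 -> 'End(vec R T)) :
  'End(vec R T) := - \sum_(i < 3) (D (xi i) \o D (xi i))%VF.

Lemma orthonormal_unit (xi : 'I_3 -> 'M[R[i]]_2) i :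
  su2_orthonormal xi -> su2_unit (xi i).
Proof. by case=> s d; split=> //; rewrite d eqxx. Qed.

Lemma casimirE T (xi : 'I_3 -> 'M[R[i]]_2) (rho : rep R T) D :
  su2_orthonormal xi -> has_differential rho D -> casimir xi rho = cas xi D.
Proof.
move=> xio rhoD; rewrite /casimir /cas; congr (- _); apply: eq_bigr => i _.
by rewrite (drepE rhoD) //; exact: orthonormal_unit.
Qed.

Lemma casE T xi D (v : vec R T) : cas xi D v = - \sum_(i < 3) D (xi i) (D (xi i) v).
Proof. by rewrite /cas opp_lfunE sum_lfunE; congr (- _); apply: eq_bigr => i _; rewrite comp_lfunE. Qed.

Lemma cas_intertwine S T xi D D' (f : 'Hom(vec R S, vec R T)) v :
  (forall i, f \o D (xi i) = D' (xi i) \o f)%VF ->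
  cas xi D' (f v) = f (cas xi D v).
Proof.
move=> fD; have fDv i w : D' (xi i) (f w) = f (D (xi i) w).
  by have /lfunP/(_ w) := fD i; rewrite !comp_lfunE.
have -> : cas xi D' (f v) = \sum_(i < 3) - f (D (xi i) (D (xi i) v)).
  by rewrite casE -sumrN; apply: eq_bigr => i _; rewrite !fDv.
by rewrite casE linearN linear_sum -sumrN.
Qed.

Lemma has_cderive0_neg (f : R -> R[i]) d : has_cderive0 f d ->
  has_cderive0 (fun t => f (- t)) (- d).
Proof.
have P (h : R -> R) (c : R) : is_derive (0 : R) (1 : R) h c ->
    is_derive (0 : R) (1 : R) (fun t => h (- t)) (- c).
  move=> hc; have hc' : is_derive (- 0 : R) (1 : R) h c by rewrite oppr0.
  have := @is_derive1_comp _ h -%R 0 c (- 1) hc' (is_deriveNid _ _).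
  by rewrite mulrN1.
case: d => d1 d2 [fr fi]; split; exact: P.
Qed.

(** The derivative of t |-> sigma (exp (- t x)) \o f \o rho (exp (t x)) vanishes when
   f commutes with the differentials; so this function is constant, equal to f. *)
Lemma intertwine_lie_group S T (rho : rep R S) (sigma : rep R T) D D'
    (f : 'Hom(vec R S, vec R T)) :
  multiplicative_rep rho -> has_differential rho D ->
  multiplicative_rep sigma -> has_differential sigma D' ->
  (forall x, su2_unit x -> (f \o D x)%VF = (D' x \o f)%VF) ->
  forall g v, SU2 g -> f (rho g v) = sigma g (f v).
Proof.
move=> [rho1 rhoM] rhoD [sig1 sigM] sigD fD g v /SU2_rotation[x [t [xu ->]]].
pose inner s w := sigma (rotation x (- s)) (f (rho (rotation x s) w)).
have inner0 w b : has_cderive0 (fun s => inner s w b) 0.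
  apply: (has_cderive0_ext (f := fun s => \sum_c
      sigma (rotation x (- s)) (dvec R c) b * f (rho (rotation x s) w) c)).
    by move=> s; rewrite /inner -lfun_vecE.
  have sum0 : \sum_c (- D' x (dvec R c) b * f (rho (rotation x 0) w) c
      + sigma (rotation x (- 0)) (dvec R c) b * f (D x w) c) = 0.
    rewrite oppr0 rotation0 rho1 sig1 big_split /=.
    under eq_bigr do rewrite id_lfunE mulNr.
    rewrite sumrN -lfun_vecE.
    under [X in _ + X]eq_bigr do rewrite id_lfunE.
    have /lfunP/(_ w) := fD x xu; rewrite !comp_lfunE => ->.
    rewrite [X in - X + _](_ : _ = (\1%VF : 'End(vec R T)) (D' x (f w)) b) ?id_lfunE //.
    under eq_bigr do rewrite -[dvec R _]id_lfunE.
    by rewrite -lfun_vecE id_lfunE addNr.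
  rewrite -[X in has_cderive0 _ X]sum0.
  apply: has_cderive0_sum => c; apply: has_cderive0M.
    exact: (has_cderive0_neg (sigD x xu (dvec R c) b)).
  apply: (has_cderive0_ext (f := fun s => \sum_e
      f (dvec R e) c * rho (rotation x s) w e)) => [s|]; first by rewrite -lfun_vecE.
  rewrite lfun_vecE; apply: has_cderive0_sum => e; apply: has_cderive0_Ml.
  exact: rhoD.
(* Factoring out exp (u x) on both sides moves the point u to the origin. *)
have const a : inner t v a = inner 0 v a.
  apply: (cderive0_eq0_cst (f := fun s => inner s v a)) => u.
  apply: (has_cderive0_ext (f := fun s => \sum_b
      sigma (rotation x (- u)) (dvec R b) a * inner s (rho (rotation x u) v) b)).
    move=> s; rewrite -lfun_vecE /inner opprD [- s - u]addrC !rotationD //.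
    by rewrite rhoM sigM !comp_lfunE.
  have sum0 : \sum_b sigma (rotation x (- u)) (dvec R b) a * 0 = 0.
    by rewrite -mulr_suml mulr0.
  rewrite -[X in has_cderive0 _ X]sum0.
  by apply: has_cderive0_sum => b; apply: has_cderive0_Ml.
have /(congr1 (sigma (rotation x t))) : inner t v = f v.
  apply/ffunP => a; rewrite const /inner oppr0 rotation0 rho1 sig1.
  by rewrite !id_lfunE.
rewrite /inner -[X in X = _]comp_lfunE -sigM -rotationD // subrr rotation0 sig1.
by rewrite id_lfunE.
Qed.

Lemma intertwine_group_lie S T (rho : rep R S) (sigma : rep R T) D D'
    (f : 'Hom(vec R S, vec R T)) :
  has_differential rho D -> has_differential sigma D' ->
  (forall g v, SU2 g -> f (rho g v) = sigma g (f v)) ->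
  forall x, su2_unit x -> (f \o D x)%VF = (D' x \o f)%VF.
Proof.
move=> rhoD sigD fg x xu; apply/lfunP => v; apply/ffunP => a.
rewrite !comp_lfunE -(cderive0E (sigD x xu (f v) a)); apply/esym/cderive0E.
apply: (has_cderive0_ext (f := fun s => \sum_e
    f (dvec R e) a * rho (rotation x s) v e)).
  by move=> s; rewrite -lfun_vecE fg //; apply: rotation_SU2.
rewrite lfun_vecE; apply: has_cderive0_sum => e; apply: has_cderive0_Ml.
exact: rhoD.
Qed.

End Differential.

(** * Tensor products of representations *)

Section TensorProduct.
Variable R : realType.
Implicit Types S T : finType.

Lemma tens_vecE S T (u : vec R S) (v : vec R T) a b :
  tens_vec u v (a, b) = u a * v b.
Proof. by rewrite ffunE. Qed.

Lemma tens_dvec S T (a : S) (b : T) : tens_vec (dvec R a) (dvec R b) = dvec R (a, b).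
Proof.
apply/ffunP => -[c d]; rewrite tens_vecE !dvecE.
by rewrite xpair_eqE; do 2 case: (_ == _); rewrite /= ?(mulr0, mulr1).
Qed.

Definition tens_hom S T S' T' (f : 'Hom(vec R S, vec R S'))
    (g : 'Hom(vec R T, vec R T')) : 'Hom(vec R (S * T)%type, vec R (S' * T')%type) :=
  mx_hom (fun ab cd => f (dvec R cd.1) ab.1 * g (dvec R cd.2) ab.2).

Lemma tens_homE S T S' T' (f : 'Hom(vec R S, vec R S'))
    (g : 'Hom(vec R T, vec R T')) u v :
  tens_hom f g (tens_vec u v) = tens_vec (f u) (g v).
Proof.
apply/ffunP => -[a b]; rewrite mx_homE tens_vecE.
rewrite lfun_vecE (lfun_vecE g) mulr_suml.
rewrite (eq_bigr (fun c : S * T => (f (dvec R c.1) a * u c.1) *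
   (g (dvec R c.2) b * v c.2))) => [|[c d] _]; last by rewrite tens_vecE /= mulrACA.
rewrite -(pair_bigA _ (fun c d => (f (dvec R c) a * u c) * (g (dvec R d) b * v d))) /=.
by apply: eq_bigr => c _; rewrite mulr_sumr.
Qed.

Lemma tens_homP S T U (f g : 'Hom(vec R (S * T)%type, vec R U)) :
  (forall u v, f (tens_vec u v) = g (tens_vec u v)) -> f = g.
Proof. by move=> fg; apply: lfun_vecP => -[a b]; rewrite -tens_dvec fg. Qed.

Lemma tens_hom_comp S T S' T' S'' T'' (f : 'Hom(vec R S, vec R S'))
    (g : 'Hom(vec R T, vec R T')) (f' : 'Hom(vec R S', vec R S''))
    (g' : 'Hom(vec R T', vec R T'')) :
  (tens_hom f' g' \o tens_hom f g)%VF = tens_hom (f' \o f)%VF (g' \o g)%VF.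
Proof. by apply: tens_homP => u v; rewrite comp_lfunE !tens_homE !comp_lfunE. Qed.

Lemma tens_hom1 S T : tens_hom \1%VF \1%VF = \1%VF :> 'End(vec R (S * T)%type).
Proof. by apply: tens_homP => u v; rewrite tens_homE !id_lfunE. Qed.

Lemma tens_vec0l S T (v : vec R T) : tens_vec (0 : vec R S) v = 0.
Proof. by apply/ffunP => -[a b]; rewrite tens_vecE !vec0 mul0r. Qed.

Lemma tens_vec0r S T (u : vec R S) : tens_vec u (0 : vec R T) = 0.
Proof. by apply/ffunP => -[a b]; rewrite tens_vecE !vec0 mulr0. Qed.

Lemma tens_vecZl S T c (u : vec R S) (v : vec R T) :
  tens_vec (c *: u) v = c *: tens_vec u v.
Proof. by apply/ffunP => -[a b]; rewrite vecZ !tens_vecE vecZ mulrA. Qed.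

Lemma tens_vecZr S T c (u : vec R S) (v : vec R T) :
  tens_vec u (c *: v) = c *: tens_vec u v.
Proof. by apply/ffunP => -[a b]; rewrite vecZ !tens_vecE vecZ mulrCA. Qed.

Lemma tens_vecNl S T (u : vec R S) (v : vec R T) :
  tens_vec (- u) v = - tens_vec u v.
Proof. by apply/ffunP => -[a b]; rewrite vecN !tens_vecE vecN mulNr. Qed.

Lemma tens_vecNr S T (u : vec R S) (v : vec R T) :
  tens_vec u (- v) = - tens_vec u v.
Proof. by apply/ffunP => -[a b]; rewrite vecN !tens_vecE vecN mulrN. Qed.

Lemma tens_vecDl S T (u u' : vec R S) (v : vec R T) :
  tens_vec (u + u') v = tens_vec u v + tens_vec u' v.
Proof. by apply/ffunP => -[a b]; rewrite vecD !tens_vecE vecD mulrDl. Qed.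

Lemma tens_vecDr S T (u : vec R S) (v v' : vec R T) :
  tens_vec u (v + v') = tens_vec u v + tens_vec u v'.
Proof. by apply/ffunP => -[a b]; rewrite vecD !tens_vecE vecD mulrDr. Qed.

Lemma tens_vec_suml S T I (r : seq I) (F : I -> vec R S) (v : vec R T) :
  tens_vec (\sum_(i <- r) F i) v = \sum_(i <- r) tens_vec (F i) v.
Proof.
elim: r => [|i r IH]; first by rewrite !big_nil tens_vec0l.
by rewrite !big_cons tens_vecDl IH.
Qed.

Lemma tens_vec_sumr S T I (r : seq I) (F : I -> vec R T) (u : vec R S) :
  tens_vec u (\sum_(i <- r) F i) = \sum_(i <- r) tens_vec u (F i).
Proof.
elim: r => [|i r IH]; first by rewrite !big_nil tens_vec0r.
by rewrite !big_cons tens_vecDr IH.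
Qed.

Lemma tens_repE S T (rho : rep R S) (sigma : rep R T) g :
  tens_rep rho sigma g = tens_hom (rho g) (sigma g).
Proof. by []. Qed.

Fact dtens_key : unit. Proof. by []. Qed.

(** The Leibniz rule. The definition is locked because comparing two such operators
   by unfolding them is costly. *)
Definition dtens S T (A : 'End(vec R S)) (B : 'End(vec R T)) :
    'End(vec R (S * T)%type) :=
  locked_with dtens_key (tens_hom A \1%VF + tens_hom \1%VF B).

Lemma dtensE S T (A : 'End(vec R S)) (B : 'End(vec R T)) u v :
  dtens A B (tens_vec u v) = tens_vec (A u) v + tens_vec u (B v).
Proof. by rewrite /dtens locked_withE add_lfunE !tens_homE !id_lfunE. Qed.

Lemma tens_rep_mult S T (rho : rep R S) (sigma : rep R T) :
  multiplicative_rep rho -> multiplicative_rep sigma ->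
  multiplicative_rep (tens_rep rho sigma).
Proof.
move=> [r1 rM] [s1 sM]; split=> [|g h]; first by rewrite tens_repE r1 s1 tens_hom1.
by rewrite !tens_repE tens_hom_comp rM sM.
Qed.

Lemma tens_rep_differential S T (rho : rep R S) (sigma : rep R T) D D' :
  rho 1%:M = \1%VF -> has_differential rho D ->
  sigma 1%:M = \1%VF -> has_differential sigma D' ->
  has_differential (tens_rep rho sigma) (fun x => dtens (D x) (D' x)).
Proof.
move=> r1 rD s1 sD x xu v [a b].
apply: (has_cderive0_ext (f := fun t => \sum_(c : S * T)
    v c * (rho (rotation x t) (dvec R c.1) a * sigma (rotation x t) (dvec R c.2) b))).
  by move=> t; rewrite tens_repE mx_homE; apply: eq_bigr => c _; rewrite mulrC.
rewrite lfun_vecE (eq_bigr (fun c : S * T => v c *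
    (D x (dvec R c.1) a * sigma (rotation x 0) (dvec R c.2) b +
     rho (rotation x 0) (dvec R c.1) a * D' x (dvec R c.2) b))); last first.
  move=> [c d] _; rewrite -tens_dvec dtensE vecD !tens_vecE mulrC.
  by rewrite rotation0 r1 s1 !id_lfunE.
apply: has_cderive0_sum => c; apply: has_cderive0_Ml; apply: has_cderive0M.
  exact: rD.
exact: sD.
Qed.

End TensorProduct.

(** * The representations V_m *)

Section Irreducible.
Variable R : realType.
Implicit Types (m : nat) (g h x : 'M[R[i]]_2).

(** The homogenisation of P as a binary form of degree m, evaluated at (A, B). *)
Definition homog m (P A B : {poly R[i]}) : {poly R[i]} :=
  \sum_(j < m.+1) P`_j *: (A ^+ j * B ^+ (m - j)).

Lemma homog_mul_linear m (a b : R[i]) (P A B : {poly R[i]}) : (size P <= m.+1)%N ->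
  homog m.+1 ((a *: 'X + b%:P) * P) A B = (a *: A + b *: B) * homog m P A B.
Proof.
move=> sP; rewrite /homog [RHS]mulrDl.
have Pm : P`_m.+1 = 0 by apply: nth_default.
transitivity (\sum_(j < m.+2) (a * (P`_j.-1 *+ (j != 0%N :> nat))) *: (A ^+ j * B ^+ (m.+1 - j))
  + \sum_(j < m.+2) (b * P`_j) *: (A ^+ j * B ^+ (m.+1 - j))).
  rewrite -big_split /=; apply: eq_bigr => j _.
  rewrite -scalerDl mulrDl coefD -scalerAl coefZ coefXM coefCM.
  by case: (nat_of_ord j) => [|k] /=; rewrite ?mulr0n ?mulr1n.
congr (_ + _).
  rewrite big_ord_recl /= mulr0n mulr0 scale0r add0r mulr_sumr.
  apply: eq_bigr => j _; rewrite mulr1n /= subSS exprS.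
  by rewrite -!scalerAl -!scalerAr scalerA !mulrA.
rewrite big_ord_recr /= Pm mulr0 scale0r addr0 mulr_sumr.
apply: eq_bigr => j _; rewrite subSn ?leq_ord // exprS.
by rewrite -!scalerAl -!scalerAr scalerA; congr (_ *: _); ring.
Qed.

Lemma size_linear_mul (a b : R[i]) (P : {poly R[i]}) m : (size P <= m.+1)%N ->
  (size ((a *: 'X + b%:P) * P)%R <= m.+2)%N.
Proof.
move=> sP; apply: leq_trans (size_polyMleq _ _) _.
have sL : (size (a *: 'X + b%:P)%R <= 2)%N.
  apply: leq_trans (size_polyD _ _) _; rewrite geq_max.
  rewrite (leq_trans (size_scale_leq _ _)) ?size_polyX //=.
  by rewrite (leq_trans (size_polyC_leq1 _)).
by rewrite -[m.+2]/(2 + m.+1).-1 -!subn1 leq_sub2r // leq_add.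
Qed.

Definition monom2 k m g : {poly R[i]} :=
  (g ord0 ord0 *: 'X + (g ord_max ord0)%:P) ^+ k *
  (g ord0 ord_max *: 'X + (g ord_max ord_max)%:P) ^+ m.

Lemma size_monom2 k m g : (size (monom2 k m g) <= (k + m).+1)%N.
Proof.
rewrite /monom2; elim: k => [|k IH]; last first.
  by rewrite exprS -mulrA addSn size_linear_mul.
rewrite expr0 mul1r; elim: m => [|m IH]; first by rewrite size_poly1.
by rewrite exprS size_linear_mul.
Qed.

Lemma homog_monom2 k m g (A B : {poly R[i]}) :
  homog (k + m) (monom2 k m g) A B =
  (g ord0 ord0 *: A + g ord_max ord0 *: B) ^+ k *
  (g ord0 ord_max *: A + g ord_max ord_max *: B) ^+ m.
Proof.
rewrite /monom2; elim: k => [|k IH].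
  rewrite !expr0 !mul1r add0n; elim: m => [|m IH].
    rewrite /homog big_ord1 !expr0 coef1 /= scale1r. by rewrite mul1r.
  rewrite !exprS homog_mul_linear ?IH //.
  by have := size_monom2 0 m g; rewrite /monom2 expr0 mul1r.
by rewrite addSn !exprS -!mulrA homog_mul_linear ?IH // size_monom2.
Qed.

Lemma irrmxE m g (j k : 'I_m.+1) : irrmx g j k = (monom2 k (m - k) g)`_j.
Proof. by []. Qed.

(** The linear forms of g *m h are those of h evaluated at those of g: multiplying
   the matrices amounts to substituting polynomials. *)
Lemma irrmx_mul m g h (i k : 'I_m.+1) :
  irrmx (g *m h) i k = \sum_j irrmx g i j * irrmx h j k.
Proof.
have km : (k + (m - k) = m)%N by rewrite subnKC // -ltnS.
have lin a : (g *m h) ord0 a *: 'X + ((g *m h) ord_max a)%:P =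
   h ord0 a *: (g ord0 ord0 *: 'X + (g ord_max ord0)%:P) +
   h ord_max a *: (g ord0 ord_max *: 'X + (g ord_max ord_max)%:P) :> {poly R[i]}.
  rewrite !mul2E !rmorphD !rmorphM /= -!mul_polyC !rmorphD !rmorphM /=.
  by ring.
rewrite irrmxE /monom2 !lin -homog_monom2 km /homog coef_sum.
by apply: eq_bigr => j _; rewrite coefZ mulrC.
Qed.

Lemma irrmx1 m (j k : 'I_m.+1) : irrmx (1%:M : 'M[R[i]]_2) j k = (j == k)%:R.
Proof.
rewrite irrmxE /monom2 !mxE /= !mulr1n !mulr0n scale1r scale0r add0r addr0.
by rewrite expr1n mulr1 coefXn.
Qed.

Lemma irr_mult m : multiplicative_rep (@irr R m).
Proof.
split=> [|g h]; apply: lfun_vecP => b; apply/ffunP => a; rewrite /irr kernel_op_mx mx_hom_dvec.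
  by rewrite irrmx1 id_lfunE dvecE.
rewrite comp_lfunE kernel_opE irrmx_mul; apply: eq_bigr => c _.
by rewrite kernel_op_mx mx_hom_dvec.
Qed.

(** The derivative at t = 0 of the column k of irrmx (exp (t x)), by the product
   rule. *)
Definition dirrmx m x (j k : 'I_m.+1) : R[i] :=
  (('X^(k.-1) * (x ord0 ord0 *: 'X + (x ord_max ord0)%:P)) *+ k +
   ('X^k * (x ord0 ord_max *: 'X + (x ord_max ord_max)%:P)) *+ (m - k))`_j.

Definition dirr m x : 'End(vec R 'I_m.+1) := mx_hom (@dirrmx m x).

Definition has_pderive0 (f : R -> {poly R[i]}) (d : {poly R[i]}) :=
  forall j, has_cderive0 (fun t => (f t)`_j) d`_j.

Lemma has_pderive0M (f g : R -> {poly R[i]}) c d : has_pderive0 f c -> has_pderive0 g d ->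
  has_pderive0 (fun t => f t * g t) (c * g 0 + f 0 * d).
Proof.
move=> fc gd j; apply: (has_cderive0_ext
  (f := fun t => \sum_(i < j.+1) (f t)`_i * (g t)`_(j - i))) => [t|].
  by rewrite coefM.
rewrite coefD !coefM -big_split /=.
by apply: has_cderive0_sum => i; apply: has_cderive0M.
Qed.

Lemma has_pderive0X f d k : has_pderive0 f d ->
  has_pderive0 (fun t => f t ^+ k) ((f 0 ^+ k.-1 * d) *+ k).
Proof.
move=> fd; elim: k => [|k IH].
  have -> : (f 0 ^+ 0.-1 * d) *+ 0 = 0 by [].
  move=> j.
  rewrite [X in has_cderive0 _ X]coef0.
  apply: (has_cderive0_ext (f := fun=> (1 : {poly R[i]})`_j)) => [t|].
    by rewrite expr0.
  exact: has_cderive0_cst.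
have -> : (fun t => f t ^+ k.+1) = (fun t => f t * f t ^+ k).
  by apply/funext => t; rewrite exprS.
have -> : (f 0 ^+ k.+1.-1 * d) *+ k.+1 =
    d * f 0 ^+ k + f 0 * ((f 0 ^+ k.-1 * d) *+ k).
  case: k {IH} => [|k] /=; first by rewrite mulr1n mulr0n mulr0 addr0 mulrC.
  by rewrite mulrS [d * _]mulrC [f 0 * _]mulrnAr mulrA -exprS.
exact: has_pderive0M.
Qed.

Lemma has_cderive0_rotation x i j : has_cderive0 (fun t => rotation x t i j) (x i j).
Proof.
apply: (has_cderive0_ext (f := fun t : R =>
    (i == j)%:R * (cos t)%:C + x i j * (sin t)%:C)) => [t|].
  by rewrite !mxE mulrC mulr_natr [x i j * _]mulrC.
rewrite [X in has_cderive0 _ X](_ : x i j =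
    (i == j)%:R * (- sin 0)%:C + x i j * (cos 0)%:C); last first.
  by rewrite sin0 oppr0 cos0 mulr0 add0r mulr1.
have real (f : R -> R) c : is_derive (0 : R) (1 : R) f c ->
    has_cderive0 (fun t => (f t)%:C) c%:C.
  by move=> fc; split=> //=; apply: is_derive_cst.
by apply: has_cderive0D; apply: has_cderive0_Ml; apply: real.
Qed.

Lemma irr_differential m : has_differential (@irr R m) (dirr m).
Proof.
move=> x xu v a; apply: (has_cderive0_ext (f := fun t =>
   \sum_k v k * irrmx (rotation x t) a k)) => [t|].
  by rewrite /irr kernel_opE; apply: eq_bigr => k _; rewrite mulrC.
rewrite mx_homE (eq_bigr (fun k => v k * dirrmx x a k)); last by move=> k _; rewrite mulrC.
apply: has_cderive0_sum => k; apply: has_cderive0_Ml.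
have lin i j : has_pderive0 (fun t => rotation x t ord0 i *: 'X + (rotation x t ord_max j)%:P)
    (x ord0 i *: 'X + (x ord_max j)%:P).
  move=> l; apply: (has_cderive0_ext (f := fun t => 'X`_l * rotation x t ord0 i +
     (l == 0%N)%:R * rotation x t ord_max j)) => [t|].
    by rewrite coefD coefZ coefC mulrC; case: (l == _); rewrite ?(mul0r, mul1r).
  have -> : (x ord0 i *: 'X + (x ord_max j)%:P)`_l =
     'X`_l * x ord0 i + (l == 0%N)%:R * x ord_max j.
    by rewrite coefD coefZ coefC mulrC; case: (l == _); rewrite ?(mul0r, mul1r).
  by apply: has_cderive0D; apply: has_cderive0_Ml; apply: has_cderive0_rotation.
have := has_pderive0M (has_pderive0X k (lin ord0 ord0))
  (has_pderive0X (m - k) (lin ord_max ord_max)).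
rewrite rotation0 !mxE /= !mulr1n !mulr0n scale1r scale0r add0r addr0 !expr1n.
by rewrite mulr1 mul1r mulrnAr => /(_ a).
Qed.

End Irreducible.

(** * Sums of joint eigenvectors and sums of squares *)

(** If lam i a differs from mu a, then A a - lam i a kills the term i, multiplies
   each of the other terms by a scalar, and acts on the sum as mu a - lam i a;
   after division by this number the terms of eigenvalues mu are unchanged. *)
Lemma joint_eigen_sum (K : fieldType) (V : vectType K) (J I : Type)
    (A : J -> 'End(V)) (lam : I -> J -> K) (mu : J -> K) (r : seq I) (w : I -> V) :
  (forall i a, A a (w i) = lam i a *: w i) ->
  (forall a, A a (\sum_(i <- r) w i) = mu a *: \sum_(i <- r) w i) ->
  \sum_(i <- r) w i = \sum_(i <- r | `[< lam i = mu >]) w i.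
Proof.
move=> + ; elim: r w => [|i r IH] w wlam wmu; first by rewrite !big_nil.
have [lmu|lmu] := asboolP (lam i = mu).
  rewrite !big_cons asboolT //; congr (_ + _); apply: IH => // a.
  have := wmu a; rewrite !big_cons linearD /= wlam scalerDr lmu.
  exact: addrI.
rewrite [RHS]big_cons asboolF //.
have [a la] : exists a, lam i a != mu a.
  apply: contrapT => h; apply: lmu; apply/funext => a; apply/eqP.
  by apply: contrapT => /negP la; apply: h; exists a.
pose d := (mu a - lam i a)^-1.
have d0 : mu a - lam i a != 0 by rewrite subr_eq0 eq_sym.
pose w' j := (d * (lam j a - lam i a)) *: w j.
have S : \sum_(j <- i :: r) w j = \sum_(j <- r) w' j.
  have : (mu a - lam i a) *: \sum_(j <- i :: r) w j =
      \sum_(j <- r) (lam j a - lam i a) *: w j.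
    rewrite scalerBl -wmu linear_sum /= scaler_sumr -sumrB big_cons.
    rewrite wlam subrr add0r; apply: eq_bigr => j _.
    by rewrite wlam -scalerBl.
  move=> /(congr1 (fun v => d *: v)); rewrite scalerA mulVf // scale1r => ->.
  by rewrite scaler_sumr; apply: eq_bigr => j _; rewrite scalerA.
rewrite S IH.
- by apply: eq_bigr => j /asboolP lj; rewrite /w' lj mulVf // scale1r.
- by move=> j b; rewrite linearZ /= wlam !scalerA mulrC.
by move=> b; rewrite -S wmu.
Qed.

Lemma lfunZ (K : fieldType) (V W : vectType K) (f : 'Hom(V, W)) c v :
  f (c *: v) = c *: f v.
Proof. by rewrite linearZ. Qed.

Lemma lfunD (K : fieldType) (V W : vectType K) (f : 'Hom(V, W)) u v :
  f (u + v) = f u + f v.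
Proof. by rewrite linearD. Qed.

Lemma lfun0 (K : fieldType) (V W : vectType K) (f : 'Hom(V, W)) : f 0 = 0.
Proof. by rewrite linear0. Qed.

Lemma lfun_sum (K : fieldType) (V W : vectType K) (f : 'Hom(V, W)) I (r : seq I) P (F : I -> V) :
  f (\sum_(i <- r | P i) F i) = \sum_(i <- r | P i) f (F i).
Proof. exact: linear_sum. Qed.

(** The sum of squares below is computed over an abstract space, where the terms
   stay small. *)
Definition lin_comb3 (K : fieldType) (V : vectType K) (a b c : K)
  (f g h : 'End(V)) : 'End(V) := a *: f + b *: g + c *: h.

Lemma lin_comb3E (K : fieldType) (V : vectType K) (a b c : K) (f g h : 'End(V)) v :
  lin_comb3 a b c f g h v = a *: f v + b *: g v + c *: h v.
Proof. by rewrite /lin_comb3 !add_lfunE !scale_lfunE. Qed.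

Lemma lin_comb3_sqr (K : fieldType) (V : vectType K) (a b c : K) (f g h : 'End(V)) v :
  lin_comb3 a b c f g h (lin_comb3 a b c f g h v) =
  (a * a) *: f (f v) + (b * b) *: g (g v) + (c * c) *: h (h v) +
  (a * b) *: (f (g v) + g (f v)) + (c * a) *: (h (f v) + f (h v)) +
  (c * b) *: (h (g v) + g (h v)).
Proof.
have lc (k : 'End(V)) x y z (u1 u2 u3 : V) : k (x *: u1 + y *: u2 + z *: u3) =
    x *: k u1 + y *: k u2 + z *: k u3 by rewrite !linearD !linearZ.
rewrite !lin_comb3E !lc !scalerDr !scalerA (mulrC b a) (mulrC a c) (mulrC b c).
by rewrite [LHS](AC (3*3*3) (1*5*9*(2*4)*(7*3)*(8*6))).
Qed.

Lemma sum_lin_comb3_sqr (K : fieldType) (V : vectType K) n (a b c : 'I_n -> K)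
    (f g h : 'End(V)) v :
  \sum_i a i * a i = 0 -> \sum_i b i * b i = 0 -> \sum_i c i * c i = - 1 ->
  \sum_i a i * b i = - 2%:R -> \sum_i c i * a i = 0 -> \sum_i c i * b i = 0 ->
  - \sum_i lin_comb3 (a i) (b i) (c i) f g h (lin_comb3 (a i) (b i) (c i) f g h v)
  = h (h v) + 2%:R *: f (g v) + 2%:R *: g (f v).
Proof.
move=> aa bb cc ab ca cb; under eq_bigr do rewrite lin_comb3_sqr.
rewrite !big_split /= -!scaler_suml aa bb cc ab ca cb !scale0r !addr0 !add0r.
by rewrite scaleN1r scalerDr !scaleNr opprD opprD !opprK addrA.
Qed.

Definition casimir_op (K : fieldType) (V : vectType K) (e f h : 'End(V)) : 'End(V) :=
  ((h \o h) + 2%:R *: (e \o f) + 2%:R *: (f \o e))%VF.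

Lemma casimir_opE (K : fieldType) (V : vectType K) (e f h : 'End(V)) v :
  casimir_op e f h v = h (h v) + 2%:R *: e (f v) + 2%:R *: f (e v).
Proof. by rewrite /casimir_op !add_lfunE !scale_lfunE !comp_lfunE. Qed.

Definition scalar_op (K : fieldType) (V : vectType K) (c : K) : 'End(V) := c *: \1%VF.

Lemma scalar_opE (K : fieldType) (V : vectType K) (c : K) (v : V) :
  scalar_op V c v = c *: v.
Proof. by rewrite /scalar_op scale_lfunE id_lfunE. Qed.

(** * The Casimir operator in terms of sl(2) *)

Section SL2.
Variable R : realType.
Implicit Types T : finType.

(** [E, F] = H, [H, E] = 2 E and [H, F] = - 2 F. *)
Definition sl2_relations T (E F H : 'End(vec R T)) : Prop :=
  [/\ forall v, E (F v) = F (E v) + H v,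
      forall v, H (E v) = E (H v) + E v + E v &
      forall v, H (F v) = F (H v) - F v - F v].

Definition sl2_act T (E F H : 'End(vec R T)) (x : 'M[R[i]]_2) : 'End(vec R T) :=
  lin_comb3 (x ord0 ord_max) (x ord_max ord0) (x ord0 ord0) E F H.

Lemma sl2_actE T (E F H : 'End(vec R T)) x v : sl2_act E F H x v =
  x ord0 ord_max *: E v + x ord_max ord0 *: F v + x ord0 ord0 *: H v.
Proof. exact: lin_comb3E. Qed.

(** Let M be the matrix of coordinates of the xi a. Orthonormality reads M N = 1,
   where N is the transpose of M corrected by the Gram matrix of the scalar
   product; the conclusion is N M = 1. *)
Lemma orthonormal_dual (xi : 'I_3 -> 'M[R[i]]_2) : su2_orthonormal xi ->
  let s (i j k l : 'I_2) := \sum_a xi a i j * xi a k l in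
  [/\ s ord0 ord0 ord0 ord0 = -1, s ord0 ord_max ord0 ord_max = 0,
      s ord_max ord0 ord_max ord0 = 0 &
   [/\ s ord0 ord0 ord0 ord_max = 0, s ord0 ord0 ord_max ord0 = 0 &
      s ord0 ord_max ord_max ord0 = - 2%:R]].
Proof.
move=> [xs xd] s.
pose M : 'M[R[i]]_3 := \matrix_(a, j)
  [:: xi a ord0 ord0; xi a ord0 ord_max; xi a ord_max ord0]`_j.
pose N : 'M[R[i]]_3 := \matrix_(j, a)
  [:: - xi a ord0 ord0; - 2%:R^-1 * xi a ord_max ord0; - 2%:R^-1 * xi a ord0 ord_max]`_j.
have MN : M *m N = 1%:M.
  apply/matrixP => a b; rewrite !mxE -xd /su2_dot tr2E !mul2E.
  rewrite (su2_trace0 (xs a)) (su2_trace0 (xs b)).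
  rewrite !big_ord_recl big_ord0 !mxE /=.
  by field.
have /matrixP NM := mulmx1C MN.
have e (i j : 'I_3) : \sum_a N i a * M a j = (i == j)%:R by have := NM i j; rewrite !mxE.
pose o1 : 'I_3 := inord 1; pose o2 : 'I_3 := inord 2.
have N0 a : N ord0 a = - xi a ord0 ord0 by rewrite mxE.
have N1 a : N o1 a = - 2%:R^-1 * xi a ord_max ord0 by rewrite mxE inordK.
have N2 a : N o2 a = - 2%:R^-1 * xi a ord0 ord_max by rewrite mxE inordK.
have M0 a : M a ord0 = xi a ord0 ord0 by rewrite mxE.
have M1 a : M a o1 = xi a ord0 ord_max by rewrite mxE inordK.
have M2 a : M a o2 = xi a ord_max ord0 by rewrite mxE inordK.
have half i j k l c : \sum_a - 2%:R^-1 * xi a i j * xi a k l = c -> s i j k l = - 2%:R * c.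
  by move=> <-; rewrite mulr_sumr; apply: eq_bigr => a _; field.
have neg i j k l c : \sum_a - xi a i j * xi a k l = c -> s i j k l = - c.
  by move=> <-; rewrite -sumrN; apply: eq_bigr => a _; ring.
have oE : (o1 == o2 = false) * (o2 == o1 = false) * (ord0 == o1 = false) * (ord0 == o2 = false).
  by rewrite -!val_eqE /= !inordK.
have eT i : \sum_a N i a * M a i = 1 by rewrite e eqxx.
have eF i j : (i == j) = false -> \sum_a N i a * M a j = 0 by rewrite e => ->.
split; last split.
- by apply: neg; rewrite -[RHS](eT ord0); apply: eq_bigr => a _; rewrite N0 M0.
- rewrite (half _ _ _ _ 0) ?mulr0 // -[RHS](eF o2 o1) ?oE //.
  by apply: eq_bigr => a _; rewrite N2 M1.
- rewrite (half _ _ _ _ 0) ?mulr0 // -[RHS](eF o1 o2) ?oE //.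
  by apply: eq_bigr => a _; rewrite N1 M2.
- rewrite (neg _ _ _ _ 0) ?oppr0 // -[RHS](eF ord0 o1) ?oE //.
  by apply: eq_bigr => a _; rewrite N0 M1.
- rewrite (neg _ _ _ _ 0) ?oppr0 // -[RHS](eF ord0 o2) ?oE //.
  by apply: eq_bigr => a _; rewrite N0 M2.
- rewrite (half _ _ _ _ 1) ?mulr1 // -[RHS](eT o2).
  by apply: eq_bigr => a _; rewrite N2 M2.
Qed.

Lemma cas_sl2 T (xi : 'I_3 -> 'M[R[i]]_2) (E F H : 'End(vec R T)) v :
  su2_orthonormal xi ->
  cas xi (sl2_act E F H) v = H (H v) + 2%:R *: E (F v) + 2%:R *: F (E v).
Proof.
by move=> /orthonormal_dual[? ? ? [? ? ?]]; rewrite casE sum_lin_comb3_sqr.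
Qed.

End SL2.

(** * The weight basis of V_m *)

Section IrreducibleSL2.
Variable R : realType.
Variable m : nat.

(** On polynomials in z and w, the operators E, F and H are z d/dw, w d/dz and
   z d/dz - w d/dw. *)
Definition irrE : 'End(vec R 'I_m.+1) :=
  mx_hom (fun j k : 'I_m.+1 => (m - k)%:R * (j == k.+1 :> nat)%:R).
Definition irrF : 'End(vec R 'I_m.+1) :=
  mx_hom (fun j k : 'I_m.+1 => k%:R * (j.+1 == k :> nat)%:R).
Definition irrH : 'End(vec R 'I_m.+1) :=
  mx_hom (fun j k : 'I_m.+1 => (k%:R - (m - k)%:R) * (j == k)%:R).

Lemma sl2_actc T (E F H : 'End(vec R T)) x v a : sl2_act E F H x v a =
  x ord0 ord_max * E v a + x ord_max ord0 * F v a + x ord0 ord0 * H v a.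
Proof.
have lin3 (b c d : R[i]) (u1 u2 u3 : vec R T) :
  (b *: u1 + c *: u2 + d *: u3) a = b * u1 a + c * u2 a + d * u3 a.
  by rewrite 2!vecD 3!vecZ.
by rewrite sl2_actE; exact: lin3.
Qed.

Lemma dirr_sl2 x : su2 x -> dirr m x = sl2_act irrE irrF irrH x.
Proof.
move=> /su2_trace0 tx; apply: lfun_vecP => k; apply/ffunP => j.
rewrite sl2_actc !mx_hom_dvec /dirrmx tx.
move: (x ord0 ord0) (x ord0 ord_max) (x ord_max ord0) => a b c.
rewrite coefD !coefMn !mulrDr !coefD -!scalerAr !coefZ ['X^_ * _%:P]mulrC.
rewrite ['X^k * _%:P]mulrC !coefCM -!exprSr !coefXn -[j == k]val_eqE /=.
case: (nat_of_ord k) => [|k'] /=.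
  rewrite mulr0n -[X in _ + X]mulr_natr; move: (m - 0)%:R (_ == 1%N)%:R (_ == 0%N)%:R.
  by move=> *; ring.
rewrite eqSS -[X in X + _]mulr_natr -[X in _ + X]mulr_natr.
move: k'.+1%:R (m - _)%:R (_ == k'.+1)%:R (_ == k'.+2)%:R (_ == k')%:R.
by move=> *; ring.
Qed.

(** The monomial z^k w^(m - k); allowing k > m, where it is zero, avoids ordinal
   arithmetic. *)
Definition ev (k : nat) : vec R 'I_m.+1 := [ffun j : 'I_m.+1 => (j == k :> nat)%:R].

Lemma evE k j : ev k j = (j == k :> nat)%:R.
Proof. by rewrite ffunE. Qed.

Lemma dvec_ev (k : 'I_m.+1) : dvec R k = ev k.
Proof. by apply/ffunP => j; rewrite evE. Qed.

Lemma ev_out k : (m < k)%N -> ev k = 0.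
Proof.
move=> mk; apply/ffunP => j; rewrite evE vec0.
by rewrite ltn_eqF // (leq_trans (ltn_ord j)).
Qed.

Lemma irrE_ev k : irrE (ev k) = (m - k)%:R *: ev k.+1.
Proof.
have [mk|km] := ltnP m k.
  have -> : (m - k = 0)%N by lia.
  by rewrite ev_out // linear0 scale0r.
rewrite -[k]/(nat_of_ord (Ordinal (km : k < m.+1)%N)) -dvec_ev.
by apply/ffunP => j; rewrite mx_hom_dvec vecZ evE.
Qed.

Lemma irrF_ev k : (k <= m)%N -> irrF (ev k) = k%:R *: ev k.-1.
Proof.
move=> km.
rewrite -[k]/(nat_of_ord (Ordinal (km : k < m.+1)%N)) -dvec_ev.
apply/ffunP => j; rewrite mx_hom_dvec vecZ evE /=.
by case: k km => [|k] km; rewrite ?mul0r // eqSS.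
Qed.

Lemma irrH_ev k : irrH (ev k) = (k%:R - (m - k)%:R) *: ev k.
Proof.
have [mk|km] := ltnP m k; first by rewrite ev_out // linear0 scaler0.
rewrite -[k]/(nat_of_ord (Ordinal (km : k < m.+1)%N)) -dvec_ev.
by apply/ffunP => j; rewrite mx_hom_dvec vecZ dvecE.
Qed.

Lemma irrH_diag v j : irrH v j = (j%:R - (m - j)%:R) * v j.
Proof.
rewrite mx_homE (bigD1 j) //= eqxx mulr1 big1 ?addr0 // => k kj.
by rewrite eq_sym (negbTE kj) mulr0 mul0r.
Qed.

Lemma ev_homP (V : vectType R[i]) (f g : 'Hom(vec R 'I_m.+1, V)) :
  (forall k, (k <= m)%N -> f (ev k) = g (ev k)) -> f = g.
Proof.
move=> fg; apply/lfunP => v; rewrite (vec_sum v) !linear_sum.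
apply: eq_bigr => k _; rewrite !linearZ /=; congr (_ *: _).
by rewrite dvec_ev fg // -ltnS.
Qed.

Lemma irrEF k : (k <= m)%N -> irrE (irrF (ev k)) = (k * (m - k).+1)%:R *: ev k.
Proof.
move=> km; rewrite irrF_ev // lfunZ irrE_ev scalerA -natrM.
case: k km => [|k] km; first by rewrite !mul0n !scale0r.
by rewrite /= -subSn // subSS.
Qed.

Lemma irrFE k : (k <= m)%N -> irrF (irrE (ev k)) = ((m - k) * k.+1)%:R *: ev k.
Proof.
rewrite leq_eqVlt => /predU1P[->|km]; rewrite irrE_ev lfunZ.
  by rewrite subnn mul0n !scale0r.
by rewrite irrF_ev // scalerA -natrM.
Qed.

Lemma natf_sub k : (k <= m)%N -> (m - k)%:R = m%:R - k%:R :> R[i].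
Proof. by move=> km; rewrite natrB. Qed.

Lemma irr_sl2 : sl2_relations irrE irrF irrH.
Proof.
split=> v.
- suff /lfunP/(_ v) : (irrE \o irrF)%VF = (irrF \o irrE + irrH)%VF.
    by rewrite comp_lfunE add_lfunE comp_lfunE.
  apply: ev_homP => k km; rewrite comp_lfunE add_lfunE comp_lfunE.
  rewrite irrEF // irrFE // irrH_ev -scalerDl; congr (_ *: _).
  by rewrite !natrM -!natr1 natf_sub //; ring.
- suff /lfunP/(_ v) : (irrH \o irrE)%VF = (irrE \o irrH + irrE + irrE)%VF.
    by rewrite comp_lfunE 2!add_lfunE comp_lfunE.
  apply: ev_homP => k km; rewrite comp_lfunE 2!add_lfunE comp_lfunE.
  rewrite irrH_ev irrE_ev lfunZ irrH_ev lfunZ irrE_ev !scalerA -!scalerDl.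
  congr (_ *: _); rewrite leq_eqVlt in km; case/predU1P: km => [->|km].
    by rewrite subnn; ring.
  rewrite (natf_sub km) (natf_sub (ltnW km)) -[k.+1%:R]natr1; ring.
- suff /lfunP/(_ v) : (irrH \o irrF)%VF = (irrF \o irrH - irrF - irrF)%VF.
    by rewrite comp_lfunE 2!add_lfunE opp_lfunE comp_lfunE.
  apply: ev_homP => k km; rewrite comp_lfunE 2!add_lfunE opp_lfunE comp_lfunE.
  rewrite irrH_ev irrF_ev // lfunZ irrH_ev lfunZ irrF_ev // !scalerA.
  rewrite -!scaleNr -!scalerDl; congr (_ *: _).
  case: k km => [|k] km; first by ring.
  rewrite /= (natf_sub km) (natf_sub (ltnW km)) -[k.+1%:R]natr1; ring.
Qed.

Lemma irr_cas (xi : 'I_3 -> 'M[R[i]]_2) v : su2_orthonormal xi ->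
  cas xi (dirr m) v = (m * (m + 2))%:R *: v.
Proof.
move=> xio; have -> : cas xi (dirr m) v = cas xi (sl2_act irrE irrF irrH) v.
  rewrite !casE; congr (- _); apply: eq_bigr => i _.
  by rewrite dirr_sl2 //; case: xio.
rewrite cas_sl2 // -casimir_opE -scalar_opE; congr fun_of_lfun; move: v => _.
apply: ev_homP => k km; rewrite casimir_opE scalar_opE.
rewrite irrEF // irrFE // irrH_ev lfunZ irrH_ev.
rewrite !scalerA -!scalerDl; congr (_ *: _).
by rewrite !natrM natrD -!natr1 natf_sub //; ring.
Qed.

End IrreducibleSL2.

(** * Lowest weight vectors *)

Section LowestWeight.
Variable R : realType.
Variables (T : finType) (E F H : 'End(vec R T)) (m : nat) (v0 : vec R T).
Hypothesis rel : sl2_relations E F H.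
Hypothesis Fv0 : F v0 = 0.
Hypothesis Hv0 : H v0 = - m%:R *: v0.
Hypothesis v0_neq0 : v0 != 0.
Hypothesis nilE : exists N, iter N E v0 = 0.

Local Notation w k := (iter k E v0).

Let Hw k : H (w k) = (k%:R + k%:R - m%:R) *: w k.
Proof.
have [_ HE _] := rel; elim: k => [|k IH]; first by rewrite /= Hv0 addr0 sub0r.
rewrite iterS HE IH lfunZ -[E _ in X in _ + X]scale1r -[E (w k) in X in X + _]scale1r.
by rewrite scalerA mulr1 -!scalerDl -natr1; congr (_ *: _); ring.
Qed.

Let Fw k : F (w k.+1) = (k.+1%:R * (m%:R - k%:R)) *: w k.
Proof.
have [EF _ _] := rel.
have FE v : F (E v) = E (F v) - H v by rewrite EF addrK.
elim: k => [|k IH]; first by rewrite /= FE Fv0 linear0 Hv0 sub0r -scaleNr; congr (_ *: _); ring.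
rewrite iterS FE IH lfunZ Hw -iterS -scalerBl; congr (_ *: _).
by rewrite -[k.+2%:R]natr1 -[k.+1%:R]natr1; ring.
Qed.

(* The vectors w k vanish for large k, and F sends w k.+1 to a nonzero multiple of
   w k as long as k > m: descend from large k to m.+1. *)
Let w_out : w m.+1 = 0.
Proof.
have [N wN] := nilE.
have step k : (m < k)%N -> w k.+1 = 0 -> w k = 0.
  move=> mk wk; have /eqP := Fw k; rewrite wk linear0 eq_sym scaler_eq0 mulf_eq0.
  rewrite pnatr_eq0 /= subr_eq0 eqr_nat => /orP[/eqP mk'|/eqP //].
  by rewrite mk' ltnn in mk.
have le_out k : (N <= k)%N -> w k = 0.
  by move=> /subnK <-; elim: (k - N)%N => [|d IH] //=; rewrite IH linear0.
have down d : w (m.+1 + d) = 0 -> w m.+1 = 0.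
  elim: d => [|d IH]; first by rewrite addn0.
  by rewrite addnS => /step h; apply: IH; apply: h; lia.
by apply: (down N); apply: le_out; lia.
Qed.

Let w_neq0 k : (k <= m)%N -> w k != 0.
Proof.
elim: k => [|k IH] km //; apply/eqP => wk.
have /eqP := Fw k; rewrite wk linear0 eq_sym scaler_eq0 mulf_eq0 pnatr_eq0 /=.
rewrite subr_eq0 eqr_nat (negbTE (IH (ltnW km))) orbF => /eqP mk.
by rewrite mk ltnn in km.
Qed.

Let coef k : R[i] := (m - k)`!%:R / m`!%:R.

Let coef_neq0 k : coef k != 0.
Proof. by rewrite mulf_neq0 ?invr_eq0 // pnatr_eq0 -lt0n fact_gt0. Qed.

Let coefS k : (k < m)%N -> coef k = (m - k)%:R * coef k.+1.
Proof.
move=> km; rewrite /coef mulrA -natrM; congr (_%:R / _).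
have -> : (m - k = (m - k.+1).+1)%N by lia.
by rewrite factS.
Qed.

(** The coefficient (m - k)!/m! compensates for the factor m - k in the action of E
   on z^k w^(m - k). *)
Definition lowest_weight_hom : 'Hom(vec R 'I_m.+1, vec R T) :=
  mx_hom (fun a (k : 'I_m.+1) => coef k * w k a).
Local Notation j := lowest_weight_hom.

Let jE k : (k <= m)%N -> j (ev R m k) = coef k *: w k.
Proof.
move=> km; rewrite -[k]/(nat_of_ord (Ordinal (km : k < m.+1)%N)) -dvec_ev.
by apply/ffunP => a; rewrite mx_hom_dvec vecZ.
Qed.

(** A lowest weight vector of weight - m generates a copy of V_m: the relations of
   sl(2) dictate the action on the E^k v0, and E^(m + 1) v0 vanishes. *)
Lemma lowest_weight_intertwine :
  [/\ (j \o irrE R m = E \o j)%VF, (j \o irrF R m = F \o j)%VF &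
      (j \o irrH R m = H \o j)%VF].
Proof.
split; apply: ev_homP => k km; rewrite 2!comp_lfunE jE //.
- rewrite irrE_ev 2!lfunZ -iterS; rewrite leq_eqVlt in km; case/predU1P: km => [->|km].
    by rewrite subnn scale0r w_out scaler0.
  by rewrite jE // scalerA -coefS.
- rewrite irrF_ev // 2!lfunZ; case: k km => [|k] km; first by rewrite scale0r /= Fv0 scaler0.
  rewrite Fw.
  rewrite -[k.+1.-1]/k.
  rewrite (jE (ltnW km)).
  rewrite scalerA.
  rewrite scalerA.
  rewrite (coefS km).
  congr (_ *: _).
  by rewrite (natf_sub R (ltnW km)); ring.
rewrite irrH_ev 2!lfunZ (jE km) Hw 2!scalerA mulrC; congr (_ * _ *: _).
by rewrite natf_sub //; ring.
Qed.

(** The vectors E^k v0, for k <= m, are nonzero and have distinct weights. *)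
Lemma lowest_weight_inj : lker j = 0%VS.
Proof.
apply/eqP; rewrite -subv0; apply/subvP => u; rewrite memv_ker memv0 => /eqP ju.
pose W (k : 'I_m.+1) := j (u k *: dvec R k).
have WE k : W k = (u k * coef k) *: w k by rewrite /W lfunZ dvec_ev jE ?scalerA // -ltnS.
have sW : \sum_k W k = 0.
  by rewrite -[RHS]ju [in RHS](vec_sum u) linear_sum.
apply/eqP/ffunP => k; rewrite vec0.
have := @joint_eigen_sum _ _ unit _ (fun=> H) (fun (i : 'I_m.+1) _ => i%:R + i%:R - m%:R)
  (fun=> k%:R + k%:R - m%:R) (index_enum _) W.
have h1 (i : 'I_m.+1) (a : unit) : H (W i) = (i%:R + i%:R - m%:R) *: W i.
  by rewrite WE lfunZ Hw 2!scalerA mulrC.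
have h2 (a : unit) : H (\sum_i W i) = (k%:R + k%:R - m%:R) *: \sum_i W i.
  by rewrite sW linear0 scaler0.
move=> /(_ h1 h2).
rewrite sW (big_pred1 k) => [|i].
  rewrite WE => /esym/eqP; rewrite scaler_eq0 mulf_eq0 (negbTE (coef_neq0 _)) orbF.
  by rewrite (negbTE (w_neq0 (leq_ord k))) orbF => /eqP.
apply/asboolP/eqP => [/(congr1 (fun f => f tt))|-> //].
move=> /(congr1 (fun x => x + m%:R)); rewrite !subrK -!natrD => /eqP.
rewrite eqr_nat => /eqP e; apply: val_inj => /=; lia.
Qed.

End LowestWeight.

(** * The Clebsch-Gordan decomposition *)

Section TensorSL2.
Variable R : realType.
Implicit Types S T : finType.

Lemma dtens_sl2_relations S T (E F H : 'End(vec R S)) (E' F' H' : 'End(vec R T)) :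
  sl2_relations E F H -> sl2_relations E' F' H' ->
  sl2_relations (dtens E E') (dtens F F') (dtens H H').
Proof.
move=> [EF HE HF] [EF' HE' HF'].
(* The cross terms are symmetric in the two operators, hence cancel in every
   commutator. *)
have cross (A B C : 'End(vec R S)) (A' B' C' : 'End(vec R T)) u v :
   (forall w, A (B w) = C w) -> (forall w, A' (B' w) = C' w) ->
   dtens A A' (dtens B B' (tens_vec u v)) =
   tens_vec (C u) v + tens_vec u (C' v) + (tens_vec (A u) (B' v) + tens_vec (B u) (A' v)).
  move=> ABC ABC'; rewrite dtensE lfunD 2!dtensE ABC ABC'.
  by rewrite [LHS](AC (2*2) (1*4*(3*2))).
split=> v.
- suff /lfunP/(_ v) : (dtens E E' \o dtens F F')%VF = (dtens F F' \o dtens E E' + dtens H H')%VF.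
    by rewrite comp_lfunE add_lfunE comp_lfunE.
  apply: tens_homP => u {}v; rewrite comp_lfunE add_lfunE comp_lfunE.
  rewrite (cross _ _ (F \o E + H)%VF _ _ (F' \o E' + H')%VF); last 2 first.
  + by move=> w; rewrite add_lfunE comp_lfunE.
  + by move=> w; rewrite add_lfunE comp_lfunE.
  rewrite (cross _ _ (F \o E)%VF _ _ (F' \o E')%VF); last 2 first.
  + by move=> w; rewrite comp_lfunE.
  + by move=> w; rewrite comp_lfunE.
  rewrite 2!add_lfunE tens_vecDl tens_vecDr dtensE.
  by rewrite [LHS](AC (2*2*2) (1*3*(6*5)*(2*4))).
- suff /lfunP/(_ v) : (dtens H H' \o dtens E E')%VF = (dtens E E' \o dtens H H' + dtens E E' + dtens E E')%VF.
    by rewrite comp_lfunE 2!add_lfunE comp_lfunE.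
  apply: tens_homP => u {}v; rewrite comp_lfunE 2!add_lfunE comp_lfunE.
  rewrite (cross _ _ (E \o H + E + E)%VF _ _ (E' \o H' + E' + E')%VF); last 2 first.
  + by move=> w; rewrite 2!add_lfunE comp_lfunE.
  + by move=> w; rewrite 2!add_lfunE comp_lfunE.
  rewrite (cross _ _ (E \o H)%VF _ _ (E' \o H')%VF); last 2 first.
  + by move=> w; rewrite comp_lfunE.
  + by move=> w; rewrite comp_lfunE.
  rewrite 4!add_lfunE 2!tens_vecDl 2!tens_vecDr dtensE.
  by rewrite [LHS](AC (3*3*2) (1*4*(8*7)*(2*5)*(3*6))).
- suff /lfunP/(_ v) : (dtens H H' \o dtens F F')%VF = (dtens F F' \o dtens H H' - dtens F F' - dtens F F')%VF.
    by rewrite comp_lfunE 2!add_lfunE opp_lfunE comp_lfunE.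
  apply: tens_homP => u {}v; rewrite comp_lfunE 2!add_lfunE opp_lfunE comp_lfunE.
  rewrite (cross _ _ (F \o H - F - F)%VF _ _ (F' \o H' - F' - F')%VF); last 2 first.
  + by move=> w; rewrite 2!add_lfunE opp_lfunE comp_lfunE.
  + by move=> w; rewrite 2!add_lfunE opp_lfunE comp_lfunE.
  rewrite (cross _ _ (F \o H)%VF _ _ (F' \o H')%VF); last 2 first.
  + by move=> w; rewrite comp_lfunE.
  + by move=> w; rewrite comp_lfunE.
  rewrite 4!add_lfunE 2!opp_lfunE 2!tens_vecDl 2!tens_vecDr tens_vecNl tens_vecNr dtensE.
  by rewrite [LHS](AC (3*3*2) (1*4*(8*7)*(2*5)*(3*6))) opprD.
Qed.

Lemma dtens_sl2_act S T (E F H : 'End(vec R S)) (E' F' H' : 'End(vec R T)) x :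
  dtens (sl2_act E F H x) (sl2_act E' F' H' x) =
  sl2_act (dtens E E') (dtens F F') (dtens H H') x.
Proof.
have lin3 (a b c : R[i]) (u1 u2 u3 u : vec R S) (v1 v2 v3 v : vec R T) :
    tens_vec (a *: u1 + b *: u2 + c *: u3) v + tens_vec u (a *: v1 + b *: v2 + c *: v3) =
    a *: (tens_vec u1 v + tens_vec u v1) + b *: (tens_vec u2 v + tens_vec u v2) +
    c *: (tens_vec u3 v + tens_vec u v3).
  rewrite 2!tens_vecDl 2!tens_vecDr 3!tens_vecZl 3!tens_vecZr 3!scalerDr.
  by rewrite [LHS](AC (3*3) ((1*4)*(2*5)*(3*6))).
apply: tens_homP => u v; rewrite sl2_actE 4!dtensE 2!sl2_actE.
exact: lin3.
Qed.

End TensorSL2.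

Section ClebschGordan.
Variable R : realType.
Variables p q : nat.

Let E := dtens (irrE R p) (irrE R q).
Let F := dtens (irrF R p) (irrF R q).
Let H := dtens (irrH R p) (irrH R q).

(** This is (w1 z2 - z1 w2)^r w1^(p - r) w2^(q - r), where z1, w1 are the variables
   of V_p and z2, w2 those of V_q. *)
Definition cg_vector (r : nat) : vec R ('I_p.+1 * 'I_q.+1)%type :=
  \sum_(i < r.+1) ((-1) ^+ i * 'C(r, i)%:R) *: tens_vec (ev R p i) (ev R q (r - i)).

Lemma cg_vector_F r : (r <= p)%N -> (r <= q)%N -> F (cg_vector r) = 0.
Proof.
move=> rp rq.
pose t i j := tens_vec (ev R p i) (ev R q j).
have Ft (i : 'I_r.+1) : F (t i (r - i)%N) = i%:R *: t i.-1 (r - i)%N + (r - i)%:R *: t i (r - i).-1.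
  rewrite dtensE irrF_ev ?(leq_trans (leq_ord i)) // irrF_ev ?(leq_trans (leq_subr _ _)) //.
  by rewrite tens_vecZl tens_vecZr.
rewrite /cg_vector lfun_sum.
rewrite (eq_bigr (fun i : 'I_r.+1 => ((-1) ^+ i * 'C(r, i)%:R * i%:R) *: t i.-1 (r - i)%N
   + ((-1) ^+ i * 'C(r, i)%:R * (r - i)%:R) *: t i (r - i).-1)); last first.
  by move=> i _; rewrite lfunZ -/(t _ _) Ft scalerDr 2!scalerA.
rewrite big_split /= big_ord_recl [X in _ + X]big_ord_recr /= subnn mulr0 scale0r.
rewrite mulr0 scale0r add0r addr0 -big_split /= big1 // => i _.
rewrite /bump /= add1n.
have -> : (r - i.+1 = (r - i).-1)%N by lia.
rewrite -scalerDl; set c := (X in X *: _).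
suff -> : c = 0 by rewrite scale0r.
rewrite /c exprS -!mulrA -!natrM -[('C(r, i.+1) * _)%N]mulnC mul_bin_left.
by rewrite mulnC; ring.
Qed.

Lemma cg_vector_H r : (r <= p)%N -> (r <= q)%N ->
  H (cg_vector r) = - (p + q - r.*2)%:R *: cg_vector r.
Proof.
move=> rp rq; rewrite /cg_vector lfun_sum scaler_sumr; apply: eq_bigr => i _.
rewrite lfunZ dtensE 2!irrH_ev tens_vecZl tens_vecZr -scalerDl 2!scalerA.
have ir := leq_ord i; congr (_ *: _).
rewrite mulrC; congr (_ * _).
have -> : (r - i)%:R = r%:R - i%:R :> R[i] by rewrite natrB.
have -> : (p - i)%:R = p%:R - i%:R :> R[i] by rewrite natrB // (leq_trans ir).
have -> : (q - (r - i))%:R = q%:R - r%:R + i%:R :> R[i].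
  by rewrite !natrB //; [ring|lia].
have -> : (p + q - r.*2)%:R = p%:R + q%:R - r%:R - r%:R :> R[i].
  by rewrite natrB -?addnn ?natrD; [ring|lia].
by ring.
Qed.

Lemma cg_vector_neq0 r : (r <= q)%N -> cg_vector r != 0.
Proof.
move=> rq; apply/eqP => /ffunP/(_ (ord0, Ordinal (rq : r < q.+1)%N)).
rewrite vec_sumE vec0 big_ord_recl /= subn0 bin0 expr0 mul1r vecZ tens_vecE !evE /=.
rewrite eqxx big1 => [|i _].
  by move=> /eqP; rewrite !mulr1 addr0 oner_eq0.
by rewrite vecZ tens_vecE evE /= mul0r mulr0.
Qed.

Lemma tens_H_diag v i j :
  H v (i, j) = ((i%:R - (p - i)%:R) + (j%:R - (q - j)%:R)) * v (i, j).
Proof.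
pose D : 'End(vec R ('I_p.+1 * 'I_q.+1)%type) :=
  mx_hom (fun a b : 'I_p.+1 * 'I_q.+1 =>
  ((a.1%:R - (p - a.1)%:R) + (a.2%:R - (q - a.2)%:R)) * (a == b)%:R).
have DE u a : D u a = ((a.1%:R - (p - a.1)%:R) + (a.2%:R - (q - a.2)%:R)) * u a.
  rewrite mx_homE (eq_bigr (fun b => ((a.1%:R - (p - a.1)%:R) + (a.2%:R - (q - a.2)%:R)) *
    (u b * (a == b)%:R))); last by move=> b _; rewrite mulrAC mulrA.
  by rewrite -mulr_sumr sum_delta.
suff -> : H = D by rewrite DE.
apply: tens_homP => u w; apply/ffunP => -[a b].
by rewrite DE dtensE vecD 3!tens_vecE 2!irrH_diag /=; ring.
Qed.

(** The weights of the tensor product are at most p + q, and each application of E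
   raises the weight by 2. *)
Lemma cg_nilpotent r : (r <= p)%N -> (r <= q)%N ->
  exists N, iter N E (cg_vector r) = 0.
Proof.
move=> rp rq; have [_ HE _] := dtens_sl2_relations (irr_sl2 R p) (irr_sl2 R q).
have Hw k : H (iter k E (cg_vector r)) = (k%:R + k%:R - (p + q - r.*2)%:R) *: iter k E (cg_vector r).
  elim: k => [|k IH]; first by rewrite cg_vector_H // addr0 sub0r.
  rewrite iterS HE -/H -/E IH lfunZ -[E _ in X in _ + X]scale1r -[E (iter _ _ _) in X in X + _]scale1r.
  by rewrite scalerA mulr1 -!scalerDl -natr1; congr (_ *: _); ring.
pose N := (p + q).+1; exists N.
apply/ffunP => -[i j]; rewrite vec0.
have := congr1 (fun v : vec R _ => v (i, j)) (Hw N).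
rewrite tens_H_diag vecZ => /eqP; rewrite -subr_eq0 -mulrBl mulf_eq0 => /orP[|/eqP //].
have ip := leq_ord i; have jq := leq_ord j.
have rpq : (r.*2 <= p + q)%N by lia.
rewrite (natrB _ ip) (natrB _ jq) (natrB _ rpq) => /eqP e; exfalso.
have : (i + i + j + j)%:R = (N + N + r.*2)%:R :> R[i].
  apply/eqP; rewrite -subr_eq0 -[X in _ == X]e !natrD; apply/eqP; ring.
move=> /eqP; rewrite eqr_nat /N => /eqP; lia.
Qed.
End ClebschGordan.

Lemma lfun_comb3 (K : fieldType) (V W : vectType K) (f : 'Hom(V, W)) a b c u v w :
  f (a *: u + b *: v + c *: w) = a *: f u + b *: f v + c *: f w.
Proof. by rewrite !lfunD !lfunZ. Qed.

Lemma vspan_sub (K : fieldType) (V : vectType K) (A : set V) v : A v -> v \in vspan A.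
Proof. by rewrite /vspan; case: cid => U /= [h _]; apply: h. Qed.

Lemma vspan_min (K : fieldType) (V : vectType K) (A : set V) (W : {vspace V}) :
  (forall v, A v -> v \in W) -> (vspan A <= W)%VS.
Proof. by rewrite /vspan; case: cid => U /= [_ h]; apply: h. Qed.

(** The Casimir operator tells the representations V_m apart. *)
Lemma eqr_casimir (K : numFieldType) m k :
  ((m * (m + 2))%:R == (k * (k + 2))%:R :> K) = (m == k).
Proof. by rewrite eqr_nat; apply/eqP/eqP => [|-> //]; nia. Qed.

Section ClebschGordanTheorem.
Variable R : realType.
Implicit Types S T : finType.

Definition intertwiner S T (rho : rep R S) (sigma : rep R T)
  (f : 'Hom(vec R S, vec R T)) := forall g v, SU2 g -> f (rho g v) = sigma g (f v).

Definition irreducible_image T (rho : rep R T) m (U : {vspace vec R T}) :=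
  exists f : 'Hom(vec R 'I_m.+1, vec R T),
    [/\ intertwiner (@irr R m) rho f, lker f = 0%VS & limg f = U].

Lemma intertwiner_cas T (rho : rep R T) D m (f : 'Hom(vec R 'I_m.+1, vec R T))
    (xi : 'I_3 -> 'M[R[i]]_2) u : su2_orthonormal xi -> has_differential rho D ->
  intertwiner (@irr R m) rho f -> cas xi D (f u) = (m * (m + 2))%:R *: f u.
Proof.
move=> xio rhoD fI; rewrite (@cas_intertwine _ _ _ _ (dirr m)) ?irr_cas ?lfunZ // => i.
apply: (intertwine_group_lie (@irr_differential R m) rhoD fI).
exact: orthonormal_unit.
Qed.

Lemma dim_vec T : dim (vec R T) = #|T|.
Proof. exact: muln1. Qed.

Lemma limg_inj_dim T m (f : 'Hom(vec R 'I_m.+1, vec R T)) : lker f = 0%VS ->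
  \dim (limg f) = m.+1.
Proof.
by move=> kf; rewrite limg_dim_eq ?kf ?capv0 // dimvf dim_vec card_ord.
Qed.

Lemma sl2_act_intertwine S T (E F H : 'End(vec R S)) (E' F' H' : 'End(vec R T))
    (f : 'Hom(vec R S, vec R T)) x :
  (f \o E = E' \o f)%VF -> (f \o F = F' \o f)%VF -> (f \o H = H' \o f)%VF ->
  (f \o sl2_act E F H x = sl2_act E' F' H' x \o f)%VF.
Proof.
move=> /lfunP fE /lfunP fF /lfunP fH; apply/lfunP => v.
have := fE v; have := fF v; have := fH v; rewrite !comp_lfunE 2!sl2_actE => eH eF eE.
by rewrite -eE -eF -eH; apply: lfun_comb3.
Qed.

Section Irreducibles.
Variables (xi : 'I_3 -> 'M[R[i]]_2) (p q : nat).
Hypothesis xio : su2_orthonormal xi.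

Let rho := tens_rep (@irr R p) (@irr R q).

Lemma tens_irr_differential :
  has_differential rho (fun x => dtens (dirr p x) (dirr q x)).
Proof.
by apply: tens_rep_differential; [case: (irr_mult R p)|exact: irr_differential|
  case: (irr_mult R q)|exact: irr_differential].
Qed.

Definition cg_hom r : 'Hom(vec R 'I_(p + q - r.*2).+1, vec R ('I_p.+1 * 'I_q.+1)%type) :=
  lowest_weight_hom (dtens (irrE R p) (irrE R q)) (p + q - r.*2) (cg_vector R p q r).

Lemma cg_hom_intertwiner r : (r <= p)%N -> (r <= q)%N ->
  intertwiner (@irr R _) rho (cg_hom r).
Proof.
move=> rp rq g v; apply: (intertwine_lie_group (irr_mult R _) (@irr_differential R _)
   (tens_rep_mult (irr_mult R p) (irr_mult R q)) tens_irr_differential) => x [sx _].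
rewrite 3?dirr_sl2 // dtens_sl2_act.
have [jE jF jH] := lowest_weight_intertwine
  (dtens_sl2_relations (irr_sl2 R p) (irr_sl2 R q)) (cg_vector_F R rp rq)
  (cg_vector_H R rp rq) (cg_vector_neq0 R p rq) (cg_nilpotent R rp rq).
exact: sl2_act_intertwine.
Qed.

Lemma cg_hom_inj r : (r <= p)%N -> (r <= q)%N -> lker (cg_hom r) = 0%VS.
Proof.
move=> rp rq; apply: (lowest_weight_inj
  (dtens_sl2_relations (irr_sl2 R p) (irr_sl2 R q)) (cg_vector_F R rp rq)
  (cg_vector_H R rp rq) (cg_vector_neq0 R p rq)).
Qed.

Lemma cg_hom_cas r u : (r <= p)%N -> (r <= q)%N ->
  cas xi (fun x => dtens (dirr p x) (dirr q x)) (cg_hom r u) =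
  ((p + q - r.*2) * (p + q - r.*2 + 2))%:R *: cg_hom r u.
Proof.
move=> rp rq.
exact: (intertwiner_cas u xio tens_irr_differential (cg_hom_intertwiner rp rq)).
Qed.

Lemma cg_weight_inj r s : (r <= minn p q)%N -> (s <= minn p q)%N ->
  (p + q - r.*2 == p + q - s.*2)%N = (r == s).
Proof. by rewrite !leq_min => *; apply/eqP/eqP => [|-> //]; lia. Qed.

(** The copies of the V_(p + q - 2 r) are independent, since they belong to distinct
   eigenvalues of the Casimir operator, and their dimensions add up to
   (p + 1) (q + 1). *)
Lemma cg_full : (\sum_(r < (minn p q).+1) limg (cg_hom r))%VS = fullv.
Proof.
have le (r : 'I_(minn p q).+1) : (r <= p)%N /\ (r <= q)%N.
  by have := leq_ord r; rewrite leq_min => /andP[].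
have dir : directv (\sum_(r < (minn p q).+1) limg (cg_hom r)).
  apply/directv_sum_independent => us Us s0 r _.
  have Uc s : cas xi (fun x => dtens (dirr p x) (dirr q x)) (us s) =
      ((p + q - s.*2) * (p + q - s.*2 + 2))%:R *: us s.
    have /memv_imgP[u _ ->] := Us s isT.
    by have [rp rq] := le s; rewrite cg_hom_cas.
  have := @joint_eigen_sum _ _ unit _ (fun=> cas xi (fun x => dtens (dirr p x) (dirr q x)))
    (fun (s : 'I_(minn p q).+1) _ => ((p + q - s.*2) * (p + q - s.*2 + 2))%:R)
    (fun=> ((p + q - r.*2) * (p + q - r.*2 + 2))%:R) (index_enum _) us (fun s _ => Uc s).
  rewrite s0 => /(_ _)/esym; rewrite (big_pred1 r) => [|s].
    by apply => _; rewrite lfun0 scaler0.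
  apply/asboolP/eqP => [/(congr1 (fun f => f tt))/eqP|-> //].
  by rewrite eqr_casimir cg_weight_inj ?leq_ord // => /eqP/val_inj.
apply/eqP; rewrite eqEdim subvf (directvP dir) /= dimvf dim_vec card_prod !card_ord.
rewrite (eq_bigr (fun r : 'I_(minn p q).+1 => (p + q - r.*2).+1)); last first.
  by move=> r _; rewrite limg_inj_dim // cg_hom_inj ?(le r).1 ?(le r).2.
have sum_dim k : (k <= p)%N -> (k <= q)%N ->
   \sum_(r < k.+1) (p + q - r.*2).+1 = (k.+1 * (p + q - k).+1)%N.
  elim: k => [|k IH] kp kq; first by rewrite big_ord1 /=; lia.
  rewrite big_ord_recr /= (IH (ltnW kp) (ltnW kq)).
  have [d ->] : exists d, (p + q = k.+1 + k.+1 + d)%N by exists (p + q - (k.+1 + k.+1))%N; lia.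
  have -> : (k.+1 + k.+1 + d - k.+1.*2 = d)%N by lia.
  have -> : (k.+1 + k.+1 + d - k.+1 = k.+1 + d)%N by lia.
  have -> : (k.+1 + k.+1 + d - k = k.+2 + d)%N by lia.
  lia.
rewrite sum_dim ?geq_minl ?geq_minr //; rewrite /minn; case: ifP => _; nia.
Qed.

End Irreducibles.

Lemma tens_space_limg S T S' T' (f : 'Hom(vec R S', vec R S)) (g : 'Hom(vec R T', vec R T)) :
  tens_space (limg f) (limg g) = limg (tens_hom f g).
Proof.
apply/eqP; rewrite eqEsubv; apply/andP; split.
  apply: vspan_min => _ [u [v [/memv_imgP[u' _ ->] /memv_imgP[v' _ ->] ->]]].
  by rewrite -tens_homE memv_img ?memvf.
apply/subvP => _ /memv_imgP[z _ ->]; rewrite (vec_sum z) lfun_sum.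
apply: memv_suml => -[a b] _; rewrite lfunZ memvZ // -tens_dvec tens_homE.
by apply: vspan_sub; exists (f (dvec R a)), (g (dvec R b)); rewrite !memv_img ?memvf.
Qed.

Lemma tens_hom_inj S T S' T' (f : 'Hom(vec R S', vec R S)) (g : 'Hom(vec R T', vec R T)) :
  lker f = 0%VS -> lker g = 0%VS -> lker (tens_hom f g) = 0%VS.
Proof.
move=> /eqP kf /eqP kg; apply/eqP/lker0P.
apply: (can_inj (g := tens_hom f^-1%VF g^-1%VF)) => z.
by rewrite -comp_lfunE tens_hom_comp !lker0_compVf // tens_hom1 id_lfunE.
Qed.

Lemma tens_hom_intertwiner S T S' T' (rho : rep R S) (sigma : rep R T)
    (rho' : rep R S') (sigma' : rep R T')
    (f : 'Hom(vec R S', vec R S)) (g : 'Hom(vec R T', vec R T)) :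
  intertwiner rho' rho f -> intertwiner sigma' sigma g ->
  intertwiner (tens_rep rho' sigma') (tens_rep rho sigma) (tens_hom f g).
Proof.
move=> fI gI h v hS; rewrite !tens_repE -comp_lfunE -[RHS]comp_lfunE; move: v.
apply/lfunP; rewrite !tens_hom_comp; congr tens_hom; apply/lfunP => v.
  by rewrite !comp_lfunE fI.
by rewrite !comp_lfunE gI.
Qed.

Section Decomposition.
Variables (xi : 'I_3 -> 'M[R[i]]_2) (S T : finType) (rho : rep R S) (sigma : rep R T).
Variables (D : 'M[R[i]]_2 -> 'End(vec R (S * T)%type)).
Variables (p q : nat) (U : {vspace vec R S}) (W : {vspace vec R T}).
Hypothesis xio : su2_orthonormal xi.
Hypothesis tauD : has_differential (tens_rep rho sigma) D.
Hypothesis rhoU : irreducible_image rho p U.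
Hypothesis sigmaW : irreducible_image sigma q W.

Let tau := tens_rep rho sigma.
Let X := tens_space U W.

Lemma cg_images : exists h : forall r, 'Hom(vec R 'I_(p + q - r.*2).+1, vec R (S * T)%type),
  [/\ forall r, (r <= minn p q)%N -> intertwiner (@irr R _) tau (h r),
      forall r, (r <= minn p q)%N -> lker (h r) = 0%VS &
      (\sum_(r < (minn p q).+1) limg (h r))%VS = X].
Proof.
have [f [fI fk fU]] := rhoU; have [g [gI gk gW]] := sigmaW.
exists (fun r => (tens_hom f g \o cg_hom p q r)%VF); split=> [r|r|].
- rewrite leq_min => /andP[rp rq] x v xS.
  by rewrite !comp_lfunE cg_hom_intertwiner // (tens_hom_intertwiner fI gI).
- rewrite leq_min => /andP[rp rq]; apply/eqP/lker0P => u v; rewrite !comp_lfunE.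
  have /eqP/lker0P kfg := tens_hom_inj fk gk.
  have /eqP/lker0P kh := cg_hom_inj rp rq.
  by move=> /kfg/kh.
under eq_bigr do rewrite limg_comp.
by rewrite -limg_sum (cg_full p q xio) /X -fU -gW tens_space_limg.
Qed.

(** An intertwining map from V_(p + q - 2 r) has its values in an eigenspace of the
   Casimir operator, which meets X along the image of h r only. *)
Lemma isotypic_image r : (r <= minn p q)%N ->
  forall h : (forall r, 'Hom(vec R 'I_(p + q - r.*2).+1, vec R (S * T)%type)),
  (forall r, (r <= minn p q)%N -> intertwiner (@irr R _) tau (h r)) ->
  (\sum_(r < (minn p q).+1) limg (h r))%VS = X ->
  isotypic tau (p + q - r.*2) X = limg (h r).
Proof.
move=> rpq h hI hX.
have casI m (F : 'Hom(vec R 'I_m.+1, _)) u := intertwiner_cas (f := F) u xio tauD.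
apply/eqP; rewrite eqEsubv; apply/andP; split; last first.
  apply/subvP => w wh; apply: vspan_sub; exists (h r); split=> // [g v gS|].
    exact: hI.
  rewrite -/X -hX; exact: (sumv_sup (Ordinal (rpq : r < (minn p q).+1)%N)).
apply: vspan_min => w [F [FI FX wF]].
have := subvP FX w wF; rewrite -/X -hX => /memv_sumP[ws wsh wE].
have wc : cas xi D w = ((p + q - r.*2) * (p + q - r.*2 + 2))%:R *: w.
  by have /memv_imgP[u _ ->] := wF; apply: casI.
have wsc (s : 'I_(minn p q).+1) : cas xi D (ws s) =
    ((p + q - s.*2) * (p + q - s.*2 + 2))%:R *: ws s.
  by have /memv_imgP[u _ ->] := wsh s isT; apply: casI; apply: hI; rewrite leq_ord.
have := @joint_eigen_sum _ _ unit _ (fun=> cas xi D)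
    (fun (s : 'I_(minn p q).+1) _ => ((p + q - s.*2) * (p + q - s.*2 + 2))%:R)
    (fun=> ((p + q - r.*2) * (p + q - r.*2 + 2))%:R) (index_enum _) ws (fun s _ => wsc s).
rewrite -wE => /(_ (fun _ => wc)) ->.
apply: memv_suml => s /asboolP/(congr1 (fun f => f tt))/eqP.
by rewrite eqr_casimir cg_weight_inj ?leq_ord // => /eqP <-; apply: wsh.
Qed.

Theorem cg_irreducible m : clebsch_gordan p q m ->
  irreducible_image tau m (isotypic tau m X).
Proof.
move=> /and4P[ev1 h1 h2 h3].
have [r rpq ->] : exists2 r, (r <= minn p q)%N & m = (p + q - r.*2)%N.
  exists (p + q - m)./2; first by rewrite leq_min; apply/andP; split; lia.
  lia.
have [h [hI hk hX]] := cg_images; exists (h r); split; [exact: hI|exact: hk|].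
by rewrite (isotypic_image rpq hI hX).
Qed.

Theorem cg_sum : X = (\sum_(r < (minn p q).+1) isotypic tau (p + q - r.*2) X)%VS.
Proof.
have [h [hI hk hX]] := cg_images; rewrite -[LHS]hX; apply: eq_bigr => r _.
by rewrite (isotypic_image _ hI hX) // leq_ord.
Qed.

Lemma cg_weight r : (r <= minn p q)%N -> clebsch_gordan p q (p + q - r.*2).
Proof. by rewrite leq_min => /andP[rp rq]; apply/and4P; split; lia. Qed.

End Decomposition.

End ClebschGordanTheorem.

(** * Spans of sets and isotypic parts *)

Section SpanLemmas.
Variables (K : fieldType) (V : vectType K).

(** Take a finite family of elements of A of maximal rank. *)
Lemma vspan_seq (A : set V) : exists s : seq V,
  (forall v, v \in s -> A v) /\ vspan A = <<s>>%VS.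
Proof.
pose P (d : nat) := `[< exists s : seq V, (forall v, v \in s -> A v) /\ \dim <<s>> = d >].
have exP : exists d, P d.
  by exists (\dim <<[::] : seq V>>)%VS; apply/asboolP; exists [::].
have boundP d : P d -> (d <= \dim {:V})%N.
  by move=> /asboolP[s [_ <-]]; apply/dimvS/subvf.
case: (ex_maxnP exP boundP) => d /asboolP[s [sA sd]] dmax.
exists s; split=> //; apply/eqP; rewrite eqEsubv; apply/andP; split; last first.
  by apply/span_subvP => v /sA /vspan_sub.
apply: vspan_min => v Av.
have sub : (<<s>> <= <<v :: s>>)%VS by rewrite span_cons addvSr.
have : (\dim <<v :: s>> <= \dim <<s>>)%N.
  rewrite sd; apply: dmax; apply/asboolP; exists (v :: s); split=> // w.
  by rewrite inE => /predU1P[->//|/sA].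
rewrite (geq_leqif (dimv_leqif_sup sub)) => /subvP; apply.
by rewrite memv_span ?mem_head.
Qed.

Lemma vspan_sum (A : set V) (v : V) : (forall c w, A w -> A (c *: w)) ->
  v \in vspan A -> exists k (w : 'I_k -> V), (forall i, A (w i)) /\ v = \sum_i w i.
Proof.
move=> AZ; have [s [sA ->]] := vspan_seq A => vs.
exists (size s), (fun i => coord (in_tuple s) i v *: s`_i); split=> [i|].
  by apply/AZ/sA/mem_nth.
exact: (@coord_span _ _ _ (in_tuple s)).
Qed.

Lemma eigen_subspace (f : 'End(V)) c (U : {vspace V}) :
  (U <= lker (f - scalar_op V c))%VS <-> (forall v, v \in U -> f v = c *: v).
Proof.
split=> [/subvP UE v /UE|UE].
  by rewrite memv_ker add_lfunE opp_lfunE scalar_opE subr_eq0 => /eqP.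
by apply/subvP => v /UE fv; rewrite memv_ker add_lfunE opp_lfunE scalar_opE fv subrr.
Qed.

Lemma vspan_eigen (A : set V) (f : 'End(V)) c :
  (forall v, A v -> f v = c *: v) -> forall v, v \in vspan A -> f v = c *: v.
Proof.
move=> Af; apply/eigen_subspace/vspan_min => v /Af fv.
by rewrite memv_ker add_lfunE opp_lfunE scalar_opE fv subrr.
Qed.

End SpanLemmas.

Section Isotypic.
Variable R : realType.
Implicit Types T : finType.

Lemma isotypic_sub T (rho : rep R T) m (X : {vspace vec R T}) :
  (isotypic rho m X <= X)%VS.
Proof. by apply: vspan_min => w [f [_ /subvP fX /fX]]. Qed.

Lemma irr0 g : @irr R 0 g = \1%VF.
Proof.
apply: lfun_vecP => b; apply/ffunP => a; rewrite mx_hom_dvec id_lfunE dvecE.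
by rewrite !ord1 irrmxE /monom2 !expr0 mulr1 coef1.
Qed.

(** V_0 being trivial, an intertwining map from it amounts to an invariant vector. *)
Lemma isotypic0 T (rho : rep R T) (X : {vspace vec R T}) :
  isotypic rho 0 X = (invariants rho :&: X)%VS.
Proof.
apply/eqP; rewrite eqEsubv; apply/andP; split.
  rewrite subv_cap isotypic_sub andbT; apply: vspan_min => _ [f [fI _ /memv_imgP[u _ ->]]].
  by apply/invariantsP => g gS; rewrite -fI // irr0 id_lfunE.
apply/subvP => w /memv_capP[/invariantsP wI wX].
pose f : 'Hom(vec R 'I_1, vec R T) := mx_hom (fun a (_ : 'I_1) => w a).
have fE u : f u = u ord0 *: w.
  by apply/ffunP => a; rewrite mx_homE big_ord1 vecZ mulrC.
apply: vspan_sub; exists f; split=> [g v gS||].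
- by rewrite irr0 id_lfunE !fE lfunZ wI.
- by apply/subvP => _ /memv_imgP[u _ ->]; rewrite fE memvZ.
- by apply/memv_imgP; exists (dvec R ord0); rewrite ?memvf // fE dvecE eqxx scale1r.
Qed.

Lemma invariant_differential T (rho : rep R T) D x v :
  has_differential rho D -> su2_unit x -> v \in invariants rho -> D x v = 0.
Proof.
move=> rhoD xu /invariantsP vI; apply/ffunP => a; rewrite vec0.
rewrite -(cderive0E (rhoD x xu v a)); apply: cderive0E.
apply: (has_cderive0_ext (f := fun=> v a)) => [t|]; last exact: has_cderive0_cst.
by rewrite vI //; apply: rotation_SU2.
Qed.

End Isotypic.

(** * Partial actions on a bracketed tensor product *)

Section Trees.
Variables (R : realType) (n : nat) (l : 'I_n -> nat).
Implicit Types (t s x y : btree n) (I : {set 'I_n}) (c : btree n -> nat).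

(** The counterpart of tensor_rep on the bracketed tensor product, see
   [unbracket_site_rep]. *)
Fixpoint site_rep I t : rep R (tree_index l t) :=
  match t return rep R (tree_index l t) with
  | Leaf i => if i \in I then @irr R (l i) else fun=> \1%VF
  | Node x y => tens_rep (site_rep I x) (site_rep I y)
  end.

Fixpoint dsite I t : 'M[R[i]]_2 -> 'End(vec R (tree_index l t)) :=
  match t return 'M[R[i]]_2 -> 'End(vec R (tree_index l t)) with
  | Leaf i => if i \in I then dirr (l i) else fun=> 0
  | Node x y => fun a => dtens (dsite I x a) (dsite I y a)
  end.

Lemma site_rep_mult I t : multiplicative_rep (site_rep I t).
Proof.
elim: t => [i|x IHx y IHy] /=; last exact: tens_rep_mult.
by case: ifP => _; [exact: irr_mult|split=> // g h; rewrite comp_lfun1l].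
Qed.

Lemma site_rep_differential I t : has_differential (site_rep I t) (dsite I t).
Proof.
elim: t => [i|x IHx y IHy] /=.
  case: ifP => _; first exact: irr_differential.
  move=> a au v b; rewrite zero_lfunE vec0; apply: (has_cderive0_ext (f := fun=> v b)).
    by move=> t; rewrite id_lfunE.
  exact: has_cderive0_cst.
by apply: tens_rep_differential; [case: (site_rep_mult I x)| |case: (site_rep_mult I y)|].
Qed.

Lemma site_repT t : site_rep [set: 'I_n] t = @tree_rep R n l t.
Proof. by elim: t => [i|x IHx y IHy] /=; rewrite ?finset.in_setT // IHx IHy. Qed.

Lemma tree_rep_differential t : has_differential (@tree_rep R n l t) (dsite [set: 'I_n] t).
Proof. by rewrite -site_repT; apply: site_rep_differential. Qed.

Lemma dtens0 S T : dtens (0 : 'End(vec R S)) (0 : 'End(vec R T)) = 0.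
Proof.
apply: tens_homP => u v; rewrite dtensE !zero_lfunE tens_vec0l tens_vec0r addr0.
by [].
Qed.

Lemma dsite_disjoint I t a : {in leaves t, forall i, i \notin I} -> dsite I t a = 0.
Proof.
elim: t => [i|x IHx y IHy] /= tI; first by rewrite (negbTE (tI i _)) ?mem_head.
rewrite IHx ?IHy ?dtens0 // => i ix; apply: tI; rewrite mem_cat ix ?orbT //.
Qed.

Lemma dsite_full I t a : {in leaves t, forall i, i \in I} -> dsite I t a = dsite [set: 'I_n] t a.
Proof.
elim: t => [i|x IHx y IHy] /= tI; first by rewrite finset.in_setT tI ?mem_head.
by rewrite IHx ?IHy // => i ix; apply: tI; rewrite mem_cat ix ?orbT.
Qed.

Lemma dsite_compl I t a v : dsite I t a v + dsite (~: I) t a v = dsite [set: 'I_n] t a v.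
Proof.
suff /lfunP/(_ v) : dsite I t a + dsite (~: I) t a = dsite [set: 'I_n] t a by rewrite add_lfunE.
elim: t {v} => [i|x IHx y IHy] /=.
  by rewrite finset.in_setC finset.in_setT; case: (i \in I); rewrite ?addr0 ?add0r.
apply: tens_homP => u v; rewrite add_lfunE !dtensE -IHx -IHy !add_lfunE.
by rewrite tens_vecDl tens_vecDr [LHS](AC (2*2) ((1*3)*(2*4))).
Qed.

Lemma dsite_comm I t a b v :
  dsite I t a (dsite (~: I) t b v) = dsite (~: I) t b (dsite I t a v).
Proof.
suff /lfunP/(_ v) : (dsite I t a \o dsite (~: I) t b = dsite (~: I) t b \o dsite I t a)%VF.
  by rewrite !comp_lfunE.
elim: t {v} => [i|x IHx y IHy] /=.
  by rewrite finset.in_setC; case: (i \in I); rewrite /= ?comp_lfun0l ?comp_lfun0r.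
apply: tens_homP => u v; rewrite !comp_lfunE !dtensE !lfunD !dtensE.
have /lfunP/(_ u) := IHx; have /lfunP/(_ v) := IHy; rewrite !comp_lfunE => -> ->.
by rewrite [LHS](AC (2*2) ((1*3)*(2*4))).
Qed.

Lemma unbracketE t (v : vec R (tree_index l t)) f :
  unbracket R l t v f = v (tree_of_multi f t).
Proof.
pose K := mx_hom (fun (f : multi_index l) (b : tree_index l t) =>
  (tree_of_multi f t == b)%:R : R[i]).
suff -> : unbracket R l t = K.
  rewrite mx_homE -[RHS](sum_delta v); apply: eq_bigr => b _; exact: mulrC.
rewrite -[RHS]linfun_id /unbracket; congr linfun; apply/funext => w.
apply/ffunP => h; rewrite ffunE mx_homE -[LHS](sum_delta w).
by apply: eq_bigr => b _; exact: mulrC.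
Qed.

Lemma tree_of_multi_inj_in t (f g : multi_index l) :
  tree_of_multi f t = tree_of_multi g t -> {in leaves t, forall i, f i = g i}.
Proof.
elim: t => [i|x IHx y IHy] /=; first by move=> fg j; rewrite inE => /eqP ->.
by case=> /IHx fgx /IHy fgy i; rewrite mem_cat => /orP[/fgx|/fgy].
Qed.

Lemma card_tree_index t : #|tree_index l t| = (\prod_(i <- leaves t) (l i).+1)%N.
Proof.
elim: t => [i|x IHx y IHy] /=; first by rewrite card_ord big_seq1.
by rewrite card_prod IHx IHy big_cat.
Qed.

Lemma card_multi_index : #|multi_index l| = (\prod_(i < n) (l i).+1)%N.
Proof.
rewrite card_dep_ffun foldrE big_map big_enum /=.
by apply: eq_bigr => i _; rewrite card_ord.
Qed.

Section Labelled.
Variable t : btree n.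
Hypothesis tP : perm_eq (leaves t) (enum 'I_n).

Lemma mem_leaves i : i \in leaves t.
Proof. by rewrite (perm_mem tP) mem_enum. Qed.

Lemma uniq_leaves : uniq (leaves t).
Proof. by rewrite (perm_uniq tP) enum_uniq. Qed.

Lemma tree_of_multi_bij : bijective (fun f : multi_index l => tree_of_multi f t).
Proof.
apply: inj_card_bij => [f g /tree_of_multi_inj_in fg|].
  by apply/ffunP => i; apply: fg; apply: mem_leaves.
rewrite card_tree_index card_multi_index (perm_big _ tP) /= big_enum /=.
exact: leqnn.
Qed.

Lemma site_rep_coef I g (a b : multi_index l) s :
  site_rep I s g (dvec R (tree_of_multi b s)) (tree_of_multi a s) =
  \prod_(i <- leaves s) (if i \in I then irrmx g (a i) (b i) else (a i == b i)%:R).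
Proof.
elim: s => [i|x IHx y IHy] /=.
  rewrite big_seq1; case: ifP => _; first exact: mx_hom_dvec.
  by rewrite id_lfunE dvecE.
by rewrite big_cat /= -IHx -IHy -tens_dvec tens_repE tens_homE tens_vecE.
Qed.

Lemma unbracket_site_rep I g v :
  unbracket R l t (site_rep I t g v) = tensor_rep l I g (unbracket R l t v).
Proof.
apply/ffunP => a; rewrite unbracketE [LHS]lfun_vecE [RHS]kernel_opE.
rewrite (reindex _ (onW_bij _ tree_of_multi_bij)) /=; apply: eq_bigr => b _.
rewrite site_rep_coef unbracketE; congr (_ * _).
by rewrite (perm_big _ tP) /= big_enum.
Qed.

Lemma unbracket_inj : lker (unbracket R l t) = 0%VS.
Proof.
apply/eqP/lker0P => u v /ffunP uv; apply/ffunP => b.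
have [h hK _] := tree_of_multi_bij; have [h' _ h'K] := tree_of_multi_bij.
by rewrite -(h'K b); have := uv (h' b); rewrite !unbracketE.
Qed.

Lemma unbracket_surj w : exists v, w = unbracket R l t v.
Proof.
have [h hK h'K] := tree_of_multi_bij.
exists [ffun b => w (h b)]; apply/ffunP => f.
by rewrite unbracketE ffunE hK.
Qed.

(** The unbracketing map is an isomorphism of representations, so it transports the
   differentials, hence the Casimir operators. *)
Lemma Qop_unbracket xi I v : su2_orthonormal xi ->
  Qop xi l I (unbracket R l t v) = unbracket R l t (cas xi (dsite I t) v).
Proof.
move=> xio; pose phi := unbracket R l t.
have phiK : (phi^-1 \o phi)%VF = \1%VF by apply: lker0_compVf; rewrite unbracket_inj.
have phiVK u : (phi^-1)%VF (phi u) = u by rewrite -comp_lfunE phiK id_lfunE.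
pose D (x : 'M[R[i]]_2) : 'End(vec R (multi_index l)) :=
  (phi \o dsite I t x \o phi^-1)%VF.
have TD : has_differential (tensor_rep l I) D.
  move=> x xu w a; have [u ->] := unbracket_surj w.
  rewrite /D 2!comp_lfunE -/phi phiVK unbracketE.
  apply: (has_cderive0_ext (f := fun s : R =>
    site_rep I t (rotation x s) u (tree_of_multi a t))) => [s|].
    by rewrite /phi -unbracket_site_rep unbracketE.
  exact: site_rep_differential.
rewrite /Qop (casimirE xio TD) -/phi.
apply: cas_intertwine => i; apply/lfunP => u.
by rewrite /D !comp_lfunE phiVK.
Qed.

Lemma unbracket_invariants v :
  (unbracket R l t v \in Hinv R l) = (v \in invariants (@tree_rep R n l t)).
Proof.
apply/idP/idP => [/invariantsP vI|/invariantsP vI]; apply/invariantsP => g gS.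
  have /eqP/lker0P := unbracket_inj; apply.
  by rewrite -site_repT unbracket_site_rep vI.
by rewrite -unbracket_site_rep site_repT vI.
Qed.

(** The two partial differentials commute and add up to the full one, which is zero
   on invariant vectors. *)
Lemma Qop_compl xi I v : su2_orthonormal xi -> v \in Hinv R l ->
  Qop xi l (~: I) v = Qop xi l I v.
Proof.
move=> xio; have [u ->] := unbracket_surj v; rewrite unbracket_invariants => uI.
rewrite 2!(Qop_unbracket _ _ xio); congr (unbracket R l t _); rewrite 2!casE; congr (- _).
apply: eq_bigr => i _; have xu := orthonormal_unit i xio.
have compl : dsite (~: I) t (xi i) u = - dsite I t (xi i) u.
  apply/eqP; rewrite -addr_eq0 addrC dsite_compl; apply/eqP.
  exact: (invariant_differential (@tree_rep_differential t) xu uI).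
by rewrite compl linearN /= -dsite_comm compl linearN opprK.
Qed.

End Labelled.
End Trees.

(** * The lines of a parenthesising *)

Section PartialSpaces.
Variables (R : realType) (n : nat) (l : 'I_n -> nat) (xi : 'I_3 -> 'M[R[i]]_2).
Hypothesis xio : su2_orthonormal xi.
Implicit Types (t s x y : btree n) (I : {set 'I_n}) (c : btree n -> nat).

Lemma partial_space_ext c c' t : (forall s, subtree s t -> c s = c' s) ->
  partial_space R l c t = partial_space R l c' t.
Proof.
elim: t => [i|x IHx y IHy] //= cc'; congr (isotypic _ _ (tens_space _ _)).
- by apply: cc'; left.
- by apply: IHx => s sx; apply: cc'; right; left.
- by apply: IHy => s sy; apply: cc'; right; right.
Qed.

(** The color of a subtree is that of the edge from which it hangs; the whole tree
   is treated as hanging from an edge too. *)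
Fixpoint tree_coloring c t : Prop :=
  match t with
  | Leaf i => c (Leaf i) = l i
  | Node x y => [/\ tree_coloring c x, tree_coloring c y &
                    clebsch_gordan (c x) (c y) (c (Node x y))]
  end.

Lemma tree_coloring_ext c c' t : (forall s, subtree s t -> c s = c' s) ->
  tree_coloring c t -> tree_coloring c' t.
Proof.
elim: t => [i|x IHx y IHy] //= cc'; first by rewrite cc' //; left.
case=> cx cy cg; split; first by apply: IHx => // s sx; apply: cc'; right; left.
  by apply: IHy => // s sy; apply: cc'; right; right.
by rewrite -!cc' //; [left|right; right; apply: subtree_refl|right; left; apply: subtree_refl].
Qed.

Lemma cas_tens_l S T (A : 'M[R[i]]_2 -> 'End(vec R S)) (B : 'M[R[i]]_2 -> 'End(vec R T)) u w :
  (forall a, B a = 0) ->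
  cas xi (fun a => dtens (A a) (B a)) (tens_vec u w) = tens_vec (cas xi A u) w.
Proof.
move=> B0; rewrite [cas xi A u]casE tens_vecNl tens_vec_suml casE; congr (- _).
have E a v : dtens (A a) (B a) (tens_vec v w) = tens_vec (A a v) w.
  by rewrite dtensE B0 zero_lfunE tens_vec0r addr0.
by apply: eq_bigr => i _; rewrite 2!E.
Qed.

Lemma cas_tens_r S T (A : 'M[R[i]]_2 -> 'End(vec R S)) (B : 'M[R[i]]_2 -> 'End(vec R T)) u w :
  (forall a, A a = 0) ->
  cas xi (fun a => dtens (A a) (B a)) (tens_vec u w) = tens_vec u (cas xi B w).
Proof.
move=> A0; rewrite [cas xi B w]casE tens_vecNr tens_vec_sumr casE; congr (- _).
have E a v : dtens (A a) (B a) (tens_vec u v) = tens_vec u (B a v).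
  by rewrite dtensE A0 zero_lfunE tens_vec0l add0r.
by apply: eq_bigr => i _; rewrite 2!E.
Qed.

Lemma partial_space_irreducible c t : tree_coloring c t ->
  irreducible_image (@tree_rep R n l t) (c t) (partial_space R l c t).
Proof.
elim: t => [i|x IHx y IHy] /=.
  move=> ->; exists \1%VF; split=> [g v _||]; first by rewrite !id_lfunE.
    by apply/eqP/lker0P => u v; rewrite !id_lfunE.
  by apply/eqP; rewrite eqEsubv subvf; apply/subvP => v _; apply/memv_imgP; exists v;
    rewrite ?memvf ?id_lfunE.
case=> /IHx Ux /IHy Uy cg.
have TD : has_differential (tens_rep (tree_rep l x) (tree_rep l y))
    (@dsite R n l [set: 'I_n] (Node x y)) := @tree_rep_differential R n l (Node x y).
exact: (cg_irreducible xio TD Ux Uy cg).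
Qed.

(** This operator acts on the tensor factor indexed by s alone, where the selected
   summand is a copy of V_(c s). *)
Lemma partial_space_cas c t s v : uniq (leaves t) -> subtree s t ->
  tree_coloring c t -> v \in partial_space R l c t ->
  cas xi (dsite l [set i in leaves s] t) v = (c s * (c s + 2))%:R *: v.
Proof.
elim: t v => [i|x IHx y IHy] v.
  by move=> _ [->|[]] /= -> _; rewrite finset.inE mem_head; apply: irr_cas.
move=> ut st [cx cy cg] vt.
have : uniq (leaves x ++ leaves y) := ut; rewrite cat_uniq => /and3P[ux /hasPn xy uy].
have dis z i : i \in leaves x -> i \in leaves y -> z.
  by move=> ix /xy; rewrite ix.
case: st => [->|st].
  have -> : @dsite R n l [set i in leaves (Node x y)] (Node x y) =
      @dsite R n l [set: 'I_n] (Node x y).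
    by apply/funext => a; apply: dsite_full => i it; rewrite finset.inE.
  move: v vt; apply: vspan_eigen => w [f [fI _ /memv_imgP[u _ ->]]].
  exact: (intertwiner_cas u xio (@tree_rep_differential R n l (Node x y)) fI).
have {vt} : v \in tens_space (partial_space R l c x) (partial_space R l c y).
  exact: (subvP (isotypic_sub _ _ _) _ vt).
move: v; apply: vspan_eigen => _ [u [w [ux' wy ->]]].
case: st => [sx|sy].
  rewrite -tens_vecZl -(IHx u ux sx cx ux'); apply: cas_tens_l => a.
  apply: dsite_disjoint => i iy; rewrite finset.inE; apply/negP => /(subtree_leaves sx) ix.
  exact: dis ix iy.
rewrite -tens_vecZr -(IHy w uy sy cy wy); apply: cas_tens_r => a.
apply: dsite_disjoint => i ix; rewrite finset.inE; apply/negP => /(subtree_leaves sy) iy.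
exact: dis ix iy.
Qed.

(** As the leaves are distinct, the leaves of a subtree tell whether it comes from x
   or from y. *)
Lemma merge_colorings c1 c2 m x y : uniq (leaves (Node x y)) ->
  exists c, [/\ forall s, subtree s x -> c s = c1 s,
    forall s, subtree s y -> c s = c2 s & c (Node x y) = m].
Proof.
rewrite [leaves _]/= cat_uniq => /and3P[_ /hasPn xy _].
have [i ix] := leaves_neq0 x; have [j jy] := leaves_neq0 y.
exists (fun s => if all (mem (leaves x)) (leaves s) then c1 s
  else if all (mem (leaves y)) (leaves s) then c2 s else m).
split=> [s /subtree_leaves sx|s /subtree_leaves sy|].
- by have -> : all (mem (leaves x)) (leaves s) by apply/allP.
- have -> : all (mem (leaves y)) (leaves s) by apply/allP.
  case: ifP => // /allP sx; have [k ks] := leaves_neq0 s.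
  by have := xy k (sy k ks); have -> : k \in leaves x := sx k ks.
rewrite /= !all_cat.
have /negbTE -> : ~~ all (mem (leaves x)) (leaves y).
  by apply/negP => /allP /(_ j jy); apply/negP/xy.
have /negbTE -> : ~~ all (mem (leaves y)) (leaves x).
  by apply/negP => /allP /(_ i ix) /xy /negP; apply.
by rewrite andbF.
Qed.

(** By induction along the tree: the tensor product of two summands decomposes by
   [cg_sum], and the colorings of the two branches are merged. *)
Lemma partial_space_span t v : uniq (leaves t) ->
  v \in vspan [set w | exists c, tree_coloring c t /\ w \in partial_space R l c t]%classic.
Proof.
elim: t v => [i|x IHx y IHy] v ut.
  by apply: vspan_sub; exists (fun=> l i); rewrite /= memvf.
have := ut; rewrite [leaves _]/= cat_uniq => /and3P[ux _ uy].
rewrite (vec_sum v); apply: memv_suml => -[a b] _; apply: memvZ; rewrite -tens_dvec.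
have AZ z (k : R[i]) (w : vec R (tree_index l z)) :
    (exists c, tree_coloring c z /\ w \in partial_space R l c z) ->
    exists c, tree_coloring c z /\ k *: w \in partial_space R l c z.
  by case=> c [cz wz]; exists c; split; last apply: memvZ.
have [k1 [u [uA ->]]] := vspan_sum (AZ x) (IHx (dvec R a) ux).
have [k2 [w [wA ->]]] := vspan_sum (AZ y) (IHy (dvec R b) uy).
rewrite tens_vec_suml; apply: memv_suml => i _.
rewrite tens_vec_sumr; apply: memv_suml => j _.
have [c1 [c1x u1]] := uA i; have [c2 [c2y w2]] := wA j.
have TD : has_differential (tens_rep (tree_rep l x) (tree_rep l y))
    (@dsite R n l [set: 'I_n] (Node x y)) := @tree_rep_differential R n l (Node x y).
have : tens_vec (u i) (w j) \in tens_space (partial_space R l c1 x) (partial_space R l c2 y).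
  by apply: vspan_sub; exists (u i), (w j).
rewrite (cg_sum xio TD (partial_space_irreducible c1x) (partial_space_irreducible c2y)).
apply/subvP/subv_sumP => r _; apply/subvP => z zr.
have [c [cx cy cm]] := merge_colorings c1 c2 (c1 x + c2 y - r.*2) ut.
apply: vspan_sub; exists c; split.
  split; first by apply: tree_coloring_ext c1x => s /cx.
    by apply: tree_coloring_ext c2y => s /cy.
  rewrite cm cx ?cy; first exact: (cg_weight (leq_ord r)).
    exact: subtree_refl.
  exact: subtree_refl.
by rewrite /= cm (partial_space_ext cx) (partial_space_ext cy).
Qed.

(** The two edges at the root are merged into one edge of the graph, so they have
   the same color. *)
Definition root_coloring c t : Prop :=
  if t is Node x y then [/\ tree_coloring c x, tree_coloring c y & c x = c y] else False.

Lemma clebsch_gordan0 p q : clebsch_gordan p q 0 = (p == q).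
Proof. by rewrite /clebsch_gordan; apply/and4P/eqP => [[]|->]; [lia|split; lia]. Qed.

Lemma Dline_ext c c' t : (forall s, proper_subtree s t -> c s = c' s) ->
  Dline R l t c = Dline R l t c'.
Proof.
case: t => [i|x y] //= cc'; congr (_ @: (_ :&: tens_space _ _))%VS.
  by apply: partial_space_ext => s sx; apply: cc'; left.
by apply: partial_space_ext => s sy; apply: cc'; right.
Qed.

(** The invariant vectors form the isotypic part of type V_0. *)
Lemma Dline_partial c t : c t = 0%N -> is_node t ->
  Dline R l t c = (unbracket R l t @: partial_space R l c t)%VS.
Proof. by case: t => [i|x y] //= -> _; rewrite isotypic0. Qed.

Lemma root_coloringE c t : is_node t -> c t = 0%N -> tree_coloring c t <-> root_coloring c t.
Proof.
case: t => [i|x y] //= _ ->; rewrite clebsch_gordan0.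
by split=> -[cx cy /eqP cxy].
Qed.

Lemma root_coloring_ext c c' t : (forall s, proper_subtree s t -> c s = c' s) ->
  root_coloring c t -> root_coloring c' t.
Proof.
case: t => [i|x y] //= cc' [cx cy cxy]; split.
- by apply: tree_coloring_ext cx => s sx; apply: cc'; left.
- by apply: tree_coloring_ext cy => s sy; apply: cc'; right.
- by rewrite -!cc' //; [right|left]; apply: subtree_refl.
Qed.

Section Lines.
Variable t : btree n.
Hypothesis tP : perm_eq (leaves t) (enum 'I_n).
Hypothesis tN : is_node t.

(** The line D_c does not involve the color of the whole tree; giving it the value 0
   makes the line a partial space. *)
Lemma recolor_root c : exists2 c', (forall s, proper_subtree s t -> c s = c' s) & c' t = 0%N.
Proof.
have := uniq_leaves tP; case: t tN => [i|x y] // _ ut.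
have [c' [cx cy c0]] := merge_colorings c c 0 ut.
by exists c' => // s [sx|sy]; [rewrite cx|rewrite cy].
Qed.

Lemma Dline_sub c : (Dline R l t c <= Hinv R l)%VS.
Proof.
have := unbracket_invariants tP; case: t tN => [i|x y] // _ uI.
apply/subvP => _ /memv_imgP[u /memv_capP[ui _] ->].
by rewrite uI.
Qed.

Lemma dim_Dline c : root_coloring c t -> \dim (Dline R l t c) = 1%N.
Proof.
move=> ct; have [c' cc' c0] := recolor_root c.
rewrite (Dline_ext cc') Dline_partial // limg_dim_eq; last by rewrite (unbracket_inj R l tP) capv0.
have /root_coloringE := root_coloring_ext cc' ct; move=> /(_ tN c0) c't.
have [f [_ fk <-]] := partial_space_irreducible c't.
by rewrite limg_inj_dim // c0.
Qed.

Lemma Dline_Qop c s v : root_coloring c t -> v \in Dline R l t c -> proper_subtree s t ->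
  Qop xi l [set i in leaves s] v = (c s * (c s + 2))%:R *: v.
Proof.
move=> ct; have [c' cc' c0] := recolor_root c.
rewrite (Dline_ext cc') Dline_partial // => /memv_imgP[u ut ->] st.
rewrite (Qop_unbracket tP _ _ xio) cc' //.
rewrite (partial_space_cas (uniq_leaves tP) _ _ ut) ?lfunZ //.
  by case: (t) st => [i|x y] //= ?; right.
by apply/root_coloringE => //; apply: root_coloring_ext ct.
Qed.

(** An invariant vector is killed by the total Casimir operator, so that only its
   components with color 0 at the root survive. *)
Lemma Dline_span v : v \in Hinv R l -> exists k (w : 'I_k -> vec R (multi_index l))
  (c : 'I_k -> btree n -> nat),
  [/\ forall i, root_coloring (c i) t, forall i, w i \in Dline R l t (c i) & v = \sum_i w i].
Proof.
have [u ->] := unbracket_surj tP v; rewrite (unbracket_invariants tP) => uI.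
have AZ (k : R[i]) (w : vec R (tree_index l t)) :
    (exists c, tree_coloring c t /\ w \in partial_space R l c t) ->
    exists c, tree_coloring c t /\ k *: w \in partial_space R l c t.
  by case=> c [cz wz]; exists c; split; last apply: memvZ.
have [k [w [wA uE]]] := vspan_sum AZ (partial_space_span u (uniq_leaves tP)).
have /choice[c cA] := wA.
pose C := cas xi (@dsite R n l [set i in leaves t] t).
have Cw i : C (w i) = (c i t * (c i t + 2))%:R *: w i.
  have [ct wt] := cA i.
  by apply: partial_space_cas => //; [apply: uniq_leaves|apply: subtree_refl].
have Cu : C u = 0.
  have -> : C = cas xi (@dsite R n l [set: 'I_n] t).
    congr (cas xi _); apply/funext => a; apply: dsite_full => i it.
    by rewrite finset.inE.
  rewrite casE big1 ?oppr0 // => i _.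
  have xu := orthonormal_unit i xio.
  by rewrite (invariant_differential (@tree_rep_differential R n l t) xu uI) lfun0.
have := @joint_eigen_sum _ _ unit _ (fun=> C) (fun i _ => (c i t * (c i t + 2))%:R)
  (fun=> 0) (index_enum _) w (fun i _ => Cw i).
rewrite -uE => /(_ (fun=> _)) sumE.
have {}sumE : u = \sum_(i | c i t == 0%N) w i.
  rewrite [LHS]sumE; last by rewrite Cu scale0r.
  apply: eq_bigl => i; apply/asboolP/eqP => [/(congr1 (fun f => f tt))/eqP|->].
    by rewrite pnatr_eq0 muln_eq0 addn_eq0 andbF orbF => /eqP.
  by rewrite mul0n.
pose B : set (vec R (multi_index l)) :=
  [set w | exists c, root_coloring c t /\ w \in Dline R l t c]%classic.
have BZ (a : R[i]) z : B z -> B (a *: z).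
  by case=> d [dt zd]; exists d; split; last apply: memvZ.
have vB : unbracket R l t u \in vspan B.
  rewrite sumE lfun_sum; apply: memv_suml => i /eqP c0; apply: vspan_sub.
  have [ct wt] := cA i; exists (c i); split; first exact/root_coloringE.
  by rewrite Dline_partial // memv_img.
have [k' [w' [w'B ->]]] := vspan_sum BZ vB.
have /choice[d dB] := w'B; exists k', w', d.
by split=> // i; have [] := dB i.
Qed.
End Lines.

End PartialSpaces.

(** * Colorings of the graph and of its trees *)

Section Colorings.
Variables (n : nat) (G : graph n) (l : 'I_n -> nat).
Implicit Types (d e : dart G) (f g : flag G) (s t x y z : btree n).
Hypothesis connectedG : connected_graph G.
Hypothesis trivalentG : trivalent G.

(** Without internal edges, connectedness leaves a single vertex, which carries only
   three half-edges. *)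
Lemma internal_edge_exists : (4 <= n)%N -> exists a : iedge G, True.
Proof.
move=> n4; apply: contrapT => noedge.
have [[v _] conn] := connectedG.
have all_v u : u = v.
  have cu := conn v u.
  apply: (connect_ind (P := fun w => w = v) cu) => // w w' /adjP[d _ _].
  by case: noedge; exists d.1.
have : #|[set f : flag G | fvert f == v]| = 3%N := trivalentG v.
have -> : [set f : flag G | fvert f == v] = [set: flag G].
  by apply/setP => f; rewrite !finset.inE; apply/eqP; apply: all_v.
by rewrite cardsT card_sum card_ord; lia.
Qed.

Lemma clebsch_gordan_star (phi : edge G -> nat) e f1 f2 : admissible_coloring phi ->
  star (dsrc e) (inl e) f1 f2 ->
  clebsch_gordan (phi (fedge f1)) (phi (fedge f2)) (phi (inl e.1)).
Proof.
move=> adm st; have [u3 _] := st.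
have f1v : fvert f1 = dsrc e by apply: (star_fvert st); rewrite !inE eqxx orbT.
have f2v : fvert f2 = dsrc e by apply: (star_fvert st); rewrite !inE eqxx !orbT.
apply: (adm f1 f2 (inl e)); rewrite ?f1v ?f2v //.
move: u3; rewrite /= !inE !negb_or !andbT => /andP[/andP[e1 e2] ->] /=.
by rewrite ![_ == inl e]eq_sym e1 e2.
Qed.

Lemma below_coloring (phi : edge G -> nat) c f x : admissible_coloring phi ->
  (forall i, phi (inr i) = l i) ->
  (forall g s, subtree s x -> below g s -> c s = phi (fedge g)) ->
  below f x -> tree_coloring l c x.
Proof.
move=> adm phil; elim: x f => [i|y IHy z IHz] f cphi /=.
  by move=> fi; rewrite -phil (cphi f) ?fi //; left.
move=> fx; have [d [f1 [f2 [fd st fy fz]]]] := fx; split.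
- by apply: IHy fy => g s sy; apply: cphi; right; left.
- by apply: IHz fz => g s sz; apply: cphi; right; right.
rewrite (cphi f1 y) //; last by right; left; apply: subtree_refl.
rewrite (cphi f2 z) //; last by right; right; apply: subtree_refl.
rewrite (cphi f (Node y z)) //; last by left.
rewrite -dsrc_drev in st; have := clebsch_gordan_star adm st.
by rewrite fd.
Qed.

(** A flag is determined by the tree that hangs from it, see [below_inj]. *)
Lemma coloring_of_edges (phi : edge G -> nat) :
  exists c : btree n -> nat, forall g s, below g s -> c s = phi (fedge g).
Proof.
exists (fun s => if pselect (exists g, below g s) is left h then phi (fedge (projT1 (cid h))) else 0%N).
move=> g s gs; case: pselect => [h|[]]; last by exists g.
by case: cid => g' /= g's; rewrite (below_inj gs g's).
Qed.

(** * Graphs associated with a parenthesising *)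

Section Associated.
Variables (t : btree n) (nv : btree n -> vert G) (ne : btree n -> edge G).
Hypothesis tP : perm_eq (leaves t) (enum 'I_n).
Hypothesis assoc : associated t nv ne.

Let size_subtree s x : subtree s x -> (size (leaves s) <= size (leaves x))%N.
Proof.
elim: x => [i|y IHy z IHz] /=; first by case=> [->|[]].
by rewrite size_cat; case=> [->|[/IHy|/IHz]]; rewrite ?size_cat //; lia.
Qed.

Let size_leaves_gt0 s : (0 < size (leaves s))%N.
Proof. by case: (leaves_neq0 s) => i; case: (leaves s). Qed.

Let size_proper s x : proper_subtree s x -> (size (leaves s) < size (leaves x))%N.
Proof.
case: x => [i|y z] //= [/size_subtree|/size_subtree]; rewrite size_cat.
  by have := size_leaves_gt0 z; lia.
by have := size_leaves_gt0 y; lia.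
Qed.

Let proper_sub s x : proper_subtree s x -> subtree s x.
Proof. by case: x => [i|y z] //= h; right. Qed.

Let uniq_sub s : subtree s t -> uniq (leaves s).
Proof.
have := uniq_leaves tP; elim: t => [i|y IHy z IHz] /=; first by move=> _ [->|[]].
rewrite cat_uniq => /and3P[uy yz uz] [->|[sy|sz]]; last exact: IHz.
  by rewrite /= cat_uniq uy yz uz.
exact: IHy.
Qed.

(* The leaves being distinct, a subtree has only one parent. *)
Let grandchild y s r : child y s -> proper_subtree s t -> t <> Node y r /\ t <> Node r y.
Proof.
move=> ys st.
have ysub : proper_subtree y s by case: s ys {st} => [i|y1 z1] //= [->|->];
  [left|right]; apply: subtree_refl.
have yss := size_proper ysub.
have [j jy] := leaves_neq0 y.
have js := subtree_leaves (proper_sub ysub) jy.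
split=> tE; have := uniq_leaves tP; move: st; rewrite tE /= cat_uniq => st /and3P[_ /hasPn dis _].
  case: st => [/size_subtree|sr]; first by lia.
  by have := dis j (subtree_leaves sr js); rewrite /= jy.
case: st => [sr|/size_subtree]; last by lia.
by have := dis j jy; rewrite /= (subtree_leaves sr js).
Qed.

Let child_proper y s : child y s -> proper_subtree s t -> proper_subtree y t.
Proof.
by case: s => [i|y1 z1] //= ys st; apply: proper_subtree_child st ys.
Qed.

Let ne_child y s : child y s -> proper_subtree s t -> ne s <> ne y.
Proof.
move=> ys st; have yt := child_proper ys st.
move=> /(ne_eq assoc st yt)[sy|tE|tE].
- have : (size (leaves y) < size (leaves s))%N.
    by apply: size_proper; case: s ys {st sy} => [i|y1 z1] //= [->|->];
      [left|right]; apply: subtree_refl.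
  by rewrite sy ltnn.
- by have [_] := grandchild s ys st.
- by have [] := grandchild s ys st.
Qed.

Let ne_children y z : proper_subtree (Node y z) t -> ne y <> ne z.
Proof.
move=> st; have yt := child_proper (or_introl erefl : child y (Node y z)) st.
have zt := child_proper (or_intror erefl : child z (Node y z)) st.
have uyz := uniq_sub (proper_sub st).
move=> /(ne_eq assoc yt zt)[yz|tE|tE].
- move: uyz; rewrite yz /= cat_uniq => /and3P[_ /hasPn dis _].
  by have [j jz] := leaves_neq0 z; have := dis j jz; rewrite /= jz.
- by have := size_proper st; rewrite tE ltnn.
- by have := size_proper st; rewrite tE /= !size_cat addnC ltnn.
Qed.

Let incident_flag (e : edge G) v : incident e v -> exists2 f : flag G, fedge f = e & fvert f = v.
Proof.
case: e => [a [b bv]|i iv]; first by exists (inl (a, b)).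
by exists (inr i).
Qed.

(** The edges of a node and of its two children all end at the vertex of the node;
   they are distinct, so by trivalence no other edge ends there. *)
Lemma associated_star y z : proper_subtree (Node y z) t ->
  exists g0 g1 g2, [/\ star (nv (Node y z)) g0 g1 g2, fedge g0 = ne (Node y z),
    fedge g1 = ne y & fedge g2 = ne z].
Proof.
move=> st; set s := Node y z.
have ys : child y s by left.
have zs : child z s by right.
have yt := child_proper ys st; have zt := child_proper zs st.
have inc r : proper_subtree r t -> r = s \/ child r s -> incident (ne r) (nv s).
  by move=> rt rs; apply/(ne_incident assoc rt st isT); exists r.
have [g0 g0e g0v] := incident_flag (inc s st (or_introl erefl)).
have [g1 g1e g1v] := incident_flag (inc y yt (or_intror ys)).
have [g2 g2e g2v] := incident_flag (inc z zt (or_intror zs)).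
exists g0, g1, g2; split=> //; apply: star_three => //.
rewrite /= !inE negb_or andbT; apply/andP; split; first (apply/andP; split).
- by apply/eqP => g01; apply: (ne_child ys st); rewrite -g0e -g1e g01.
- by apply/eqP => g02; apply: (ne_child zs st); rewrite -g0e -g2e g02.
- by apply/eqP => g12; apply: (ne_children st); rewrite -g1e -g2e g12.
Qed.

Lemma associated_root_coloring (phi : edge G -> nat) : admissible_coloring phi ->
  (forall i, phi (inr i) = l i) -> is_node t -> root_coloring l (fun s => phi (ne s)) t.
Proof.
move=> adm phil.
have col s : proper_subtree s t -> tree_coloring l (fun s => phi (ne s)) s.
  elim: s => [i|y IHy z IHz] st /=; first by rewrite (ne_leaf assoc st).
  split; first by apply: IHy; apply: child_proper st; left.
    by apply: IHz; apply: child_proper st; right.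
  have [g0 [g1 [g2 [[u3 mem3] <- <- <-]]]] := associated_star st.
  have gv g : g \in [:: g0; g1; g2] -> fvert g = nv (Node y z) by rewrite -mem3 => /eqP.
  apply: adm; rewrite ?gv ?inE ?eqxx ?orbT //.
  move: u3; rewrite /= !inE !negb_or !andbT => /andP[/andP[e1 e2] ->] /=.
  by rewrite ![_ == g0]eq_sym e1 e2.
have xy x y : t = Node x y -> ne x = ne y.
  move=> tE; apply/(ne_eq assoc); rewrite tE /=; [left|right|apply: Or32 => //];
    exact: subtree_refl.
case: (t) col xy => [i|x y] //= col xy _; split.
- by apply: col; left; apply: subtree_refl.
- by apply: col; right; apply: subtree_refl.
- by rewrite (xy x y).
Qed.

(** By induction from the leaves upwards. Each internal edge has two flags; the
   clause on the target of d serves to recognise, among the flags at the vertex of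
   the parent, the one from which s hangs. *)
Lemma associated_below s : proper_subtree s t ->
  (exists a, ne s = inl a) \/ ~~ is_node s ->
  exists f, [/\ fedge f = ne s, below f s & is_node s -> forall d, f = inl d -> dtgt d = nv s].
Proof.
elim: s => [i|y IHy z IHz] st.
  by move=> _; exists (inr i); split=> //; rewrite (ne_leaf assoc st).
case=> // -[a sa]; have [g0 [g1 [g2 [star3 g0e g1e g2e]]]] := associated_star st.
have sv := star3; have [d0 g0d] : exists d0, g0 = inl d0.
  by case: g0 g0e {star3 sv} => [d0|i]; [exists d0|rewrite sa].
have child_flag r g : child r (Node y z) -> g \in [:: g0; g1; g2] -> fedge g = ne r ->
    ((exists a, ne r = inl a) \/ ~~ is_node r -> exists f, [/\ fedge f = ne r, below f r &
       is_node r -> forall d, f = inl d -> dtgt d = nv r]) -> below g r.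
  move=> rs gin gr IH; have rt := child_proper rs st.
  have gv : fvert g = nv (Node y z) := star_fvert star3 gin.
  case: (boolP (is_node r)) => rn; last first.
    have [|f [fr fb _]] := IH; first by right.
    case: r rn fb fr gr {IH rs rt} => [i|] // _ /= -> /= <-.
    by case: g {gin gv} => [?|?] //= [->].
  have [a' ra] : exists a', ne r = inl a'.
    case rE : (ne r) => [a'|i]; first by exists a'.
    have it : proper_subtree (Leaf i) t.
      have := mem_leaves tP i; case: (t) rt => [j|x1 x2] //= _; rewrite mem_cat.
      have leaf_sub x : i \in leaves x -> subtree (Leaf i) x.
        elim: x => [j|x3 IH3 x4 IH4] /=; first by rewrite inE => /eqP ->; left.
        by rewrite mem_cat => /orP[/IH3|/IH4]; right; [left|right].
      by case/orP => /leaf_sub; [left|right].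
    have : ne r = ne (Leaf i) by rewrite rE (ne_leaf assoc it).
    move=> /(ne_eq assoc rt it)[rL|tE|tE]; first by rewrite rL in rn.
      by have [] := grandchild (Leaf i) rs st.
    by have [_] := grandchild (Leaf i) rs st.
  have [|f [fr fb fv]] := IH; first by left; exists a'.
  suff -> : g = f by [].
  case: f fr fb fv => [d|i]; last by rewrite ra.
  case: g gr gv {gin} => [d'|i]; last by rewrite ra.
  rewrite /= => d'r d's dr _ /(_ rn d erefl) dv.
  have : d'.1 = d.1 by move: d'r; rewrite -dr => -[].
  case/same_edge => [-> //|dE].
  have : nv r = nv (Node y z) by rewrite -dv -d's dE dsrc_drev.
  move=> /(nv_inj assoc rt rn st isT) rE.
  have : proper_subtree r (Node y z).
    by case: rs => ->; [left|right]; apply: subtree_refl.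
  by move/size_proper; rewrite rE ltnn.
have yb : below g1 y.
  by apply: child_flag => //; [left|rewrite !inE eqxx orbT|apply: IHy; apply: child_proper st; left].
have zb : below g2 z.
  by apply: child_flag => //; [right|rewrite !inE eqxx !orbT|apply: IHz; apply: child_proper st; right].
have d0v : dsrc d0 = nv (Node y z).
  by have := star_fvert star3 (mem_head _ _); rewrite g0d.
exists (inl (drev d0)); split=> [||_ d [<-]]; last by rewrite dtgt_drev.
  by rewrite -g0e g0d.
exists (drev d0), g1, g2; split=> //.
by rewrite dtgt_drev drevK d0v -g0d.
Qed.

End Associated.
End Colorings.

(** * The joint spectrum *)

Lemma tree_coloring_sub n (l : 'I_n -> nat) c (s t : btree n) :
  tree_coloring l c t -> subtree s t -> tree_coloring l c s.
Proof.
elim: t => [i|x IHx y IHy] /=; first by move=> ci [->|[]].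
by case=> cx cy cg [->|[/(IHx cx)|/(IHy cy)]].
Qed.

Lemma clebsch_gordan_perm p q m : clebsch_gordan p q m ->
  clebsch_gordan q p m /\ clebsch_gordan p m q.
Proof. by move=> /and4P[? ? ? ?]; split; apply/and4P; split; lia. Qed.

Lemma comp_lfun_commute (K : fieldType) (V : vectType K) (f g : 'End(V)) :
  (forall v, f (g v) = g (f v)) -> (f \o g = g \o f)%VF.
Proof. by move=> fg; apply/lfunP => v; rewrite !comp_lfunE. Qed.

Lemma lfun_commute_sum (K : fieldType) (V : vectType K) (f g : 'End(V)) k (u : 'I_k -> V) :
  (forall i, f (g (u i)) = g (f (u i))) -> f (g (\sum_i u i)) = g (f (\sum_i u i)).
Proof. by move=> fg; rewrite !linear_sum; apply: eq_bigr => i _; exact: fg. Qed.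

Lemma lfun_commute_eigen (K : fieldType) (V : vectType K) (f g : 'End(V)) a b v :
  f v = a *: v -> g v = b *: v -> f (g v) = g (f v).
Proof. by move=> fv gv; rewrite gv fv !linearZ /= fv gv !scalerA mulrC. Qed.

Section Restriction.
Variables (R : realType) (xi : 'I_3 -> 'M[R[i]]_2) (n : nat) (G : graph n).
Variables (l : 'I_n -> nat) (dir : iedge G -> bool).
Implicit Types (mu : iedge G -> R[i]) (w : vec R (multi_index l)).

Definition joint_eigenvector mu w :=
  forall a, Qop xi l (Iset (a, dir a)) w = mu a *: w.

Hypothesis pres : forall a : iedge G,
  (Qop xi l (Iset (a, dir a)) @: Hinv R l <= Hinv R l)%VS.

Lemma HopE a v : vsval (Hop xi l (a, dir a) v) = Qop xi l (Iset (a, dir a)) (vsval v).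
Proof.
pose f : 'Hom(subvs_of (Hinv R l), subvs_of (Hinv R l)) :=
  (linfun (vsproj (Hinv R l)) \o Qop xi l (Iset (a, dir a)) \o linfun vsval)%VF.
have fE u : f u = vsproj (Hinv R l) (Qop xi l (Iset (a, dir a)) (vsval u)).
  rewrite /f comp_lfunE comp_lfunE.
  rewrite (lfunE (vsproj (Hinv R l))).
  rewrite (lfunE (@vsval _ _ (Hinv R l))).
  by [].
have -> : Hop xi l (a, dir a) = f.
  rewrite -[RHS]fun_of_lfunK /Hop /Qres; congr linfun; apply/funext => u.
  by rewrite fE.
rewrite fE vsprojK //.
by apply: (subvP (pres a)); rewrite memv_img // subvsP.
Qed.

Lemma mem_joint_eigenspace mu v : reflect (joint_eigenvector mu (vsval v))
  (v \in joint_eigenspace xi l dir mu).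
Proof.
have E a : (v \in passmx.leigenspace (Hop xi l (a, dir a)) (mu a)) =
    (Qop xi l (Iset (a, dir a)) (vsval v) == mu a *: vsval v).
  rewrite /passmx.leigenspace memv_ker add_lfunE opp_lfunE scale_lfunE id_lfunE subr_eq0.
  by rewrite -HopE -(inj_eq subvs_inj).
apply: (iffP idP) => [vJ a|vJ].
  by apply/eqP; rewrite -E; apply: (subvP _ _ vJ); apply: bigcapv_inf.
by rewrite memvE; apply/subv_bigcapP => a _; rewrite -memvE E; apply/eqP/vJ.
Qed.

Definition joint_space mu : {vspace vec R (multi_index l)} :=
  (linfun (@vsval _ _ (Hinv R l)) @: joint_eigenspace xi l dir mu)%VS.

Lemma vsval_linfun_inj : lker (linfun (@vsval _ _ (Hinv R l))) = 0%VS.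
Proof. by apply/eqP/lker0P => u v; rewrite 2!lfunE => /subvs_inj. Qed.

Lemma dim_joint_space mu : \dim (joint_space mu) = \dim (joint_eigenspace xi l dir mu).
Proof. by rewrite limg_dim_eq // vsval_linfun_inj capv0. Qed.

Lemma mem_joint_space mu w : reflect (w \in Hinv R l /\ joint_eigenvector mu w)
  (w \in joint_space mu).
Proof.
apply: (iffP memv_imgP) => [[v /mem_joint_eigenspace vJ ->]|[wH wmu]].
  by rewrite lfunE subvsP.
exists (vsproj (Hinv R l) w); last by rewrite lfunE /= vsprojK.
by apply/mem_joint_eigenspace; rewrite vsprojK.
Qed.

End Restriction.

Section JointSpectrum.
Variables (R : realType) (xi : 'I_3 -> 'M[R[i]]_2) (n : nat) (G : graph n).
Variables (l : 'I_n -> nat) (dir : iedge G -> bool).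
Hypothesis xio : su2_orthonormal xi.
Hypothesis connectedG : connected_graph G.
Hypothesis acyclicG : acyclic_graph G.
Hypothesis trivalentG : trivalent G.
Implicit Types (t s : btree n) (c : btree n -> nat) (mu : iedge G -> R[i]).
Implicit Types (d : dart G) (a : iedge G) (v w : vec R (multi_index l)).

Let Q a := Qop xi l (Iset (a, dir a)).

(** The leaves of s are the half-edges beyond d, whereas dir may direct the edge
   either way: [Qop_compl] reconciles the two directions. *)
Lemma Dline_edge t c d s w : perm_eq (leaves t) (enum 'I_n) -> is_node t ->
  root_coloring l c t -> w \in Dline R l t c -> proper_subtree s t -> below (inl d) s ->
  Q d.1 w = (c s * (c s + 2))%:R *: w.
Proof.
move=> tP tN ct wt st db; rewrite -(Dline_Qop xio tP tN ct wt st).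
have sE : [set i in leaves s] = Iset (drev d).
  by apply/setP => i; rewrite finset.inE (below_leaves acyclicG db).1.
have wH : w \in Hinv R l := subvP (Dline_sub R l tP tN c) _ wt.
rewrite sE /Q; have [E|E] := @same_edge _ _ (d.1, dir d.1) d erefl; rewrite E; last by [].
have -> : Iset d = ~: Iset (drev d) by rewrite -(Iset_compl acyclicG connectedG) drevK.
exact: (Qop_compl tP _ xio wH).
Qed.

Definition edges_below t := forall a, exists s d,
  [/\ proper_subtree s t, below (inl d) s & d.1 = a].

Lemma Dline_eigenvector t c mu w : perm_eq (leaves t) (enum 'I_n) -> is_node t ->
  root_coloring l c t ->
  (forall a, exists s d, [/\ proper_subtree s t, below (inl d) s, d.1 = a &
     mu a = (c s * (c s + 2))%:R]) ->
  w \in Dline R l t c -> joint_eigenvector xi dir mu w.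
Proof.
move=> tP tN ct cmu wt a; have [s [d [st ds <- ->]]] := cmu a.
exact: Dline_edge tP tN ct wt st ds.
Qed.

Section Rooted.
Variables (d0 : dart G) (x0 y0 : btree n).
Hypothesis r0 : rooted_at d0 x0 y0.
Let t := Node x0 y0.
Let tP : perm_eq (leaves t) (enum 'I_n) := rooted_leaves acyclicG connectedG r0.

Lemma rooted_edges_below : edges_below t.
Proof.
move=> a; have [f [s [st fs fa]]] := rooted_flag acyclicG connectedG (inl (a, true)) r0.
by case: f fs fa => [d|i] fs //= [da]; exists s, d.
Qed.

(** The eigenvalues mu are those that the line D_c would have. *)
Definition compatible c mu := forall s d, proper_subtree s t -> below (inl d) s ->
  mu d.1 = (c s * (c s + 2))%:R.

Lemma compatible_of_eigenvector c mu w : root_coloring l c t -> w \in Dline R l t c ->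
  w != 0 -> joint_eigenvector xi dir mu w -> compatible c mu.
Proof.
move=> ct wt w0 wmu s d st ds; have := wmu d.1.
rewrite (Dline_edge tP isT ct wt st ds) => /eqP; rewrite -subr_eq0 -scalerBl scaler_eq0.
by rewrite (negbTE w0) orbF subr_eq0 => /eqP.
Qed.

(** A subtree is a leaf, whose color is prescribed by l, or it hangs from an internal
   edge, whose eigenvalue determines the color. *)
Lemma compatible_unique c c' mu : root_coloring l c t -> root_coloring l c' t ->
  compatible c mu -> compatible c' mu -> forall s, proper_subtree s t -> c s = c' s.
Proof.
move=> ct c't cmu c'mu s st.
have leaf i c1 : root_coloring l c1 t -> proper_subtree (Leaf i) t -> c1 (Leaf i) = l i.
  by case=> c1x c1y _ [ix|iy]; [exact: (tree_coloring_sub c1x ix)|exact: (tree_coloring_sub c1y iy)].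
case: s st => [i|y z] st; first by rewrite !leaf.
have [f fs] := rooted_subtree r0 st; have [d fd] := below_node fs; rewrite fd in fs.
apply/eqP; rewrite -(eqr_casimir R[i]).
by rewrite -(cmu _ _ st fs) -(c'mu _ _ st fs).
Qed.

(** Decompose w along the lines D_c, which span the invariant vectors. The components
   whose eigenvalues are not mu cancel out, and the others lie on a single line. *)
Lemma eigenvector_Dline mu w : w \in Hinv R l -> joint_eigenvector xi dir mu w -> w != 0 ->
  exists c, [/\ root_coloring l c t, compatible c mu & w \in Dline R l t c].
Proof.
move=> wH wmu w0; have [k [u [c [cP uP wE]]]] := Dline_span xio tP isT wH.
have /choice[S /choice[D SP]] := rooted_edges_below.
pose lam i a : R[i] := (c i (S a) * (c i (S a) + 2))%:R.
have ulam i a : Q a (u i) = lam i a *: u i.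
  have [st ds da] := SP a.
  by rewrite -{1}da (Dline_edge tP isT (cP i) (uP i) st ds).
have wmu' a : Q a (\sum_i u i) = mu a *: \sum_i u i by rewrite -wE; exact: wmu.
have := joint_eigen_sum ulam wmu'; rewrite -wE => sumE.
have good i : lam i = mu -> u i != 0 -> compatible (c i) mu.
  by move=> lmu ui0; apply: compatible_of_eigenvector (cP i) (uP i) ui0 _ => a; rewrite ulam lmu.
have [i0 [i0mu ui0]] : exists i, lam i = mu /\ u i != 0.
  apply: contrapT => no; move: w0; rewrite sumE big1 ?eqxx // => i /asboolP imu.
  by apply/eqP; apply: contrapT => /negP ui0; apply: no; exists i.
exists (c i0); split; [exact: cP|exact: good|].
rewrite sumE; apply: memv_suml => i /asboolP imu.
have [->|ui] := eqVneq (u i) 0; first exact: mem0v.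
rewrite (@Dline_ext R n l (c i0) (c i)) // => s.
by apply: compatible_unique; [exact: cP|exact: cP|exact: good|exact: good].
Qed.

Lemma Qop_preserves a : (Q a @: Hinv R l <= Hinv R l)%VS.
Proof.
apply/subvP => _ /memv_imgP[w wH ->].
have [k [u [c [cP uP ->]]]] := Dline_span xio tP isT wH.
have [s [d [st ds <-]]] := rooted_edges_below a.
rewrite lfun_sum; apply: memv_suml => i _.
rewrite (Dline_edge tP isT (cP i) (uP i) st ds); apply: memvZ.
exact: (subvP (Dline_sub R l tP isT (c i)) _ (uP i)).
Qed.

(** Each internal edge receives the color of the subtree hanging from it. At every
   vertex the three flags are, up to order, those of a node and of its children. *)
Lemma compatible_coloring c mu : root_coloring l c t -> compatible c mu ->
  exists phi : edge G -> nat, [/\ admissible_coloring phi, forall i, phi (inr i) = l i &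
    forall a, mu a = color_eigenvalue R phi a].
Proof.
move=> ct cmu; have /choice[S /choice[D SP]] := rooted_edges_below.
have sub s : proper_subtree s t -> tree_coloring l c s.
  by case: ct => cx cy _ [sx|sy]; [exact: tree_coloring_sub cx sx|exact: tree_coloring_sub cy sy].
pose phi (e : edge G) := match e with inl a => c (S a) | inr i => l i end.
have phiE f s : proper_subtree s t -> below f s -> phi (fedge f) = c s.
  case: f => [d|i] st fs /=.
    have [S_t S_d d1] := SP d.1; apply/eqP; rewrite -(eqr_casimir R[i]).
    by rewrite -(cmu _ _ S_t S_d) d1 (cmu _ _ st fs).
  by case: s st fs => [j|y z] st /=; [move=> [->]; rewrite (sub _ st)|case=> d [f1 [f2 []]]].
exists phi; split=> // [f1 f2 f3 u3 f12 f23|a]; last first.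
  by have [S_t S_d <-] := SP a; rewrite (cmu _ _ S_t S_d) /color_eigenvalue /phi; have [_ _ ->] := SP a.
have [d [y [z [st dv b]]]] := rooted_vertex acyclicG connectedG (fvert f1) r0.
have [e [g1 [g2 [[eE] star3 g1y g2z]]]] := b; rewrite -eE in star3.
have cg0 : clebsch_gordan (phi (fedge g1)) (phi (fedge g2)) (phi (inl d.1)).
  have [_ _] := sub _ st.
  rewrite (phiE g1 y) ?(phiE g2 z) -?(phiE (inl d) _ st b) //.
    by apply: proper_subtree_child st _; right.
  by apply: proper_subtree_child st _; left.
have [_ mem3] := star3.
(* f1, f2, f3 are these three flags in some order, and the condition is symmetric. *)
have in3 f : fvert f = fvert f1 -> f \in [:: inl (drev d); g1; g2] by rewrite -mem3 dv => ->.
have := in3 f1 erefl; have := in3 f2 (esym f12); have := in3 f3 (esym (etrans f12 f23)).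
have [cg1 cg2] := clebsch_gordan_perm cg0.
have [cg3 cg4] := clebsch_gordan_perm cg1; have [cg5 cg6] := clebsch_gordan_perm cg2.
have [cg7 cg8] := clebsch_gordan_perm cg4; have [cg9 cg10] := clebsch_gordan_perm cg5.
move: u3; rewrite !inE => u3 /or3P[] /eqP e3 /or3P[] /eqP e2 /or3P[] /eqP e1;
  rewrite e1 e2 e3 /= ?inE ?eqxx ?orbT ?andbF //= in u3 *.
Qed.

Lemma coloring_compatible (phi : edge G -> nat) :
  admissible_coloring phi -> (forall i, phi (inr i) = l i) ->
  exists c, root_coloring l c t /\
    compatible c (color_eigenvalue R phi).
Proof.
move=> adm phil; have [c cP] := coloring_of_edges phi.
have [xb yb] := r0; exists c; split; last first.
  by move=> s d _ ds; rewrite /color_eigenvalue (cP _ _ ds).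
split.
- by apply: (below_coloring adm phil _ xb) => g s _; apply: cP.
- by apply: (below_coloring adm phil _ yb) => g s _; apply: cP.
- by rewrite (cP _ _ xb) (cP _ _ yb).
Qed.

Lemma joint_space_Dline c mu : root_coloring l c t -> compatible c mu ->
  joint_space xi l dir mu = Dline R l t c.
Proof.
move=> ct cmu; apply/vspaceP => w; apply/(mem_joint_space Qop_preserves)/idP => [[wH wmu]|wt].
  have [->|w0] := eqVneq w 0; first exact: mem0v.
  have [c' [c't c'mu wt]] :=
    eigenvector_Dline wH wmu w0.
  rewrite (@Dline_ext R n l c c') // => s; exact: (compatible_unique ct c't cmu c'mu).
split; first exact: (subvP (Dline_sub R l tP isT c) _ wt).
apply: (Dline_eigenvector tP isT ct _ wt) => a.
have [s [d [st ds da]]] := rooted_edges_below a.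
by exists s, d; split=> //; rewrite -da; apply: cmu.
Qed.

Lemma joint_eigenvalueP mu : joint_eigenvalue xi l dir mu <->
  exists c, root_coloring l c t /\ compatible c mu.
Proof.
have dimE : joint_eigenvalue xi l dir mu <-> joint_space xi l dir mu != 0%VS.
  by rewrite /joint_eigenvalue -!dimv_eq0 dim_joint_space.
rewrite dimE; split=> [J0|[c [ct cmu]]]; last first.
  by rewrite (joint_space_Dline ct cmu) -dimv_eq0 (dim_Dline xio tP).
have := memv_pick (joint_space xi l dir mu) => /(mem_joint_space Qop_preserves)[wH wmu].
have w0 : vpick (joint_space xi l dir mu) != 0 by rewrite vpick0.
have [c [ct cmu _]] := eigenvector_Dline wH wmu w0.
by exists c.
Qed.

Lemma joint_eigenspace_simple mu : joint_eigenvalue xi l dir mu ->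
  \dim (joint_eigenspace xi l dir mu) = 1%N.
Proof.
move=> /joint_eigenvalueP[c [ct cmu]].
by rewrite -dim_joint_space (joint_space_Dline ct cmu) (dim_Dline xio tP).
Qed.

Lemma Hop_commute a b :
  (Hop xi l (a, dir a) \o Hop xi l (b, dir b) =
   Hop xi l (b, dir b) \o Hop xi l (a, dir a))%VF.
Proof.
apply: comp_lfun_commute => v; apply: subvs_inj.
have E a1 b1 : vsval (Hop xi l (a1, dir a1) (Hop xi l (b1, dir b1) v)) = Q a1 (Q b1 (vsval v)) :=
  etrans (HopE Qop_preserves a1 _) (congr1 (Q a1) (HopE Qop_preserves b1 v)).
apply: (etrans (E a b)); apply: (etrans _ (esym (E b a))).
have [k [u [c [cP uP ->]]]] := Dline_span xio tP isT (subvsP v).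
apply: lfun_commute_sum => i.
have scalar a' : exists m : R[i], Q a' (u i) = m *: u i.
  have [s [d [st ds <-]]] := rooted_edges_below a'.
  by eexists; apply: (Dline_edge tP isT (cP i) (uP i) st ds).
have [ma ua] := scalar a; have [mb ub] := scalar b.
apply: (lfun_commute_eigen ua ub).
Qed.

Lemma joint_eigenvalue_coloring mu : joint_eigenvalue xi l dir mu <->
  exists phi : edge G -> nat, [/\ admissible_coloring phi, forall i, phi (inr i) = l i &
    forall a, mu a = color_eigenvalue R phi a].
Proof.
rewrite joint_eigenvalueP; split=> [[c [ct cmu]]|[phi [adm phil muE]]].
  exact: (compatible_coloring ct cmu).
have [c [ct cphi]] := coloring_compatible adm phil.
by exists c; split=> // s d st ds; rewrite muE (cphi s d).
Qed.

(** The line of the parenthesising s0 is contained in the joint eigenspace; both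
   have dimension one. *)
Lemma joint_space_associated (s0 : btree n) nv (ne : btree n -> edge G) phi :
  perm_eq (leaves s0) (enum 'I_n) -> is_node s0 -> associated s0 nv ne ->
  admissible_coloring phi -> (forall i, phi (inr i) = l i) ->
  joint_space xi l dir (color_eigenvalue R phi) = Dline R l s0 (fun s => phi (ne s)).
Proof.
move=> s0P s0N assoc adm phil.
have c0 := associated_root_coloring trivalentG s0P assoc adm phil s0N.
have J : joint_eigenvalue xi l dir (color_eigenvalue R phi).
  by apply/joint_eigenvalue_coloring; exists phi.
apply/esym/eqP; rewrite eqEdim dim_joint_space (joint_eigenspace_simple J).
rewrite (dim_Dline xio s0P) // andbT; apply/subvP => w wD.
apply/(mem_joint_space Qop_preserves); split; first exact: (subvP (Dline_sub R l s0P s0N _) _ wD).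
apply: (Dline_eigenvector s0P s0N c0 _ wD) => a.
have [s [st sa]] := ne_surj assoc (inl a).
have [|f [fs fb _]] := associated_below trivalentG s0P assoc st; first by left; exists a.
case: f fs fb => [d|i]; last by rewrite sa.
rewrite /= sa => -[da] ds; exists s, d; split=> //.
by rewrite /color_eigenvalue sa.
Qed.

End Rooted.
End JointSpectrum.

Theorem theorem2p1 (R : realType) (xi : 'I_3 -> 'M[R[i]]_2)
    (hxi : su2_orthonormal xi) (n : nat) (hn : (4 <= n)%N)
    (G : graph n) (hG : admissible_graph G) (l : 'I_n -> nat)
    (dir : iedge G -> bool) :
  (* the operators Q_{I(a)} do restrict to H_l *)
  (forall a : iedge G,
     (Qop xi l (Iset (a, dir a)) @: Hinv R l <= Hinv R l)%VS) /\
  (* the operators H_a commute *)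
  (forall a b : iedge G,
     (Hop xi l (a, dir a) \o Hop xi l (b, dir b) =
      Hop xi l (b, dir b) \o Hop xi l (a, dir a))%VF) /\
  (* the joint eigenvalues *)
  (forall mu : iedge G -> R[i],
     joint_eigenvalue xi l dir mu <->
     exists phi : edge G -> nat,
       [/\ admissible_coloring phi,
           forall i : 'I_n, phi (inr i) = l i &
           forall a : iedge G, mu a = color_eigenvalue R phi a]) /\
  (* each of them is simple *)
  (forall mu : iedge G -> R[i],
     joint_eigenvalue xi l dir mu ->
     \dim (joint_eigenspace xi l dir mu) = 1%N) /\
  (* the joint eigenspaces when G comes from a parenthesising *)
  (forall (t : btree n) (nv : btree n -> vert G) (ne : btree n -> edge G),
     parenthesising t -> associated t nv ne ->
     forall phi : edge G -> nat,
       admissible_coloring phi -> (forall i : 'I_n, phi (inr i) = l i) ->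
       (linfun (@vsval _ _ (Hinv R l)) @:
          joint_eigenspace xi l dir (color_eigenvalue R phi))%VS =
       Dline R l t (fun s => phi (ne s))).
Proof.
have [connectedG acyclicG trivalentG] := hG.
have [a0 _] := internal_edge_exists connectedG trivalentG hn.
pose d0 : dart G := (a0, true).
have [x0 x0b] := below_exists acyclicG trivalentG (inl d0).
have [y0 y0b] := below_exists acyclicG trivalentG (inl (drev d0)).
have r0 : rooted_at d0 x0 y0 by [].
split; first exact (Qop_preserves l dir hxi connectedG acyclicG r0).
split; first exact (Hop_commute l dir hxi connectedG acyclicG r0).
split; first exact (joint_eigenvalue_coloring l dir hxi connectedG acyclicG r0).
split; first exact (@joint_eigenspace_simple _ _ _ _ _ _ hxi connectedG acyclicG _ _ _ r0).
move=> t nv ne tE assoc phi adm phil.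
apply: (joint_space_associated dir hxi connectedG acyclicG trivalentG r0 _ _ assoc) => //.
  by rewrite tE.
have : size (leaves t) = n by rewrite tE size_enum_ord.
by case: (t) => //= i n1; rewrite -n1 in hn.
Qed.
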